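(* Let $\mathcal A$ be a unital $C^*$-algebra, $k\in\mathcal A$ positive and invertible, $n\ge1$, let $\alpha_0,\dots,\alpha_n$ be positive integers and $d>-1$ a real number. For $A_0,\dots,A_n>0$ put $$G_{\alpha_0,\dots,\alpha_n}(A_0,\dots,A_n)=\frac1{2\pi}\int_{-\infty}^\infty e^{-ix}(A_0-ix)^{-\alpha_0}\cdots(A_n-ix)^{-\alpha_n}\,dx .$$ Then, with $\mathbf z_j=1-\mathbf y_1\cdots\mathbf y_j$ for $j=1,\dots,n$, $$(k^{(0)})^{d+1}\int_0^\infty G_{\alpha_0,\dots,\alpha_n}(k^{(0)}r,\dots,k^{(n)}r)\,r^d\,dr=\frac{\Gamma(d+1)}{\Gamma(\alpha_0+\cdots+\alpha_n)}\,F_D^{(n)}\big(d+1;\alpha_1,\dots,\alpha_n;\alpha_0+\cdots+\alpha_n;\mathbf z_1,\dots,\mathbf z_n\big).$$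
   Context: For $j=0,\dots,n$, $k^{(j)}=1\otimes\cdots\otimes k\otimes\cdots\otimes1\in\mathcal A^{\otimes(n+1)}$ with $k$ in the $j$-th slot (slots numbered $0,\dots,n$); for $j=1,\dots,n$, $\mathbf y_j=(k^{(j-1)})^{-1}k^{(j)}$, so $k^{(j)}=k^{(0)}\mathbf y_1\cdots\mathbf y_j$. The $k^{(j)}$ are commuting positive invertible elements, and functions of them are defined by joint continuous functional calculus. $F_D^{(n)}$ is the Lauricella function of type $D$: for $\alpha_j>0$, $c>\alpha_1+\cdots+\alpha_n$ and real $x_j<1$, $$F_D^{(n)}(a;\alpha_1,\dots,\alpha_n;c;x_1,\dots,x_n)=\frac{\Gamma(c)}{\Gamma(\alpha_1)\cdots\Gamma(\alpha_n)\Gamma(c-\sum_j\alpha_j)}\int_{R}\Big(1-\sum_j u_j\Big)^{c-\sum_j\alpha_j-1}\prod_j u_j^{\alpha_j-1}\Big(1-\sum_jx_ju_j\Big)^{-a}du_1\cdots du_n,$$ where $R=\{u_1,\dots,u_n\ge0,\ \sum_j u_j\le1\}$. *)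

(* Defs.v *)
From HB Require Import structures.
From mathcomp Require Import all_boot all_order all_algebra.
From mathcomp Require Import all_classical all_reals all_analysis.
From mathcomp Require Import complex.

Set Implicit Arguments.
Unset Strict Implicit.
Unset Printing Implicit Defensive.

Import Order.TTheory GRing.Theory Num.Theory.
Import numFieldNormedType.Exports.

Local Open Scope classical_set_scope.
Local Open Scope ring_scope.
Local Open Scope complex_scope.

(* Unital C*-algebras over the complex numbers R[i].  The norm is a field of the
   structure because the hierarchy admits no join of unitRingType with the
   library's normed modules (numDomainType already inherits from both).
   Inverses come from unitRingType, which is no restriction classically; the
   zero algebra is excluded. *)
HB.mixin Record isCStar (R : realType) A of GRing.UnitAlgebra R[i] A := {
  star : A -> A ;
  cnorm : A -> R ;
  starD : forall x y : A, star (x + y) = star x + star y ;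
  starZ : forall (c : R[i]) (x : A), star (c *: x) = c^* *: star x ;
  starM : forall x y : A, star (x * y) = star y * star x ;
  starK : involutive star ;
  cnorm_eq0 : forall x : A, cnorm x = 0 -> x = 0 ;
  cnormD : forall x y : A, cnorm (x + y) <= cnorm x + cnorm y ;
  cnormZ : forall (c : R[i]) (x : A), cnorm (c *: x) = complex.Re `|c| * cnorm x ;
  cnormM : forall x y : A, cnorm (x * y) <= cnorm x * cnorm y ;
  cnorm_star : forall x : A, cnorm (star x * x) = cnorm x ^+ 2 ;
  cnorm_complete : forall u : nat -> A,
    (forall eps, 0 < eps -> exists N, forall i j, (N <= i)%N -> (N <= j)%N ->
       cnorm (u i - u j) < eps) ->
    exists l, forall eps, 0 < eps -> exists N, forall i, (N <= i)%N ->
      cnorm (u i - l) < eps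
}.

#[short(type="cstarAlgType")]
HB.structure Definition CStarAlgebra (R : realType) :=
  {A of GRing.UnitAlgebra R[i] A & isCStar R A}.

Section CStarAlgebraTheory.
Variables (R : realType) (A : cstarAlgType R).

(* Self-adjoint with spectrum in [0, +oo[ ; in R[i], 0 <= l means that l is
   real and nonnegative. *)
Definition cstar_positive (a : A) : Prop :=
  star a = a /\ forall l : R[i], a - l%:A \isn't a GRing.unit -> 0 <= l.

Definition norm_closure (D : set A) : set A :=
  [set x | forall eps : R, 0 < eps -> exists2 y, D y & cnorm (x - y) < eps].

Definition cstar_subalgebra (D : set A) : Prop :=
  [/\ norm_closure D `<=` D, D 1,
      forall (c : R[i]) x y, D x -> D y -> D (c *: x + y),
      forall x y, D x -> D y -> D (x * y)
    & forall x, D x -> D (star x)].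

Definition generated_cstar (S : set A) : set A :=
  [set x | forall D, cstar_subalgebra D -> S `<=` D -> D x].

(* Only the values of chi on D are relevant. *)
Definition is_character (D : set A) (chi : A -> R[i]) : Prop :=
  [/\ chi 1 = 1,
      forall (c : R[i]) x y, D x -> D y -> chi (c *: x + y) = c * chi x + chi y
    & forall x y, D x -> D y -> chi (x * y) = chi x * chi y].

(* Joint continuous functional calculus of a commuting family b of self-adjoint
   elements: with D = C*(1, b), f(b) is the element of D whose Gelfand transform
   is chi |-> f (chi(b_0), ..., chi(b_(m-1))).  The points (chi(b_j))_j form the
   joint spectrum of b, a subset of R^m, whence the real parts.  The value is
   only meaningful when f is continuous on the joint spectrum. *)
Definition joint_cfc (m : nat) (b : 'I_m -> A) (f : ('I_m -> R) -> R[i]) : A :=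
  xget 0 [set y | generated_cstar (range b) y /\
    forall chi, is_character (generated_cstar (range b)) chi ->
      chi y = f (fun j => complex.Re (chi (b j)))].

End CStarAlgebraTheory.

Definition multilinear (K : pzRingType) (m : nat) (U V : lmodType K)
    (f : ('I_m -> U) -> V) : Prop :=
  forall (j : 'I_m) (a : 'I_m -> U) (c : K) (x y : U),
    f [eta a with j |-> c *: x + y] =
    c *: f [eta a with j |-> x] + f [eta a with j |-> y].

(* tens (a_0, ..., a_(m-1)) = a_0 (x) ... (x) a_(m-1) exhibits B as a
   C*-completion of the m-fold algebraic tensor power of A, with respect to some
   C*-norm.  The fourth clause says that the algebraic tensor power embeds in B:
   a finite sum of elementary tensors vanishes in the algebraic tensor power iff
   every multilinear map kills the corresponding sum. *)
Definition is_cstar_tensor_power (R : realType) (A B : cstarAlgType R)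
    (m : nat) (tens : ('I_m -> A) -> B) : Prop :=
  [/\ multilinear tens,
      tens (fun=> 1) = 1 /\
        (forall a b, tens (fun i => a i * b i) = tens a * tens b),
      forall a, tens (fun i => star (a i)) = star (tens a),
      forall s : seq ('I_m -> A), \sum_(a <- s) tens a = 0 ->
        forall (V : lmodType R[i]) (f : ('I_m -> A) -> V), multilinear f ->
          \sum_(a <- s) f a = 0
    & norm_closure [set b | exists s : seq ('I_m -> A), b = \sum_(a <- s) tens a]
        = setT].

Section Slots.
Variables (R : realType) (A B : cstarAlgType R) (n : nat).
Variables (tens : ('I_n.+1 -> A) -> B) (k : A).

Definition slot (j : 'I_n.+1) : B := tens [eta (fun=> 1) with j |-> k].

(* The indices 0, ..., n-1 of yelt and zelt stand for 1, ..., n. *)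
Definition yelt (j : 'I_n) : B :=
  (slot (widen_ord (leqnSn n) j))^-1 * slot (lift ord0 j).

Definition zelt (j : 'I_n) : B := 1 - \prod_(i < n | (i <= j)%N) yelt i.

End Slots.

Section VectorIntegral.
Variables (R : realType) (V : cstarAlgType R).

(* Norm limit of the Riemann sums over the partitions p_0 <= ... <= p_N of [a, b]
   with tags t_i. *)
Definition is_Riemann_integral (a b : R) (f : R -> V) (v : V) : Prop :=
  forall eps : R, 0 < eps -> exists2 delta : R, 0 < delta &
    forall (N : nat) (p t : nat -> R),
      p 0%N = a -> p N = b ->
      (forall i, (i < N)%N ->
         [/\ p i <= t i, t i <= p i.+1 & p i.+1 - p i < delta]) ->
      cnorm (\sum_(i < N) (p i.+1 - p i)%:C *: f (t i) - v) < eps.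

(* Improper Riemann integral over ]0, +oo[, improper at both ends. *)
Definition is_improper_integral (f : R -> V) (v : V) : Prop :=
  exists2 I : R -> R -> V,
    forall a b : R, 0 < a -> a <= b -> is_Riemann_integral a b f (I a b)
    & forall eps : R, 0 < eps -> exists delta M : R, [/\ 0 < delta, 0 < M &
        forall a b, 0 < a -> a < delta -> M < b -> a <= b ->
          cnorm (I a b - v) < eps].

End VectorIntegral.

Section SpecialFunctions.
Variable R : realType.
Let mu := @lebesgue_measure R.

Definition Gamma (s : R) : R :=
  \int[mu]_(t in `]0, +oo[) (t `^ (s - 1) * expR (- t)).

Definition complex_integral (f : R -> R[i]) : R[i] :=
  (\int[mu]_(x in setT) complex.Re (f x)) +i*
  (\int[mu]_(x in setT) complex.Im (f x)).

(* e^(-ix) is written cos x - i sin x. *)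
Definition Gfun (m : nat) (alpha : 'I_m -> nat) (a : 'I_m -> R) : R[i] :=
  ((2 * pi)^-1)%:C *
  complex_integral (fun x =>
    (cos x -i* sin x) * \prod_(j < m) (a j -i* x) ^- (alpha j)).

Definition cons_vec (n : nat) (x : R) (u : 'I_n -> R) (i : 'I_n.+1) : R :=
  oapp u x (unlift ord0 i).

(* Iterated Lebesgue integral over R^n, which for the nonnegative measurable
   integrands below is the integral over R^n by Tonelli. *)
Fixpoint iterated_integral (n : nat) : (('I_n -> R) -> \bar R) -> \bar R :=
  match n with
  | 0%N => fun f => f (fun=> 0)
  | m.+1 => fun f =>
      (\int[mu]_(x in setT) iterated_integral (fun u => f (cons_vec x u)))%E
  end.

Definition simplex (n : nat) : set ('I_n -> R) :=
  [set u | (forall j, 0 <= u j) /\ \sum_(j < n) u j <= 1].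

Definition lauricellaD (n : nat) (a : R) (alpha : 'I_n -> R) (c : R)
    (x : 'I_n -> R) : R :=
  Gamma c / ((\prod_(j < n) Gamma (alpha j)) * Gamma (c - \sum_(j < n) alpha j)) *
  fine (iterated_integral (fun u : 'I_n -> R =>
    (\1_(@simplex n) u *
     ((1 - \sum_(j < n) u j) `^ (c - \sum_(j < n) alpha j - 1) *
      (\prod_(j < n) u j `^ (alpha j - 1)) *
      (1 - \sum_(j < n) x j * u j) `^ (- a)))%:E)).

End SpecialFunctions.

(* Main.v *)
Require Import Defs.
From mathcomp Require Import all_boot all_order all_algebra.
From mathcomp Require Import all_classical all_reals all_analysis.
From mathcomp Require Import complex measurable_realfun.
From mathcomp Require Import ring lra.
Import Order.TTheory GRing.Theory Num.Theory.
Import numFieldNormedType.Exports.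
Local Open Scope classical_set_scope.
Local Open Scope ring_scope.
Local Open Scope complex_scope.

(* Characters of the commutative C*-algebra D generated by the k^(j) turn the
   identity into a scalar one.  Norms in D are detected by characters: a minimal
   submultiplicative seminorm p with p (x^2) = p(x)^2 and p h = |h| (Zorn) is
   multiplicative, and by Ostrowski's argument p (x - c) = 0 for some scalar c,
   which is the value at x of a character norming h.  Multivariate Bernstein
   polynomials then show that every Lipschitz function of the joint spectrum, which
   lies in a box of positive numbers, is the Gelfand transform of an element of D.

   On the scalar side, (A - ix)^(-m-1) is the characteristic function of the
   density s^m e^(-As) / m! on s >= 0, so by Fourier inversion (Abel summation)
   G(A) is the value at 1 of a convolution of such densities, that is, an integral
   of a Dirichlet density times exp (- (A_0 (1 - sum u_j) + sum A_j u_j)) over the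
   simplex.  By Tonelli, integrating G(Ar) r^d over r > 0 gives Gamma(d+1) times the
   integral of (A_0 (1 - sum u_j) + sum A_j u_j)^(-d-1), from which A_0^(-d-1)
   factors out and leaves the Lauricella function at 1 - A_j / A_0.

   Since r |-> G(Ar) r^d is Lipschitz on compact intervals and has integrable tails,
   uniformly for A in the box, the Riemann sums converge in norm. *)

Set Implicit Arguments.
Unset Strict Implicit.
Unset Printing Implicit Defensive.

(** [joint_cfc] is a description: the element of the generated algebra with a prescribed Gelfand
    transform. Using it takes uniqueness, that is, characters separating points, and existence of an
    element with that transform. The scalar estimates are arranged to deliver existence: G and the
    integrals over [s, t] have explicit Lipschitz constants on the box, and the integral over the
    half-line is a uniform limit of the latter. Three algebras occur, generated by the k^(j), the r
    k^(j) and the z_j. The second equals the first. The third may be smaller, and its characters are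
    not known to extend to D, so the bound that keeps z_j away from the singular value 1 is carried
    over by a norm estimate. The hypothesis n >= 1 supplies two resolvent factors, hence decay 1 /
    (1 + x^2) and an absolutely convergent inversion integral. Densities and weights are
    nonnegative, so that Tonelli and monotonicity do most of the work; trigonometric integrands are
    made nonnegative by adding 1 where needed. *)

Section ComplexModulus.
Variable R : realType.
Implicit Types c z : R[i].

Definition cabs c : R := complex.Re `|c|.

Lemma cabsE c : cabs c = Num.sqrt (complex.Re c ^+ 2 + complex.Im c ^+ 2).
Proof. by rewrite /cabs normc_def. Qed.

Lemma cabs_ge0 c : 0 <= cabs c. Proof. by rewrite cabsE sqrtr_ge0. Qed.

Lemma cabsM c z : cabs (c * z) = cabs c * cabs z.
Proof. exact: Normc.normcM. Qed.

Lemma cabsD c z : cabs (c + z) <= cabs c + cabs z.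
Proof. exact: le_normcD. Qed.

Lemma cabsN c : cabs (- c) = cabs c.
Proof. exact: normcN. Qed.

Lemma cabs0 : cabs 0 = 0. Proof. exact: Normc.normc0. Qed.
Lemma cabs1 : cabs 1 = 1. Proof. exact: Normc.normc1. Qed.

Lemma cabs_real (x : R) : cabs x%:C = `|x|.
Proof. by rewrite cabsE /= expr0n /= addr0 sqrtr_sqr. Qed.

Lemma cabs_eq0 c : cabs c = 0 -> c = 0.
Proof. exact: Normc.eq0_normc. Qed.

Lemma cabsX c n : cabs (c ^+ n) = cabs c ^+ n.
Proof. by elim: n => [|n ih]; rewrite ?cabs1// !exprS cabsM ih. Qed.

Lemma cabs_sqr c : cabs c ^+ 2 = complex.Re c ^+ 2 + complex.Im c ^+ 2.
Proof. by rewrite cabsE sqr_sqrtr// addr_ge0 ?sqr_ge0. Qed.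

Lemma Re_le_cabs c : `|complex.Re c| <= cabs c.
Proof. by rewrite cabsE -sqrtr_sqr ler_wsqrtr// lerDl sqr_ge0. Qed.

Lemma Im_le_cabs c : `|complex.Im c| <= cabs c.
Proof. by rewrite cabsE -sqrtr_sqr ler_wsqrtr// lerDr sqr_ge0. Qed.

Lemma cabs_le_ReIm c : cabs c <= `|complex.Re c| + `|complex.Im c|.
Proof.
rewrite -(@ler_pXn2r _ 2)// ?nnegrE ?cabs_ge0 ?addr_ge0//.
rewrite cabs_sqr -(real_normK (num_real (complex.Re c))).
rewrite -(real_normK (num_real (complex.Im c))) sqrrD lerD2r lerDl.
by rewrite mulrn_wge0// mulr_ge0.
Qed.

Lemma real_lim_exists (u : nat -> R) :
  (forall eps : R, 0 < eps -> exists N, forall i j, (N <= i)%N -> (N <= j)%N ->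
     `|u i - u j| < eps) ->
  exists l : R, forall eps : R, 0 < eps -> exists N, forall i, (N <= i)%N ->
     `|u i - l| < eps.
Proof.
move=> cu; have /cvg_ex[l ul] : cvgn u.
  apply/cauchy_cvgP/cauchy_exP => e e0; have [N uN] := cu _ e0.
  by exists (u N); exists N => // n /= Nn; exact: uN.
exists l => e e0; move/cvgrPdist_lt : ul => /(_ _ e0)[N _ uN].
by exists N => i Ni; rewrite distrC; exact: uN.
Qed.

Lemma cabs_lim_exists (u : nat -> R[i]) :
  (forall eps : R, 0 < eps -> exists N, forall i j, (N <= i)%N -> (N <= j)%N ->
     cabs (u i - u j) < eps) ->
  exists l, forall eps : R, 0 < eps -> exists N, forall i, (N <= i)%N ->
     cabs (u i - l) < eps.
Proof.
move=> cu.
have cvgf (f : R[i] -> R) : (forall x y, f (x - y) = f x - f y) ->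
    (forall x, `|f x| <= cabs x) ->
    exists l : R, forall eps : R, 0 < eps -> exists N, forall i, (N <= i)%N ->
     `|f (u i) - l| < eps.
  move=> fB fle; apply: real_lim_exists => e e0; have [N uN] := cu _ e0.
  by exists N => i j Ni Nj; rewrite -fB (le_lt_trans (fle _))// uN.
have [a ua] := cvgf _ (raddfB _) (@Re_le_cabs).
have [b ub] := cvgf _ (raddfB _) (@Im_le_cabs).
exists (a +i* b) => e e0; have e20 : 0 < e / 2 by rewrite divr_gt0.
have [N uN] := ua _ e20; have [M uM] := ub _ e20.
exists (maxn N M) => i; rewrite geq_max => /andP[Ni Mi].
rewrite (le_lt_trans (cabs_le_ReIm _))// (splitr e) !raddfB/=.
by rewrite ltrD// ?uN ?uM.
Qed.

End ComplexModulus.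

(** * C*-algebras and their characters *)

Section CStarBasics.
Variables (R : realType) (A : cstarAlgType R).
Implicit Types (x y : A) (c : R[i]).

Lemma cnormZE c x : cnorm (c *: x) = cabs c * cnorm x.
Proof. exact: cnormZ. Qed.

Lemma cnorm0 : cnorm (0 : A) = 0.
Proof. by rewrite -(scale0r (0 : A)) cnormZE cabs0 mul0r. Qed.

Lemma cnormN x : cnorm (- x) = cnorm x.
Proof. by rewrite -scaleN1r cnormZE cabsN cabs1 mul1r. Qed.

Lemma cnorm_ge0 x : 0 <= cnorm x.
Proof.
have := cnormD x (- x); rewrite subrr cnorm0 cnormN -mulr2n.
by rewrite pmulrn_lge0.
Qed.

Lemma cnorm_distC x y : cnorm (x - y) = cnorm (y - x).
Proof. by rewrite -cnormN opprB. Qed.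

Lemma star1 : star (1 : A) = 1.
Proof. by rewrite -[LHS]mulr1 -{2}(starK 1) -starM mulr1 starK. Qed.

Lemma cnorm1 : cnorm (1 : A) = 1.
Proof.
have := cnorm_star (1 : A); rewrite star1 mulr1 => /eqP.
rewrite expr2 -{1}(mulr1 (cnorm 1)) -subr_eq0 -mulrBr mulf_eq0.
case/orP => [/eqP/cnorm_eq0/eqP|]; first by rewrite oner_eq0.
by rewrite subr_eq0 => /eqP.
Qed.

Lemma star_inv x : star x = x -> x \is a GRing.unit -> star x^-1 = x^-1.
Proof.
move=> sx ux; apply: (mulIr ux); rewrite mulVr//.
by rewrite -{2}sx -starM mulrV// star1.
Qed.

Section Subalgebra.
Variables (D : set A) (hD : cstar_subalgebra D).

Lemma suba1 : D 1. Proof. by case: hD. Qed.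
Lemma subaZD c x y : D x -> D y -> D (c *: x + y). Proof. by case: hD => _ _ h _ _; apply: h. Qed.
Lemma subaM x y : D x -> D y -> D (x * y). Proof. by case: hD => _ _ _ h _; apply: h. Qed.
Lemma subaS x : D x -> D (star x). Proof. by case: hD => _ _ _ _ h; apply: h. Qed.
Lemma suba0 : D 0. Proof. by rewrite -(addNr 1) -scaleN1r; apply: subaZD; exact: suba1. Qed.
Lemma subaZ c x : D x -> D (c *: x).
Proof. by move=> Dx; rewrite -[_ *: _]addr0; apply: subaZD => //; exact: suba0. Qed.
Lemma subaD x y : D x -> D y -> D (x + y).
Proof. by move=> Dx Dy; rewrite -[x]scale1r; apply: subaZD. Qed.
Lemma subaN x : D x -> D (- x).
Proof. by move=> Dx; rewrite -scaleN1r; apply: subaZ. Qed.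
Lemma subaB x y : D x -> D y -> D (x - y).
Proof. by move=> Dx Dy; apply: subaD => //; apply: subaN. Qed.
Lemma subaX x n : D x -> D (x ^+ n).
Proof. by move=> Dx; elim: n => [|n ih]; [exact: suba1|rewrite exprS; exact: subaM]. Qed.
Lemma subaA c : D (c%:A). Proof. by apply: subaZ; exact: suba1. Qed.
Lemma suba_sum (I : Type) (r : seq I) (P : pred I) (F : I -> A) :
  (forall i, P i -> D (F i)) -> D (\sum_(i <- r | P i) F i).
Proof. by move=> h; elim/big_ind : _ => //; [exact: suba0|exact: subaD]. Qed.
Lemma suba_prod (I : Type) (r : seq I) (P : pred I) (F : I -> A) :
  (forall i, P i -> D (F i)) -> D (\prod_(i <- r | P i) F i).
Proof. by move=> h; elim/big_ind : _ => //; [exact: suba1|exact: subaM]. Qed.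

Lemma suba_lim (u : nat -> A) : (forall n, D (u n)) ->
  (forall eps, 0 < eps -> exists N, forall i j, (N <= i)%N -> (N <= j)%N ->
       cnorm (u i - u j) < eps) ->
  exists2 l, D l & forall eps, 0 < eps -> exists N, forall i, (N <= i)%N ->
      cnorm (u i - l) < eps.
Proof.
move=> Du /cnorm_complete[l ul]; exists l => //.
have [cl _ _ _ _] := hD; apply: cl => eps eps0.
by have [N uN] := ul _ eps0; exists (u N) => //; rewrite cnorm_distC uN.
Qed.

Lemma cnormX x n : cnorm (x ^+ n) <= cnorm x ^+ n.
Proof.
elim: n => [|n ih]; first by rewrite !expr0 cnorm1.
by rewrite !exprS (le_trans (cnormM _ _))// ler_wpM2l// cnorm_ge0.
Qed.

(** The geometric series converges inside D because D is norm closed. Having the right inverse in D,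
    and not merely in A, makes it visible to characters of D. *)
Lemma neumann x : D x -> cnorm x < 1 -> exists2 y, D y & (1 - x) * y = 1.
Proof.
move=> Dx x1; pose q := cnorm x; pose u n := \sum_(i < n) x ^+ i.
have q0 : 0 <= q by exact: cnorm_ge0.
have cq (e : R) : 0 < e -> exists N, forall i, (N <= i)%N -> q ^+ i < e.
  move=> e0; have : q ^+ n @[n --> \oo] --> (0 : R).
    by apply: cvg_expr; rewrite ger0_norm.
  move/cvgrPdist_lt => /(_ _ e0)[N _ uN]; exists N => i /uN /=.
  by rewrite sub0r normrN ger0_norm// exprn_ge0.
(* The telescoping bound (q^i - q^j) / (1 - q) is the one that passes through the induction on j;
   q^j is dropped at the end. *)
have du i j : (i <= j)%N -> cnorm (u j - u i) <= (q ^+ i) / (1 - q).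
  move=> ij; suff : cnorm (u j - u i) <= (q ^+ i - q ^+ j) / (1 - q).
    move/le_trans; apply; rewrite ler_wpM2r ?invr_ge0 ?subr_ge0 ?(ltW x1)//.
    by rewrite gerBl exprn_ge0.
  rewrite -(subnK ij); elim: (j - i)%N => [|n ih].
    by rewrite add0n !subrr cnorm0 mul0r.
  rewrite addSn /u big_ord_recr /= -/(u _) addrAC.
  rewrite (le_trans (cnormD _ _))// (le_trans (lerD ih (cnormX _ _)))//.
  rewrite -/q exprS -subr_ge0 le_eqVlt; apply/orP; left; apply/eqP.
  by field; rewrite subr_eq0 gt_eqF.
have [||y Dy uy] := @suba_lim u.
- by move=> n; apply: suba_sum => i _; exact: subaX.
- move=> e e0; have [|N qN] := cq (e * (1 - q)).
    by rewrite mulr_gt0// subr_gt0.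
  exists N => i j Ni Nj; wlog ij : i j Ni Nj / (i <= j)%N.
    move=> H; have [/H|/ltnW/H] := leqP i j; first exact.
    by rewrite cnorm_distC; exact.
  rewrite cnorm_distC (le_lt_trans (du _ _ ij))// ltr_pdivrMr ?subr_gt0//.
  exact: qN.
exists y => //; apply/subr0_eq/cnorm_eq0/eqP; rewrite eq_le cnorm_ge0 andbT.
apply/ler_addgt0Pl => e e0; rewrite addr0.
have [N1 qN] := cq (e / 2) (divr_gt0 e0 (ltr0Sn _ 1)).
have [|N2 uN] := uy (e / 4); first by rewrite divr_gt0.
pose N := maxn N1 N2.
(* As (1 - x) u_N = 1 - x^N, the defect splits into two small terms; the factor 1 - x has norm at
   most 2, whence e / 4 above. *)
have -> : (1 - x) * y - 1 = (1 - x) * (y - u N) - x ^+ N.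
  rewrite mulrBr (_ : (1 - x) * u N = 1 - x ^+ N); last first.
    by rewrite -(opprB (x ^+ N)) subrX1 -mulNr opprB.
  by rewrite -[RHS]addrA; congr (_ + _); rewrite opprB addrAC subrr add0r.
rewrite (le_trans (cnormD _ _))// cnormN (splitr e) lerD//; last first.
  by rewrite (le_trans (cnormX _ _))// ltW// qN// leq_maxl.
rewrite (le_trans (cnormM _ _))//.
apply: (@le_trans _ _ (2 * (e / 4))); last by lra.
rewrite ler_pM ?cnorm_ge0//.
  by rewrite (le_trans (cnormD _ _))// cnormN cnorm1 (_ : 2 = 1 + 1)// lerD2l ltW.
by rewrite cnorm_distC ltW// uN// leq_maxr.
Qed.

Lemma char0 chi : is_character D chi -> chi 0 = 0.
Proof.
case=> c1 cl _; have := cl (-1) 1 1 suba1 suba1.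
by rewrite scaleN1r addNr c1 mulN1r addNr.
Qed.

Lemma charZ chi c x : is_character D chi -> D x -> chi (c *: x) = c * chi x.
Proof.
move=> hchi Dx; have [_ cl _] := hchi.
by have := cl c x 0 Dx suba0; rewrite (char0 hchi) !addr0.
Qed.

Lemma charA chi c : is_character D chi -> chi c%:A = c.
Proof. by move=> hc; rewrite (charZ _ hc suba1); case: hc => -> _ _; rewrite mulr1. Qed.

Lemma charD chi x y : is_character D chi -> D x -> D y -> chi (x + y) = chi x + chi y.
Proof.
by move=> [_ cl _] Dx Dy; rewrite -[x in LHS]scale1r cl// mul1r.
Qed.

Lemma charN chi x : is_character D chi -> D x -> chi (- x) = - chi x.
Proof. by move=> hc Dx; rewrite -scaleN1r (charZ _ hc Dx) mulN1r. Qed.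

Lemma charB chi x y : is_character D chi -> D x -> D y -> chi (x - y) = chi x - chi y.
Proof. by move=> hc Dx Dy; rewrite (charD hc Dx (subaN Dy)) (charN hc Dy). Qed.

Lemma charM chi x y : is_character D chi -> D x -> D y -> chi (x * y) = chi x * chi y.
Proof. by case=> _ _; apply. Qed.

Lemma char_sum chi (I : Type) (r : seq I) (P : pred I) (F : I -> A) :
  is_character D chi -> (forall i, P i -> D (F i)) ->
  chi (\sum_(i <- r | P i) F i) = \sum_(i <- r | P i) chi (F i).
Proof.
move=> hc DF; elim: r => [|a r ih]; first by rewrite !big_nil (char0 hc).
rewrite !big_cons; case: ifP => // Pa.
by rewrite (charD hc (DF _ Pa)) ?ih//; exact: suba_sum.
Qed.

(** Otherwise z = x / chi x has norm below 1, so 1 - z has a right inverse in D, although chi (1 -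
    z) = 0. *)
Lemma char_le chi x : is_character D chi -> D x -> cabs (chi x) <= cnorm x.
Proof.
move=> hc Dx; rewrite leNgt; apply/negP => lt.
have c0 : chi x != 0.
  by apply/eqP => c0; move: lt; rewrite c0 cabs0 ltNge cnorm_ge0.
have a0 : 0 < cabs (chi x) by rewrite (le_lt_trans _ lt)// cnorm_ge0.
pose z := (chi x)^-1 *: x; have Dz : D z by exact: subaZ.
have z1 : cnorm z < 1.
  rewrite cnormZE -(ltr_pM2l a0) mulrA -cabsM divff// cabs1 mul1r mulr1.
  exact: lt.
have [y Dy zy] := neumann Dz z1.
have /(congr1 chi) := zy.
rewrite (charM hc)//; last by apply: subaB => //; exact: suba1.
rewrite (charB hc suba1 Dz) (charZ _ hc Dx) mulVf//.
case: hc => -> _ _; rewrite subrr mul0r => /esym/eqP; by rewrite oner_eq0.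
Qed.

(** Applying [char_le] to x + it, whose norm squared is at most |x|^2 + t^2, bounds (Im + t)^2 by
    |x|^2 + t^2 for every real t. The term linear in t forces Im = 0; the contradiction takes t with
    2 Im t = |x|^2 + 1. *)
Lemma char_real chi x : is_character D chi -> D x -> star x = x ->
  chi x = (complex.Re (chi x))%:C.
Proof.
move=> hc Dx sx.
have key (t : R) : complex.Re (chi x) ^+ 2 + (complex.Im (chi x) + t) ^+ 2
    <= cnorm x ^+ 2 + t ^+ 2.
  pose w := x + (0 +i* t)%:A.
  have Dw : D w by apply: subaD => //; exact: subaA.
  have sw : star w = x - (0 +i* t)%:A.
    rewrite starD sx starZ star1; congr (_ + _).
    rewrite -scaleNr; congr (_ *: _).
    by apply/eqP; rewrite eq_complex /= oppr0 !eqxx.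
  have := char_le hc Dw.
  rewrite -(@ler_pXn2r _ 2)// ?nnegrE ?cabs_ge0 ?cnorm_ge0//.
  rewrite -(cnorm_star w) sw.
  have -> : (x - (0 +i* t)%:A) * (x + (0 +i* t)%:A) = x * x + (t ^+ 2)%:C%:A.
    rewrite mulrDr !mulrBl !mulr_algl !mulr_algr addrA subrK scalerA.
    rewrite -scaleNr; congr (_ + _ *: _).
    by apply/eqP; rewrite eq_complex /=; apply/andP; split; apply/eqP; ring.
  move/le_trans => /(_ _ (cnormD _ _)); rewrite cnormZE cnorm1 mulr1.
  rewrite cabs_real (ger0_norm (sqr_ge0 _)).
  have -> : x * x = star x * x by rewrite sx.
  rewrite cnorm_star; apply: le_trans.
  rewrite (charD hc Dx (subaA _)) (charA _ hc) cabs_sqr.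
  by case: (chi x) => a b /=; rewrite addr0.
apply/eqP; rewrite eq_complex /= eqxx /=; apply/eqP.
move: key; set b := complex.Im _; set a := complex.Re _ => key.
apply/eqP/negPn/negP => b0.
have := key ((cnorm x ^+ 2 + 1) / (2 * b)).
set t := _ / _; have tb : 2 * b * t = cnorm x ^+ 2 + 1.
  by rewrite /t mulrC divfK// mulf_neq0.
by have := sqr_ge0 a; have := sqr_ge0 b; nra.
Qed.

End Subalgebra.
End CStarBasics.

(** * Gelfand theory *)

Section Gelfand.
Variables (R : realType) (A : cstarAlgType R) (D : set A).
Hypotheses (hD : cstar_subalgebra D)
  (hC : forall x y, D x -> D y -> x * y = y * x).
Implicit Types (x y f : A) (c : R[i]) (p q : A -> R).

(** The condition on squares is what remains of the C*-identity in a commutative algebra. It passes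
    to infima of chains and to localizations, and it determines p on all powers of an element. *)
Record pmseminorm p : Prop := PMSeminorm {
  pm_ge0 : forall x, D x -> 0 <= p x ;
  pm_le : forall x, D x -> p x <= cnorm x ;
  pmD : forall x y, D x -> D y -> p (x + y) <= p x + p y ;
  pmZ : forall c x, D x -> p (c *: x) = cabs c * p x ;
  pmM : forall x y, D x -> D y -> p (x * y) <= p x * p y ;
  pm_sqr : forall x, D x -> p (x * x) = p x ^+ 2
}.

(** Let z = star x x. By commutativity the C*-identity for x^2 reads |x^2|^2 = |z^2|, and z is
    self-adjoint, so |z^2| = |z|^2 = |x|^4. *)
Lemma cnorm_pm : pmseminorm (@cnorm R A).
Proof.
split => //.
- by move=> x _; exact: cnorm_ge0.
- by move=> x y _ _; exact: cnormD.
- by move=> c x _; exact: cnormZE.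
- by move=> x y _ _; exact: cnormM.
- move=> x Dx; have Dsx := subaS hD Dx.
  apply/eqP; rewrite -(@eqrXn2 _ 2) ?exprn_ge0 ?cnorm_ge0//.
  rewrite -(cnorm_star (x * x)); set z := star x * x.
  have -> : star (x * x) * (x * x) = z * z.
    by rewrite starM /z -!mulrA; congr (_ * _); rewrite !mulrA (hC Dsx Dx).
  have sz : star z = z by rewrite /z starM starK.
  by rewrite -{1}sz cnorm_star /z cnorm_star.
Qed.

Section Localization.
Variables (p : A -> R) (hp : pmseminorm p) (f : A).
Hypotheses (Df : D f) (pf0 : 0 < p f).

Let r x n := p (f ^+ n * x) / p f ^+ n.

(* The limit of p (f^n x) / p f^n, for which f acts as multiplication by p f; a
   minimal seminorm agrees with it and is therefore multiplicative. *)
Definition pm_loc x : R := inf (range (r x)).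

Let DfX n : D (f ^+ n). Proof. exact: subaX. Qed.
Let Dfx n x : D x -> D (f ^+ n * x). Proof. by move=> ?; apply: subaM. Qed.

Let r_ge0 x n : D x -> 0 <= r x n.
Proof. by move=> Dx; rewrite divr_ge0 ?exprn_ge0 ?(ltW pf0)// (pm_ge0 hp)//; apply: Dfx. Qed.

Let r_lb x : D x -> has_inf (range (r x)).
Proof. by move=> Dx; split; [exists (r x 0), 0|exists 0 => _ [n _ <-]; exact: r_ge0]. Qed.

Let loc_le x n : D x -> pm_loc x <= r x n.
Proof. by move=> Dx; apply: ge_inf; [case: (r_lb Dx)|exists n]. Qed.

Let le_loc x (a : R) : (forall n, a <= r x n) -> a <= pm_loc x.
Proof. by move=> h; apply: lb_le_inf; [exists (r x 0), 0|move=> _ [n _ <-]]. Qed.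

(** Submultiplicativity makes the quotients nonincreasing, so their infimum is a limit and is
    unaffected by a shift of the index. This turns an inequality into the equality [pm_locM]. *)
Let r_homo x n m : D x -> (n <= m)%N -> r x m <= r x n.
Proof.
move=> Dx; elim: m => [|m ih]; first by rewrite leqn0 => /eqP ->.
rewrite leq_eqVlt => /orP[/eqP ->//|]; rewrite ltnS => /ih; apply: le_trans.
have pfm : 0 < p f ^+ m by rewrite exprn_gt0.
rewrite /r !exprS ler_pdivrMr ?mulr_gt0// mulrCA divfK ?gt_eqF//.
by rewrite -mulrA (pmM hp)//; apply: Dfx.
Qed.

Lemma pm_loc_le x : D x -> pm_loc x <= p x.
Proof. by move=> Dx; have := loc_le 0 Dx; rewrite /r expr0 mul1r divr1. Qed.

Lemma pm_locM x : D x -> pm_loc (f * x) = p f * pm_loc x.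
Proof.
move=> Dx; have Dfx1 : D (f * x) by exact: subaM.
have E n : r (f * x) n = p f * r x n.+1.
  by rewrite /r mulrA -exprSr [p f ^+ _.+1]exprS invfM mulrCA mulVKf ?gt_eqF.
apply/le_anti/andP; split; last first.
  by apply: le_loc => n; rewrite E ler_pM2l//; exact: loc_le.
rewrite -ler_pdivrMl//; apply: le_loc => n; rewrite ler_pdivrMl//.
rewrite (le_trans (loc_le n Dfx1))// E ler_pM2l//.
exact: r_homo.
Qed.

Lemma loc_pm : pmseminorm pm_loc.
Proof.
have loc_ge0 x : D x -> 0 <= pm_loc x by move=> Dx; apply: le_loc => n; exact: r_ge0.
have locM x y : D x -> D y -> pm_loc (x * y) <= pm_loc x * pm_loc y.
  move=> Dx Dy; have Dxy := subaM hD Dx Dy.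
  (* The two indices are independent, so that infima can be taken in one factor at a time; a
     vanishing factor is treated apart, since it cannot be divided out. *)
  have key n m : pm_loc (x * y) <= r x n * r y m.
    apply: (le_trans (loc_le (n + m) Dxy)); rewrite /r mulrACA -invfM -exprD.
    rewrite ler_pM2r ?invr_gt0 ?exprn_gt0//.
    have -> : f ^+ (n + m) * (x * y) = (f ^+ n * x) * (f ^+ m * y).
      by rewrite exprD -!mulrA; congr (_ * _); rewrite !mulrA (hC (DfX m) Dx).
    by apply: pmM => //; apply: Dfx.
  have key2 m : pm_loc (x * y) <= pm_loc x * r y m.
    have := r_ge0 m Dy; rewrite le_eqVlt => /orP[/eqP r0|rp].
      by rewrite -r0 mulr0; have := key 0 m; rewrite -r0 mulr0.
    by rewrite -ler_pdivrMr//; apply: le_loc => n; rewrite ler_pdivrMr.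
  have := loc_ge0 x Dx; rewrite le_eqVlt => /orP[/eqP r0|rp].
    by rewrite -r0 mul0r; have := key2 0; rewrite -r0 mul0r.
  by rewrite -ler_pdivrMl//; apply: le_loc => n; rewrite ler_pdivrMl.
split => //.
- by move=> x Dx; rewrite (le_trans (pm_loc_le Dx))// (pm_le hp).
- move=> x y Dx Dy; have Dxy := subaD hD Dx Dy.
  have key n m : pm_loc (x + y) <= r x n + r y m.
    pose N := maxn n m; apply: (le_trans (loc_le N Dxy)).
    apply: (@le_trans _ _ (r x N + r y N)); last first.
      by rewrite lerD// r_homo// ?leq_maxl ?leq_maxr.
    rewrite /r -mulrDl ler_pM2r ?invr_gt0 ?exprn_gt0// mulrDr.
    by apply: pmD => //; apply: Dfx.
  rewrite -lerBlDr; apply: le_loc => n; rewrite lerBlDr -lerBlDl.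
  by apply: le_loc => m; rewrite lerBlDl.
- move=> c x Dx; have [->|c0] := eqVneq c 0.
    rewrite scale0r cabs0 mul0r; apply/le_anti; rewrite loc_ge0 ?andbT; last exact: suba0.
    have D0 := suba0 hD.
    have := pm_loc_le D0; rewrite -{2}(scale0r 0) (pmZ hp)// cabs0 mul0r.
    exact.
  have a0 : 0 < cabs c.
    by rewrite lt_neqAle cabs_ge0 andbT eq_sym; apply: contra c0 => /eqP/cabs_eq0 ->.
  have E n : r (c *: x) n = cabs c * r x n.
    by rewrite /r -scalerAr (pmZ hp) ?mulrA//; exact: Dfx.
  have Dcx := subaZ hD c Dx.
  apply/le_anti/andP; split.
    rewrite -ler_pdivrMl//; apply: le_loc => n; rewrite ler_pdivrMl//.
    by rewrite -E; exact: loc_le.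
  by apply: le_loc => n; rewrite E ler_pM2l//; exact: loc_le.
- move=> x Dx; have Dxx := subaM hD Dx Dx.
  apply/le_anti/andP; split; first by rewrite expr2 locM.
  apply: le_loc => n.
  (* The reverse inequality: (f^n x)^2 = f^n (f^n x^2), and p (f^n) <= p f^n absorbs one of the two
     powers of f. *)
  apply: (@le_trans _ _ (r x n ^+ 2)).
    by rewrite ler_pXn2r ?nnegrE ?loc_ge0 ?r_ge0//; exact: loc_le.
  have pfn : 0 < p f ^+ n by rewrite exprn_gt0.
  rewrite /r expr_div_n -(pm_sqr hp)//; last exact: Dfx.
  rewrite ler_pdivrMr ?exprn_gt0// (expr2 (p f ^+ n)).
  rewrite [X in _ <= X]mulrA divfK ?gt_eqF//.
  have -> : f ^+ n * x * (f ^+ n * x) = f ^+ n * (f ^+ n * (x * x)).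
    by rewrite -!mulrA; congr (_ * _); rewrite !mulrA (hC (DfX n) Dx).
  rewrite (le_trans (pmM hp (DfX n) (Dfx _ Dxx)))// mulrC ler_wpM2l ?(pm_ge0 hp)//.
    exact: Dfx.
  elim: n {pfn} => [|n ih].
    rewrite !expr0; have := pm_le hp (suba1 hD); rewrite cnorm1; exact.
  rewrite !exprS (le_trans (pmM hp Df (DfX n)))// ler_wpM2l//.
  exact: ltW.
Qed.

End Localization.

(** Repeated squaring gives the powers 2^k. A general n is completed to 2^n: p f^(2^n) <= p (f^(2^n
    - n)) p (f^n) <= p f^(2^n - n) p (f^n), and the common factor cancels. *)
Lemma pmX p f n : pmseminorm p -> p 1 = 1 -> D f -> p (f ^+ n) = p f ^+ n.
Proof.
move=> hp p1 Df; have pf0 := pm_ge0 hp Df.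
have DX m : D (f ^+ m) by exact: subaX.
have leX m : p (f ^+ m) <= p f ^+ m.
  elim: m => [|m ih]; first by rewrite !expr0 p1.
  by rewrite !exprS (le_trans (pmM hp Df (DX m)))// ler_wpM2l.
apply/le_anti; rewrite leX /=.
move: (pf0); rewrite (le_eqVlt 0) => /orP[/eqP z|pos].
  rewrite -z; case: n => [|n]; first by rewrite !expr0 p1.
  by rewrite expr0n /= (pm_ge0 hp).
have e2 k : p (f ^+ (2 ^ k)) = p f ^+ (2 ^ k).
  elim: k => [|k ih]; first by rewrite !expr1.
  by rewrite expnS mul2n -addnn !exprD (pm_sqr hp)// ih expr2.
have nk : (n <= 2 ^ n)%N by rewrite ltnW// ltn_expl.
rewrite -(@ler_pM2l _ (p f ^+ (2 ^ n - n))) ?exprn_gt0//.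
rewrite -exprD subnK// -e2 -{1}(subnK nk) exprD (le_trans (pmM hp _ _))//.
by rewrite ler_wpM2r// (pm_ge0 hp).
Qed.

(** If localizing a minimal p at f keeps the value at h, minimality makes the localization equal to
    p, whence p (f x) = p f p x. For f = h the value is kept by [pmX]. Knowing p (h x) = p h p x,
    one has p (x^n h) = p x^n p h, so the value is also kept by localization at any x with p x >
    0. *)
Lemma exists_multiplicative_seminorm h : D h -> 0 < cnorm h ->
  exists p, [/\ pmseminorm p, p h = cnorm h
    & forall x y, D x -> D y -> p (x * y) = p x * p y].
Proof.
move=> Dh h0.
pose T := {p : A -> R | pmseminorm p /\ p h = cnorm h}.
pose t0 : T := exist _ (@cnorm R A) (conj cnorm_pm erefl).
(* The order is reversed, since Zorn's lemma produces a maximal element. *)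
pose le (s t : T) : bool := `[< forall x, D x -> sval t x <= sval s x >].
have [||F totF|[p [hp ph]] pmin] := @ZL_preorder T t0 le.
- by move=> t; apply/asboolP.
- move=> r s t /asboolP rs /asboolP st; apply/asboolP => x Dx.
  exact: le_trans (st x Dx) (rs x Dx).
- have [->|/set0P[s0 Fs0]] := eqVneq F set0; first by exists t0.
  pose val x := [set sval s x | s in F].
  pose q x := inf (val x).
  have hi x : D x -> has_inf (val x).
    move=> Dx; split; first by exists (sval s0 x), s0.
    by exists 0 => _ [s Fs <-]; case: s {Fs} => s [hs ?] /=; exact: pm_ge0.
  have q_le x s : D x -> F s -> q x <= sval s x.
    by move=> Dx Fs; apply: ge_inf; [case: (hi _ Dx)|exists s].
  have le_q x (a : R) : (forall s, F s -> a <= sval s x) -> a <= q x.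
    move=> H; apply: lb_le_inf; first by exists (sval s0 x), s0.
    by move=> _ [s Fs <-]; exact: H.
  have hs (s : T) : pmseminorm (sval s) by case: s => s [].
  have q_ge0 x : D x -> 0 <= q x by move=> Dx; apply: (le_q) => s _; exact: pm_ge0.
  (* Two members of a chain have a common lower bound in the chain; inequalities with one seminorm
     thus extend to products and sums of values of two. *)
  have minF s t : F s -> F t -> exists2 u, F u & forall x, D x ->
      sval u x <= sval s x /\ sval u x <= sval t x.
    move=> Fs Ft; have [/asboolP st|/asboolP ts] := totF _ _ Fs Ft.
      by exists t => // x Dx; split => //; exact: st.
    by exists s => // x Dx; split => //; exact: ts.
  have qM x y : D x -> D y -> q (x * y) <= q x * q y.
    move=> Dx Dy; have Dxy := subaM hD Dx Dy.
    have key s t : F s -> F t -> q (x * y) <= sval s x * sval t y.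
      move=> Fs Ft; have [u Fu H] := minF _ _ Fs Ft.
      rewrite (le_trans (q_le _ _ Dxy Fu))// (le_trans (pmM (hs u) Dx Dy))//.
      have [? _] := H _ Dx; have [_ ?] := H _ Dy.
      by rewrite ler_pM// (pm_ge0 (hs u)).
    have key2 t : F t -> q (x * y) <= q x * sval t y.
      move=> Ft; have := pm_ge0 (hs t) Dy; rewrite le_eqVlt => /orP[/eqP r0|rp].
        by rewrite -r0 mulr0; have := key _ _ Fs0 Ft; rewrite -r0 mulr0.
      by rewrite -ler_pdivrMr//; apply: (le_q) => n Fn; rewrite ler_pdivrMr//; exact: key.
    have := q_ge0 x Dx; rewrite le_eqVlt => /orP[/eqP r0|rp].
      by rewrite -r0 mul0r; have := key2 _ Fs0; rewrite -r0 mul0r.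
    by rewrite -ler_pdivrMl//; apply: (le_q) => n Fn; rewrite ler_pdivrMl//; exact: key2.
  have hq : pmseminorm q.
    split => //.
    + by move=> x Dx; rewrite (le_trans (q_le _ _ Dx Fs0))// (pm_le (hs _)).
    + move=> x y Dx Dy; have Dxy := subaD hD Dx Dy.
      have key s t : F s -> F t -> q (x + y) <= sval s x + sval t y.
        move=> Fs Ft; have [u Fu H] := minF _ _ Fs Ft.
        rewrite (le_trans (q_le _ _ Dxy Fu))// (le_trans (pmD (hs u) Dx Dy))//.
        have [? _] := H _ Dx; have [_ ?] := H _ Dy.
        by rewrite lerD.
      rewrite -lerBlDr; apply: (le_q) => n Fn; rewrite lerBlDr -lerBlDl.
      by apply: (le_q) => m Fm; rewrite lerBlDl; exact: key.
    + move=> c x Dx; have [->|c0] := eqVneq c 0.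
        rewrite scale0r cabs0 mul0r; apply/le_anti.
        rewrite q_ge0 ?andbT; last exact: suba0.
        have D0 := suba0 hD.
        have := q_le _ _ D0 Fs0; rewrite -{2}(scale0r 0) (pmZ (hs _))// cabs0 mul0r.
        exact.
      have a0 : 0 < cabs c.
        by rewrite lt_neqAle cabs_ge0 andbT eq_sym; apply: contra c0 => /eqP/cabs_eq0 ->.
      have Dcx := subaZ hD c Dx.
      apply/le_anti/andP; split.
        rewrite -ler_pdivrMl//; apply: (le_q) => n Fn; rewrite ler_pdivrMl//.
        by rewrite -(pmZ (hs n) _ Dx); exact: q_le.
      by apply: (le_q) => n Fn; rewrite (pmZ (hs n) _ Dx) ler_pM2l//; exact: q_le.
    + move=> x Dx; have Dxx := subaM hD Dx Dx.
      apply/le_anti/andP; split; first by rewrite expr2 qM.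
      apply: (le_q) => s Fs; rewrite (pm_sqr (hs s) Dx).
      by rewrite ler_pXn2r ?nnegrE ?q_ge0 ?(pm_ge0 (hs s))//; exact: q_le.
  have qh : q h = cnorm h.
    apply/le_anti/andP; split; first exact: (pm_le hq).
    by apply: (le_q) => -[s [hs1 e]] Fs /=; rewrite e.
  exists (exist _ q (conj hq qh)) => s Fs; apply/asboolP => x Dx /=.
  exact: q_le.
have locE f : D f -> 0 < p f -> pm_loc p f h = cnorm h ->
    forall x, D x -> p (f * x) = p f * p x.
  move=> Df pf0 lh.
  pose s : T := exist _ (pm_loc p f) (conj (loc_pm hp Df pf0) lh).
  have /pmin /asboolP/= H : le (exist _ p (conj hp ph)) s.
    by apply/asboolP => x Dx; exact: pm_loc_le.
  have E x : D x -> pm_loc p f x = p x.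
    by move=> Dx; apply/le_anti; rewrite pm_loc_le//=; exact: H.
  by move=> x Dx; rewrite -E ?pm_locM ?E//; exact: subaM.
have ph0 : 0 < p h by rewrite ph.
have D1 := suba1 hD.
have p1 : p 1 = 1.
  apply/le_anti/andP; split; first by rewrite -(cnorm1 A); exact: (pm_le hp).
  have := pmM hp Dh D1; rewrite mulr1 => H.
  by rewrite -(ler_pM2l ph0) mulr1.
have hmul x : D x -> p (h * x) = p h * p x.
  apply: locE => //; apply/le_anti/andP; split.
    by rewrite -ph; exact: pm_loc_le.
  apply: lb_le_inf; first by exists (p (h ^+ 0 * h) / p h ^+ 0), 0%N.
  move=> _ [n _ <-]; rewrite -exprSr !pmX// exprS mulfK ?ph//.
  by rewrite gt_eqF// exprn_gt0.
exists p; split => // x y Dx Dy.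
have := pm_ge0 hp Dx; rewrite le_eqVlt => /orP[/eqP px0|px0].
  rewrite -px0 mul0r; apply/le_anti; rewrite (pm_ge0 hp) ?andbT; last exact: subaM.
  by have := pmM hp Dx Dy; rewrite -px0 mul0r.
apply: locE => //; apply/le_anti/andP; split.
  by rewrite -ph; exact: pm_loc_le.
apply: lb_le_inf; first by exists (p (x ^+ 0 * h) / p x ^+ 0), 0%N.
move=> _ [n _ <-]; rewrite -(hC Dh (subaX hD n Dx)) hmul; last exact: subaX.
by rewrite pmX// mulfK ?ph// gt_eqF// exprn_gt0.
Qed.

End Gelfand.

(** * From multiplicative seminorms to characters *)

Section Characters.
Variables (R : realType) (A : cstarAlgType R) (D : set A).
Hypotheses (hD : cstar_subalgebra D)
  (hC : forall x y, D x -> D y -> x * y = y * x).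
Implicit Types (x y f : A) (c : R[i]).

Section Ostrowski.
Variables (p : A -> R) (hp : pmseminorm D p) (p1 : p 1 = 1).
Hypothesis pMul : forall x y, D x -> D y -> p (x * y) = p x * p y.

Let DA c : D c%:A. Proof. exact: subaA. Qed.
Let DB x c : D x -> D (x - c%:A). Proof. by move=> Dx; apply: subaB. Qed.

Lemma pm_alg c : p c%:A = cabs c.
Proof. by rewrite (pmZ hp) ?p1 ?mulr1//; exact: suba1. Qed.

Lemma pmN x : D x -> p (- x) = p x.
Proof. by move=> Dx; rewrite -scaleN1r (pmZ hp)// cabsN cabs1 mul1r. Qed.

(* z^(n+1) - c^(n+1) is the product of z - c and of n further translates of z,
   each of seminorm at least m. *)
Lemma ostrowski_step z (m : R) c n : D z -> 0 <= m ->
  (forall l : R[i], m <= p (z - l%:A)) ->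
  m ^+ n * p (z - c%:A) <= p z ^+ n.+1 + cabs c ^+ n.+1.
Proof.
move=> Dz m0 mp; pose q : {poly R[i]} := 'X^(n.+1) - (c ^+ n.+1)%:P.
have [s] := closed_field_poly_normal q.
rewrite /q lead_coefXnsubC// scale1r -/q => qE.
have cs : c \in s.
  by rewrite -root_prod_XsubC -qE /root /q !hornerE subrr.
have sz : size (rem c s) = n.
  rewrite size_rem// -[size s]/(size s).+1.-1 -(size_prod_XsubC _ id) -qE.
  by rewrite size_XnsubC.
have zE : z ^+ n.+1 - (c ^+ n.+1)%:A =
    (z - c%:A) * \prod_(r <- rem c s) (z - r%:A).
  have := congr1 (horner_alg z) qE.
  rewrite rmorphB rmorphXn /= horner_algX horner_algC => ->.
  rewrite (perm_big _ (perm_to_rem cs)) /= big_cons rmorphM rmorph_prod rmorphB /=.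
  rewrite horner_algX horner_algC; congr (_ * _).
  by apply: eq_bigr => r _; rewrite rmorphB /= horner_algX horner_algC.
have Dprod (t : seq R[i]) : D (\prod_(r <- t) (z - r%:A)).
  by apply: suba_prod => // r _; exact: DB.
have prod_ge (t : seq R[i]) : m ^+ size t <= p (\prod_(r <- t) (z - r%:A)).
  elim: t => [|a t ih]; first by rewrite big_nil p1.
  by rewrite big_cons exprS pMul//; [rewrite ler_pM// exprn_ge0|exact: DB].
rewrite mulrC (@le_trans _ _ (p (z ^+ n.+1 - (c ^+ n.+1)%:A)))//.
  rewrite zE pMul//; last exact: DB.
  by rewrite ler_wpM2l ?(pm_ge0 hp)//; [exact: DB|rewrite -sz].
have DX k : D (z ^+ k) by exact: subaX.
rewrite -scaleNr (le_trans (pmD hp (DX _) (DA _)))// pm_alg cabsN cabsX lerD2r.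
by rewrite (pmX hD _ hp p1 Dz).
Qed.

(** Let m be the infimum of p (x - c). If m = 0, near-minimizers c form a Cauchy sequence, because
    |c - d| <= p (x - c) + p (x - d). If m > 0, a near-minimizer stays one after translation by w
    with |w| = m / 2 < m; enough translations contradict the same inequality. *)
Lemma ostrowski x : D x -> exists c, p (x - c%:A) = 0.
Proof.
move=> Dx; pose V := range (fun c => p (x - c%:A)); pose m := inf V.
have hV : has_inf V.
  by split; [exists (p (x - 0%:A)), 0|exists 0 => _ [c _ <-]; rewrite (pm_ge0 hp)//; exact: DB].
have mle c : m <= p (x - c%:A) by apply: ge_inf; [case: hV|exists c].
have m0 : 0 <= m.
  by apply: lb_le_inf; [case: hV|move=> _ [c _ <-]; rewrite (pm_ge0 hp)//; exact: DB].
have mlt (e : R) : 0 < e -> exists c, p (x - c%:A) < m + e.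
  by move=> /(inf_adherent)/(_ hV)[_ [c _ <-] ?]; exists c.
have tri c d : cabs (c - d) <= p (x - c%:A) + p (x - d%:A).
  have -> : cabs (c - d) = p (- (x - c%:A) + (x - d%:A)).
    by rewrite -pm_alg scalerBl opprB addrA subrK.
  rewrite (le_trans (pmD hp _ _))//; [by apply: subaN => //; exact: DB|exact: DB|].
  by rewrite pmN//; exact: DB.
have shift c d : x - c%:A - d%:A = x - (c + d)%:A by rewrite scalerDl opprD addrA.
move: m0; rewrite le_eqVlt => /orP[/eqP me|mpos].
  have me0 : m = 0 by [].
  have /choice[u uP] : forall n, exists c, p (x - c%:A) < n.+1%:R^-1.
    by move=> n; have [|c] := mlt n.+1%:R^-1; [rewrite invr_gt0|rewrite me0 add0r; exists c].
  have small (e : R) : 0 < e -> exists N, forall i, (N <= i)%N -> p (x - (u i)%:A) < e.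
    move=> e0; have [N _ hN] := near_infty_natSinv_lt (PosNum e0).
    by exists N => i /hN /= ?; rewrite (lt_trans (uP i)).
  have [|l ul] := @cabs_lim_exists R u.
    move=> e e0; have [|N hN] := small (e / 2); first by rewrite divr_gt0.
    exists N => i j Ni Nj; rewrite (le_lt_trans (tri _ _))// (splitr e).
    by rewrite ltrD// hN.
  exists l; apply/le_anti; rewrite (pm_ge0 hp) ?andbT; last exact: DB.
  apply/ler_addgt0Pl => e e0; rewrite addr0.
  have e2 : 0 < e / 2 by rewrite divr_gt0.
  have [N hN] := small _ e2; have [M hM] := ul _ e2.
  pose n := maxn N M.
  have -> : x - l%:A = (x - (u n)%:A) + (u n - l)%:A by rewrite scalerBl addrA subrK.
  rewrite (le_trans (pmD hp _ _))//; first exact: DB.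
  by rewrite pm_alg (splitr e) lerD// ltW// ?hN ?hM// ?leq_maxl ?leq_maxr.
pose w : R[i] := (m / 2)%:C.
have cw : cabs w = m / 2 by rewrite cabs_real ger0_norm// ltW// divr_gt0.
(* If p (x - c) < m r, [ostrowski_step] divided by m^n bounds the new value by m (r^(n+1) +
   2^-(n+1)). Here n makes the last power smaller than e / 2, and r is the (n+1)-st root of 1 + e /
   2. *)
have step (e : R) : 0 < e -> exists2 t, 0 < t & forall c,
    p (x - c%:A) < m * (1 + t) -> p (x - (c + w)%:A) < m * (1 + e).
  move=> e0; have e2 : 0 < e / 2 by rewrite divr_gt0.
  have [n hn] : exists n, (2^-1 : R) ^+ n.+1 < e / 2.
    have : ((2^-1 : R) ^+ n @[n --> \oo]) --> (0 : R).
      by apply: cvg_expr; rewrite ger0_norm ?invr_ge0// invf_lt1 ?ltr1n.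
    move/cvgrPdist_lt => /(_ _ e2)[N _ uN]; exists N.
    by have := uN N.+1 (leqnSn N); rewrite /= sub0r normrN ger0_norm// exprn_ge0.
  pose r := (1 + e / 2) `^ n.+1%:R^-1.
  have rn : r ^+ n.+1 = 1 + e / 2.
    rewrite -powR_mulrn ?powR_ge0// -powRrM mulVf ?pnatr_eq0// powRr1//.
    by rewrite addr_ge0// ltW.
  have r1 : 1 < r.
    rewrite ltNge; apply/negP => r1; have : r ^+ n.+1 <= 1 by rewrite exprn_ile1// powR_ge0.
    by rewrite rn leNgt ltrDl e2.
  exists (r - 1); first by rewrite subr_gt0.
  move=> c; rewrite (addrC 1) subrK => pc.
  have Dc := DB c Dx.
  have := @ostrowski_step _ m w n Dc (ltW mpos).
  rewrite shift => /(_ _)/le_lt_trans => H.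
  rewrite -(@ltr_pM2l _ (m ^+ n)) ?exprn_gt0//; apply: H.
    by move=> l; rewrite shift.
  rewrite cw exprMn [_ * (m * _)]mulrA -exprSr.
  apply: (@lt_le_trans _ _ ((m * r) ^+ n.+1 + m ^+ n.+1 * 2^-1 ^+ n.+1)).
    by rewrite ltrD2r ltrXn2r// ?nnegrE ?(pm_ge0 hp)// ltW// mulr_gt0// (lt_trans _ r1).
  rewrite exprMn rn -mulrDr ler_pM2l ?exprn_gt0//.
  by move: hn; set a := _ ^+ n.+1; lra.
have iter K (e : R) : 0 < e -> exists2 t, 0 < t & forall c,
    p (x - c%:A) < m * (1 + t) -> p (x - (c + w *+ K)%:A) < m * (1 + e).
  elim: K e => [|K ih] e e0; first by exists e => // c; rewrite mulr0n addr0.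
  have [t1 t10 h1] := step _ e0; have [t2 t20 h2] := ih _ t10.
  by exists t2 => // c /h2/h1; rewrite mulrSr addrA.
(* Eight translations cover the distance 8 (m / 2) = 4 m, while both end points have value below 2
   m. *)
have [t t0 ht] := iter 8%N 1 ltr01.
pose s := Num.min t 1; have s0 : 0 < s by rewrite lt_min t0 ltr01.
have [|c pc] := mlt (m * s); first by rewrite mulr_gt0.
have pct : p (x - c%:A) < m * (1 + t).
  by rewrite (lt_le_trans pc)// mulrDr mulr1 lerD2l ler_pM2l// ge_min lexx.
have pc1 : p (x - c%:A) < m * 2.
  by rewrite (lt_le_trans pc)// mulr_natr mulr2n lerD2l ger_pMr// ge_min lexx orbT.
have w8 : cabs (w *+ 8) = m / 2 * 8.
  rewrite -(mulr_natr w) cabsM cw (_ : 8 = 8%:R%:C); last by rewrite rmorph_nat.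
  by rewrite cabs_real ger0_norm.
have := tri (c + w *+ 8) c; rewrite addrAC subrr add0r w8 => H.
by exfalso; have := ht _ pct; lra.
Qed.

End Ostrowski.

(** The scalar c with p (x - c) = 0 is unique because p is the modulus on scalars. Uniqueness makes
    x |-> c linear and multiplicative, and p x = |c| yields the norming property at h. *)
Theorem exists_norming_character h : D h ->
  exists2 chi, is_character D chi & cabs (chi h) = cnorm h.
Proof.
have [D0 D1] := (suba0 hD, suba1 hD).
(* For h = 0 any character will do; the one norming 1 shows that there is one. *)
wlog h0 : h / 0 < cnorm h => [H Dh|Dh].
  have := cnorm_ge0 h; rewrite le_eqVlt => /orP[/eqP e|h0]; last exact: H.
  have [|//|chi hchi _] := H 1; first by rewrite cnorm1 ltr01.
  exists chi => //; rewrite -e (cnorm_eq0 _ (esym e)).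
  by rewrite (char0 hD hchi) cabs0.
have [p [hp ph pMul]] := exists_multiplicative_seminorm hD hC Dh h0.
have p1 : p 1 = 1.
  have := pMul h 1 Dh D1; rewrite mulr1 ph => /eqP.
  rewrite -{1}(mulr1 (cnorm h)) -subr_eq0 -mulrBr mulf_eq0 gt_eqF//= subr_eq0.
  by move=> /eqP.
have /choice[chi chiP] : forall x, exists c, D x -> p (x - c%:A) = 0.
  move=> x; have [Dx|nDx] := pselect (D x); last by exists 0.
  by have [c pc] := ostrowski hp p1 pMul Dx; exists c.
have DA c : D c%:A by exact: subaA.
have DB x c : D x -> D (x - c%:A) by move=> Dx; apply: subaB.
have p0 x : D x -> p x <= 0 -> p x = 0.
  by move=> Dx le0; apply/le_anti; rewrite le0 (pm_ge0 hp).
have uniq x c : D x -> p (x - c%:A) = 0 -> chi x = c.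
  move=> Dx pc; apply/subr0_eq/cabs_eq0.
  rewrite -(pm_alg hp p1); apply: p0 => //.
  have -> : (chi x - c)%:A = - (x - (chi x)%:A) + (x - c%:A).
    by rewrite scalerBl opprB addrA subrK.
  rewrite (le_trans (pmD hp _ _))//; [by apply: subaN => //; exact: DB|exact: DB|].
  by rewrite (pmN hp) ?chiP ?pc ?addr0//; exact: DB.
exists chi.
  split.
  - by apply: uniq => //; rewrite scale1r subrr -(scale0r 1) (pmZ hp)// cabs0 mul0r.
  - move=> c x y Dx Dy; have Dcx := subaZ hD c Dx.
    apply: uniq; first exact: subaZD.
    apply: p0; first by apply: DB; exact: subaZD.
    have -> : c *: x + y - (c * chi x + chi y)%:A = c *: (x - (chi x)%:A) + (y - (chi y)%:A).
      by rewrite scalerDl scalerBr scalerA opprD addrACA.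
    have Dz := subaZ hD c (DB _ (chi x) Dx).
    rewrite (le_trans (pmD hp Dz (DB _ _ Dy)))// (pmZ hp)//; last exact: DB.
    by rewrite !chiP// mulr0 addr0.
  - move=> x y Dx Dy; have Dxy := subaM hD Dx Dy.
    apply: uniq => //; apply: p0; first exact: DB.
    have -> : x * y - (chi x * chi y)%:A = (x - (chi x)%:A) * y + chi x *: (y - (chi y)%:A).
      by rewrite scalerBr scalerA mulrBl mulr_algl addrA subrK.
    have Dz := subaZ hD (chi x) (DB _ (chi y) Dy).
    have Dw := subaM hD (DB _ (chi x) Dx) Dy.
    rewrite (le_trans (pmD hp Dw Dz))// (pmZ hp)//; last exact: DB.
    by rewrite pMul ?chiP//; [rewrite mul0r mulr0 addr0|exact: DB].
rewrite -ph -(pm_alg hp p1).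
have le1 (x y : A) : D x -> D y -> p (x - y) = 0 -> p x <= p y.
  move=> Dx Dy e; rewrite -{1}(subrK y x) (le_trans (pmD hp (subaB hD Dx Dy) Dy))//.
  by rewrite e add0r.
have H := chiP _ Dh; apply/le_anti; rewrite !le1//.
by rewrite -opprB (pmN hp)//; exact: DB.
Qed.

(** The form in which Gelfand theory is used below: a norm estimate in D is a scalar estimate
    uniform over the characters. *)
Corollary cnorm_le_char x (C : R) : D x ->
  (forall chi, is_character D chi -> cabs (chi x) <= C) -> cnorm x <= C.
Proof.
by move=> Dx H; have [chi hchi <-] := exists_norming_character Dx; exact: H.
Qed.

Corollary char_inj x y : D x -> D y ->
  (forall chi, is_character D chi -> chi x = chi y) -> x = y.
Proof.
move=> Dx Dy H; apply/subr0_eq/cnorm_eq0/le_anti; rewrite cnorm_ge0 andbT.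
apply: cnorm_le_char; first exact: subaB.
by move=> chi hchi; rewrite (charB hD hchi Dx Dy) H// subrr cabs0.
Qed.

End Characters.

(** * Joint continuous functional calculus *)

Section Generated.
Variables (R : realType) (A : cstarAlgType R).
Implicit Types (S D : set A) (x y : A).

Lemma generated_min S D : cstar_subalgebra D -> S `<=` D -> generated_cstar S `<=` D.
Proof. by move=> hD SD x; apply. Qed.

Lemma sub_generated S : S `<=` generated_cstar S.
Proof. by move=> x Sx D hD; apply. Qed.

Lemma generated_suba S : cstar_subalgebra (generated_cstar S).
Proof.
split.
- move=> x cx D hD SD; have [cl _ _ _ _] := hD; apply: cl => e /cx[y Gy xy].
  by exists y => //; exact: Gy.
- by move=> D hD SD; exact: suba1.
- by move=> c x y Gx Gy D hD SD; apply: subaZD => //; [exact: Gx|exact: Gy].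
- by move=> x y Gx Gy D hD SD; apply: subaM => //; [exact: Gx|exact: Gy].
- by move=> x Gx D hD SD; apply: subaS => //; exact: Gx.
Qed.

Lemma commutant_suba S : (forall x, S x -> S (star x)) ->
  cstar_subalgebra [set x | forall y, S y -> x * y = y * x].
Proof.
move=> hS; split => /=.
- move=> x cx y Sy; apply/subr0_eq/cnorm_eq0/le_anti; rewrite cnorm_ge0 andbT.
  apply/ler_addgt0Pl => e e0; rewrite addr0.
  pose d := e / (2 * (1 + cnorm y)).
  have y1 : 0 < 1 + cnorm y by rewrite ltr_pwDl// cnorm_ge0.
  have [|z zc xz] := cx d; first by rewrite divr_gt0// mulr_gt0.
  have -> : x * y - y * x = (x - z) * y - y * (x - z).
    by rewrite mulrBl mulrBr (zc _ Sy) opprB addrA subrK.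
  rewrite (le_trans (cnormD _ _))// cnormN.
  rewrite (le_trans (lerD (cnormM _ _) (cnormM _ _)))//.
  have := cnorm_ge0 y; set b := cnorm y in y1 d xz *; set a := cnorm (x - z) in xz *.
  move=> b0; have a0 : 0 <= a by exact: cnorm_ge0.
  have de : d * (2 * (1 + b)) = e by rewrite /d divfK// mulf_neq0// gt_eqF.
  nra.
- by move=> y _; rewrite mul1r mulr1.
- move=> c x y hx hy z Sz.
  by rewrite mulrDl mulrDr hy// -scalerAl -scalerAr hx.
- by move=> x y hx hy z Sz; rewrite -mulrA hy// mulrA hx// mulrA.
- move=> x hx y Sy; rewrite -[y]starK -!starM; congr star.
  by rewrite hx//; exact: hS.
Qed.

(** A double commutant argument: the commutant of S contains S, hence the generated algebra;
    therefore the commutant of the generated algebra contains S, hence again the generated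
    algebra. *)
Lemma generated_comm S : (forall x, S x -> star x = x) ->
  (forall x y, S x -> S y -> x * y = y * x) ->
  forall x y, generated_cstar S x -> generated_cstar S y -> x * y = y * x.
Proof.
move=> sS cS.
have h1 : cstar_subalgebra [set x | forall y, S y -> x * y = y * x].
  by apply: commutant_suba => x Sx; rewrite sS.
have h2 : cstar_subalgebra [set x | forall y, generated_cstar S y -> x * y = y * x].
  by apply: commutant_suba => x Gx; exact: (subaS (generated_suba S)).
move=> x y Gx Gy; apply: (generated_min h2 _ Gx) => // z Sz w Gw.
by apply/esym/(generated_min h1 _ Gw) => // v Sv u Su; exact: cS.
Qed.

(* Comparing 1 with x^2 / |x|^2 in the commutative algebra C*(x, x^-1), where
   characters are bounded away from 0 on x, puts x^2 within the reach of the
   Neumann series, which stays in D. *)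
Lemma suba_inv D x : cstar_subalgebra D -> D x -> star x = x ->
  x \is a GRing.unit -> D x^-1.
Proof.
move=> hD Dx sx ux; pose S : set A := [set x; x^-1].
have hE := generated_suba S; set E := generated_cstar S in hE.
have sx' := star_inv sx ux.
have hC : forall y z, E y -> E z -> y * z = z * y.
  apply: generated_comm; first by move=> y [->|->].
  by move=> y z [->|->] [->|->] //; rewrite mulVr// mulrV.
have Ex : E x by apply: sub_generated; left.
have Ex' : E x^-1 by apply: sub_generated; right.
have norm_pos y : y * y^-1 = 1 -> 0 < cnorm y.
  move=> e; rewrite lt_neqAle cnorm_ge0 andbT eq_sym; apply/eqP => /cnorm_eq0 y0.
  by move/eqP: e; rewrite y0 mul0r eq_sym oner_eq0.
have N0 : 0 < cnorm x by apply: norm_pos; rewrite mulrV.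
have N0' : 0 < cnorm x^-1 by apply: norm_pos; rewrite invrK mulVr.
pose N := cnorm x; pose N' := cnorm x^-1.
(* A character takes a real value a on x with 1 / N' <= |a| <= N, so 1 - c a^2 lies between 0 and 1
   - 1 / (N N')^2. *)
pose c : R := (N ^+ 2)^-1.
have c0 : 0 < c by rewrite invr_gt0 exprn_gt0.
have Exx : E (x * x) by exact: (subaM hE Ex Ex).
have Ecxx : E (c%:C *: (x * x)) by exact: (subaZ hE _ Exx).
pose y := 1 - c%:C *: (x * x).
have y1 : cnorm y < 1.
  apply: (@le_lt_trans _ _ (1 - c * (N'^-1) ^+ 2)); last first.
    by rewrite ltrBlDr ltrDl mulr_gt0// exprn_gt0// invr_gt0.
  have Ey : E y by exact: (subaB hE (suba1 hE) Ecxx).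
  apply: (cnorm_le_char hE hC Ey).
  move=> chi hchi; rewrite (charB hE hchi (suba1 hE) Ecxx) (charZ hE _ hchi Exx).
  rewrite (charM hchi Ex Ex) (char_real hE hchi Ex sx).
  have [-> _ _] := hchi; set a := complex.Re (chi x).
  have aN : `|a| <= N.
    by rewrite (le_trans (Re_le_cabs _))//; exact: (char_le hE hchi Ex).
  have aN' : N'^-1 <= `|a|.
    have := charM hchi Ex Ex'; rewrite mulrV//; have [-> _ _] := hchi.
    move=> /(congr1 (@cabs R)); rewrite cabs1 cabsM (char_real hE hchi Ex sx).
    rewrite cabs_real => e; have := char_le hE hchi Ex' => l.
    have N'p : 0 < N' by exact: N0'.
    rewrite -(ler_pM2r N'p) mulVf ?gt_eqF// e.
    by rewrite ler_wpM2l.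
  have -> : 1 - c%:C * (a%:C * a%:C) = (1 - c * a ^+ 2)%:C.
    by rewrite expr2 rmorphB !rmorphM rmorph1.
  rewrite cabs_real ger0_norm.
    rewrite lerD2l lerN2 ler_pM2l// -(real_normK (num_real a)).
    by rewrite ler_pXn2r ?nnegrE ?invr_ge0 ?(ltW N0').
  rewrite subr_ge0 /c mulrC ler_pdivrMr ?exprn_gt0// mul1r.
  by rewrite -(real_normK (num_real a)) ler_pXn2r ?nnegrE ?(ltW N0).
have Dy : D y.
  by apply: subaB => //; [exact: suba1|apply: subaZ => //; exact: subaM].
have [z Dz] := neumann hD Dy y1.
rewrite /y subKr -scalerAl -mulrA => yz.
have -> : x^-1 = c%:C *: (x * z) by rewrite -[RHS](mulKr ux) -scalerAr yz mulr1.
by apply: subaZ => //; exact: subaM.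
Qed.

End Generated.

(** * Bernstein operators in one variable *)

Section Bernstein.
Variable R : realFieldType.

(** The expectation of phi (K) for a binomial K of parameters N and t, that is, the Bernstein
    polynomial with coefficients phi. The de Casteljau recursion uses sums and products only, so
    that realizability passes through it by induction. *)
Fixpoint bern (t : R) (N : nat) (phi : nat -> R) : R :=
  if N is M.+1 then bern t M (fun k => (1 - t) * phi k + t * phi k.+1)
  else phi 0%N.

Lemma le_bern t N phi psi : 0 <= t -> t <= 1 ->
  (forall k, (k <= N)%N -> phi k <= psi k) -> bern t N phi <= bern t N psi.
Proof.
move=> t0 t1; elim: N phi psi => [|N ih] phi psi h /=; first exact: h.
apply: ih => k kN; rewrite lerD// ler_wpM2l ?subr_ge0 ?h//; exact: leqW.
Qed.

Lemma bernD t N phi psi :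
  bern t N (fun k => phi k + psi k) = bern t N phi + bern t N psi.
Proof.
elim: N phi psi => [|N ih] phi psi //=; rewrite -ih; congr bern.
by apply/funext => k; ring.
Qed.

Lemma bernZ t N c phi : bern t N (fun k => c * phi k) = c * bern t N phi.
Proof.
elim: N phi => [|N ih] phi //=; rewrite -ih; congr bern.
by apply/funext => k; ring.
Qed.

Lemma bern_cst t N c : bern t N (fun=> c) = c.
Proof.
elim: N => [|N ih] //=; rewrite -[RHS]ih; congr bern.
by apply/funext => k; ring.
Qed.

(** The second moment about an arbitrary point c. One trial replaces c by c - t and adds the
    variance t (1 - t), so c has to vary in the induction. *)
Lemma bern_var t N c :
  bern t N (fun k => (k%:R - c) ^+ 2) = (N%:R * t - c) ^+ 2 + N%:R * (t * (1 - t)).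
Proof.
elim: N c => [|N ih] c /=; first by rewrite !mul0r addr0.
transitivity (bern t N (fun k => (k%:R - (c - t)) ^+ 2 + t * (1 - t))).
  by congr bern; apply/funext => k; rewrite -natr1; ring.
by rewrite bernD ih bern_cst -natr1; ring.
Qed.

(* |s| <= d + s^2 / d turns the variance into a bound on the first absolute
   moment without square roots. *)
Lemma bern_approx t N phi (v L d : R) : 0 <= t -> t <= 1 -> 0 < d -> 0 <= L ->
  (0 < N)%N -> (forall k, (k <= N)%N -> `|phi k - v| <= L * `|k%:R / N%:R - t|) ->
  `|bern t N phi - v| <= L * (d + (N%:R * d)^-1).
Proof.
move=> t0 t1 d0 L0 N0 h; have Np : (0 : R) < N%:R by rewrite ltr0n.
pose e k : R := L * d + L / (N%:R ^+ 2 * d) * (k%:R - N%:R * t) ^+ 2.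
have he k : (k <= N)%N -> `|phi k - v| <= e k.
  move=> /h/le_trans; apply; rewrite /e -mulrA -mulrDr ler_wpM2l//.
  set s := k%:R / N%:R - t.
  have -> : (N%:R ^+ 2 * d)^-1 * (k%:R - N%:R * t) ^+ 2 = s ^+ 2 / d.
    by rewrite /s; field; rewrite !gt_eqF.
  have [sd|/ltW ds] := leP `|s| d; first by rewrite (le_trans sd)// lerDl divr_ge0 ?sqr_ge0// ltW.
  rewrite (@le_trans _ _ (s ^+ 2 / d))//; last by rewrite lerDr ltW.
  by rewrite ler_pdivlMr// -(real_normK (num_real s)) expr2 ler_wpM2l.
have hB : bern t N e <= L * (d + (N%:R * d)^-1).
  rewrite bernD bern_cst bernZ bern_var subrr expr0n /= add0r (mulrDr L) lerD2l -mulrA.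
  rewrite ler_wpM2l//.
  have -> : (N%:R ^+ 2 * d)^-1 * (N%:R * (t * (1 - t))) = (N%:R * d)^-1 * (t * (1 - t)).
    by field; rewrite !gt_eqF.
  by rewrite ler_piMr ?invr_ge0 ?mulr_ge0 ?(ltW d0)//; nra.
have vE : bern t N phi - v = bern t N (fun k => phi k - v).
  by rewrite bernD bern_cst.
rewrite vE (le_trans _ hB)// ler_norml; apply/andP; split.
  rewrite lerNl -mulN1r -bernZ; apply: le_bern => // k /he.
  by rewrite ler_norml mulN1r lerNl => /andP[].
by apply: le_bern => // k /he; rewrite ler_norml => /andP[].
Qed.

End Bernstein.

(** * Gelfand transforms of Lipschitz functions *)

Section JointFunctionalCalculus.
Variables (R : realType) (A : cstarAlgType R) (m : nat) (b : 'I_m -> A).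
Hypotheses (hb : forall j, star (b j) = b j)
  (hbC : forall i j, b i * b j = b j * b i).

Let D := generated_cstar (range b).

Lemma range_suba : cstar_subalgebra D.
Proof. exact: generated_suba. Qed.

Lemma range_comm x y : D x -> D y -> x * y = y * x.
Proof.
apply: generated_comm; first by move=> _ [j _ <-].
by move=> _ _ [i _ <-] [j _ <-].
Qed.

Lemma range_gen j : D (b j).
Proof. by apply: sub_generated; exists j. Qed.

Let hD := range_suba.

(** Characters separate the points of D, so the description behind [joint_cfc] has at most one
    solution; exhibiting one evaluates it. *)
Lemma joint_cfcE (f : ('I_m -> R) -> R[i]) y : D y ->
  (forall chi, is_character D chi -> chi y = f (fun j => complex.Re (chi (b j)))) ->
  joint_cfc b f = y.
Proof.
move=> Dy hy; rewrite /joint_cfc; case: xgetP => [z ->|/(_ y)]; last first.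
  by case; split.
case=> Dz hz; apply: (char_inj hD range_comm Dz Dy) => chi hchi.
by rewrite hz// hy.
Qed.

Definition realizable (f : ('I_m -> R) -> R) : Prop := exists2 y, D y &
  forall chi, is_character D chi -> chi y = (f (fun j => complex.Re (chi (b j))))%:C.

Variables (lo hi : R).
Hypotheses (lohi : lo < hi)
  (hbox : forall chi, is_character D chi ->
    forall j, lo <= complex.Re (chi (b j)) <= hi).

Lemma realizable_cst c : realizable (fun=> c).
Proof.
exists c%:C%:A; first exact: subaA.
by move=> chi hchi; rewrite (charA hD).
Qed.

Lemma realizable_coord j : realizable (fun x => x j).
Proof.
by exists (b j); [exact: range_gen|move=> chi hchi; exact: (char_real hD hchi (range_gen j))].
Qed.

Lemma realizableD f g : realizable f -> realizable g ->
  realizable (fun x => f x + g x).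
Proof.
move=> [y Dy hy] [z Dz hz]; exists (y + z); first exact: (subaD hD).
by move=> chi hchi; rewrite (charD hchi Dy Dz) hy// hz// rmorphD.
Qed.

Lemma realizableM f g : realizable f -> realizable g ->
  realizable (fun x => f x * g x).
Proof.
move=> [y Dy hy] [z Dz hz]; exists (y * z); first exact: (subaM hD).
by move=> chi hchi; rewrite (charM hchi Dy Dz) hy// hz// rmorphM.
Qed.

Lemma eq_realizable f g : (forall x, (forall j, lo <= x j <= hi) -> f x = g x) ->
  realizable f -> realizable g.
Proof.
move=> fg [y Dy hy]; exists y => // chi hchi.
by rewrite hy// fg//; exact: hbox.
Qed.

(** Uniform approximations on the box have Cauchy realizations by [cnorm_le_char], and D is
    complete; characters, being contractive, pass to the limit. *)
Lemma realizable_lim f : (forall e : R, 0 < e -> exists2 g, realizable g &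
    forall x, (forall j, lo <= x j <= hi) -> `|f x - g x| <= e) ->
  realizable f.
Proof.
move=> H.
have /choice[y yP] : forall n : nat, exists y, D y /\ forall chi, is_character D chi ->
    cabs (chi y - (f (fun j => complex.Re (chi (b j))))%:C) <= n.+1%:R^-1.
  move=> n; have [|g [y Dy hy] fg] := H n.+1%:R^-1; first by rewrite invr_gt0.
  exists y; split => // chi hchi; rewrite hy// -rmorphB cabs_real distrC.
  by apply: fg; exact: hbox.
have Dy n : D (y n) by case: (yP n).
have hy n : forall chi, is_character D chi ->
    cabs (chi (y n) - (f (fun j => complex.Re (chi (b j))))%:C) <= n.+1%:R^-1.
  by case: (yP n).
have small (e : R) : 0 < e -> exists N, forall i, (N <= i)%N -> i.+1%:R^-1 < e.
  by move=> e0; have [N _ hN] := near_infty_natSinv_lt (PosNum e0); exists N => i /hN.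
have [|z Dz yz] := @suba_lim R A D hD y Dy.
  move=> e e0; have [|N hN] := small (e / 4); first by rewrite divr_gt0.
  exists N => i j /hN Ni /hN Nj.
  apply: (@le_lt_trans _ _ (e / 2)); last by rewrite ltr_pdivrMr// ltr_pMr// ltr1n.
  apply: (cnorm_le_char hD range_comm (subaB hD (Dy i) (Dy j))) => chi hchi.
  rewrite (charB hD hchi (Dy i) (Dy j)).
  set v := (f (fun j => complex.Re (chi (b j))))%:C.
  have -> : chi (y i) - chi (y j) = (chi (y i) - v) - (chi (y j) - v).
    by rewrite opprB addrA subrK.
  rewrite (le_trans (cabsD _ _))// cabsN.
  rewrite (le_trans (lerD (hy i _ hchi) (hy j _ hchi)))//.
  by rewrite (_ : e / 2 = e / 4 + e / 4) ?lerD ?ltW//; field.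
exists z => // chi hchi.
apply/subr0_eq/cabs_eq0/le_anti; rewrite cabs_ge0 andbT.
apply/ler_addgt0Pl => e e0; rewrite addr0.
have e2 : 0 < e / 2 by rewrite divr_gt0.
have [N hN] := small _ e2; have [M hM] := yz _ e2.
pose n := maxn N M.
set v := (f (fun j => complex.Re (chi (b j))))%:C.
have -> : chi z - v = (chi (y n) - v) - (chi (y n) - chi z).
  by rewrite opprB [RHS]addrC addrA subrK.
rewrite (le_trans (cabsD _ _))// cabsN (splitr e) lerD//.
  by rewrite (le_trans (hy n _ hchi))// ltW// hN// leq_maxl.
rewrite -(charB hD hchi (Dy n) Dz) (le_trans (char_le hD hchi (subaB hD (Dy n) Dz)))//.
by rewrite ltW// hM// leq_maxr.
Qed.

Lemma realizable_bern (t : ('I_m -> R) -> R) N (phi : nat -> ('I_m -> R) -> R) :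
  realizable t -> (forall k, realizable (phi k)) ->
  realizable (fun x => bern (t x) N (phi^~ x)).
Proof.
move=> ht; elim: N phi => [|N ih] phi hphi /=; first exact: hphi.
apply: (ih (fun k x => (1 - t x) * phi k x + t x * phi k.+1 x)) => k.
apply: realizableD; apply: realizableM => //.
apply: eq_realizable (realizableD (realizable_cst 1)
  (realizableM (realizable_cst (-1)) ht)) => x _.
by rewrite mulN1r.
Qed.

(** Induction on the number i of coordinates on which g depends. The last of these is replaced by
    Bernstein interpolation, whose coefficients g (upd x (c k)) depend on the earlier coordinates
    only and keep the constant L. *)
Lemma realizable_lipschitz (f : ('I_m -> R) -> R) (L : R) : 0 <= L ->
  (forall x y, (forall j, lo <= x j <= hi) -> (forall j, lo <= y j <= hi) ->
     `|f x - f y| <= L * \sum_j `|x j - y j|) ->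
  realizable f.
Proof.
move=> L0; pose box x := forall j : 'I_m, lo <= x j <= hi.
suff H i (g : ('I_m -> R) -> R) : (forall x y, box x -> box y ->
      `|g x - g y| <= L * \sum_j `|x j - y j|) ->
    (forall x y, box x -> box y -> (forall j : 'I_m, (j < i)%N -> x j = y j) -> g x = g y) ->
    realizable g.
  move=> Lf; apply: (H m) => // x y _ _ xy; congr f.
  by apply/funext => j; exact: xy.
elim: i g => [|i ih] g Lg dg.
  apply: eq_realizable (realizable_cst (g (fun=> lo))) => x xb.
  by apply: dg => // j; rewrite lexx ltW.
have [im|mi] := ltnP i m; last first.
  apply: ih => // x y xb yb xy; apply: dg => // j _; apply: xy.
  exact: leq_trans (ltn_ord j) mi.
pose i0 := Ordinal im.
pose upd (x : 'I_m -> R) (c : R) : 'I_m -> R := fun j => if j == i0 then c else x j.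
have upd_box x c : box x -> lo <= c <= hi -> box (upd x c).
  by move=> xb hc j; rewrite /upd; case: ifP.
have dpos : 0 < hi - lo by rewrite subr_gt0.
apply: realizable_lim => e e0.
pose L1 := L * (hi - lo) + 1.
have L10 : 0 < L1 by rewrite ltr_wpDl// mulr_ge0// ltW.
pose d := e / (2 * L1); have d0 : 0 < d by rewrite divr_gt0// mulr_gt0.
(* With 1 / (N d) <= d the Bernstein error is at most 2 L (hi - lo) d, which the choice of d keeps
   below e. *)
have [N N0 hN] : exists2 N, (0 < N)%N & (N%:R * d)^-1 <= d.
  have [N _ hN] := near_infty_natSinv_lt (PosNum (mulr_gt0 d0 d0)).
  exists N.+1 => //; have := hN N (leqnn N); rewrite /= invfM => h.
  by rewrite ler_pdivrMr// ltW.
(* The nodes divide [lo, hi] evenly. The minimum keeps them in the box for k > N as well, since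
   [realizable_bern] asks for every k. *)
pose c k : R := lo + (hi - lo) * Num.min 1 (k%:R / N%:R).
have N0R : (0 : R) < N%:R by rewrite ltr0n.
have hc k : lo <= c k <= hi.
  have k0 : (0 : R) <= k%:R / N%:R by rewrite divr_ge0.
  have m0 : 0 <= Num.min 1 (k%:R / N%:R : R) by rewrite le_min ler01.
  have m1 : Num.min 1 (k%:R / N%:R : R) <= 1 by rewrite ge_min lexx.
  by rewrite /c lerDl -lerBrDl mulr_ge0 ?(ltW dpos)//= ler_piMr ?(ltW dpos).
pose t (x : 'I_m -> R) := (x i0 - lo) / (hi - lo).
have ht : realizable t.
  apply: eq_realizable (realizableM (realizableD (realizable_coord i0)
    (realizable_cst (- lo))) (realizable_cst (hi - lo)^-1)) => x _ //.
exists (fun x => bern (t x) N (fun k => g (upd x (c k)))).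
  apply: (@realizable_bern t N (fun k x => g (upd x (c k)))) => // k.
  apply: ih => [x y xb yb|x y xb yb xy].
    rewrite (le_trans (Lg _ _ (upd_box _ _ xb (hc k)) (upd_box _ _ yb (hc k))))//.
    rewrite ler_wpM2l// ler_sum// => j _; rewrite /upd; case: ifP => // _.
    by rewrite subrr normr0.
  apply: dg; [exact: upd_box|exact: upd_box|move=> j].
  rewrite ltnS leq_eqVlt /upd => /orP[/eqP ji|ji].
    by have -> : j == i0 by apply/eqP/val_inj.
  by case: ifP => // _; exact: xy.
move=> x xb; have /andP[xlo xhi] := xb i0.
have t0 : 0 <= t x by rewrite divr_ge0 ?subr_ge0// ltW.
have t1 : t x <= 1 by rewrite ler_pdivrMr// mul1r lerD2r.
rewrite distrC (le_trans (@bern_approx _ (t x) N _ (g x) (L * (hi - lo)) d t0 t1 d0 _ N0 _))//.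
- by rewrite mulr_ge0// ltW.
- move=> k kN; rewrite (le_trans (Lg _ _ (upd_box _ _ xb (hc k)) xb))//.
  rewrite -mulrA ler_wpM2l// (bigD1 i0)//= big1 ?addr0; last first.
    by move=> j /negbTE ji; rewrite /upd ji subrr normr0.
  rewrite /upd eqxx /c (_ : Num.min 1 _ = k%:R / N%:R); last first.
    by apply/min_idPr; rewrite ler_pdivrMr// mul1r ler_nat.
  have -> : lo + (hi - lo) * (k%:R / N%:R) - x i0 = (hi - lo) * (k%:R / N%:R - t x).
    by rewrite /t; field; rewrite !gt_eqF.
  by rewrite normrM gtr0_norm.
- have K0 : 0 <= L * (hi - lo) by rewrite mulr_ge0// ltW.
  rewrite (le_trans (ler_wpM2l K0 (lerD (lexx d) hN)))//.
  have <- : d * (2 * L1) = e by rewrite /d divfK// gt_eqF// mulr_gt0.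
  by rewrite /L1; nra.
Qed.

End JointFunctionalCalculus.

(** * Convolutions and Fourier inversion *)

Section AffineChange.
Variable R : realType.
Let mu := @lebesgue_measure R.
Local Open Scope ereal_scope.

Lemma measurable_affine (c b : R) : measurable_fun setT (fun x : R => c * x + b)%R.
Proof. by apply: measurable_funD => //; exact: measurable_funM. Qed.

Definition affine_pushforward (c b : R) : {measure set (measurableTypeR R) -> \bar R} :=
  measure_function_pushforward__canonical__measure_function_Measure mu
    (measurable_affine c b : measurable_fun (setT : set (measurableTypeR R))
      ((fun x => c * x + b)%R : measurableTypeR R -> measurableTypeR R)).

(** By uniqueness of Lebesgue measure it suffices to compare half-open intervals; for c < 0 the
    preimage is closed at the other end. *)
Lemma lebesgue_affine (c b : R) (A : set R) : c != 0%R -> measurable A ->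
  mu A = mscale (NngNum (normr_ge0 c)) (affine_pushforward c b) A.
Proof.
move=> c0 mA; apply: lebesgue_measure_unique => // _ [[u v]] _ <-.
rewrite -[RHS]/(`|c|%:E * mu ((fun x => c * x + b)%R @^-1` `]u, v]%classic)).
have pos : (0 < `|c|)%R by rewrite normr_gt0.
have [cpos|cneg] := ltP 0%R c.
  rewrite (_ : _ @^-1` _ = `]((u - b) / c)%R, ((v - b) / c)%R]%classic); last first.
    apply/seteqP; split => x /=; rewrite !in_itv /= ltr_pdivrMr// ler_pdivlMr//;
    by rewrite ltrBlDr lerBrDr mulrC.
  rewrite /mu !lebesgue_measure_itv /= !lte_fin ltr_pM2r ?invr_gt0// ltrD2r.
  case: ifP => uv; last by rewrite mule0.
  rewrite -!EFinD -EFinM gtr0_norm//; congr EFin.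
  by field.
have {}cneg : (c < 0)%R by rewrite lt_neqAle c0.
rewrite (_ : _ @^-1` _ = `[((v - b) / c)%R, ((u - b) / c)%R[%classic); last first.
  apply/seteqP; split => x /=; rewrite !in_itv /= ltr_ndivlMr// ler_ndivrMr//;
  by rewrite ltrBlDr lerBrDr mulrC andbC.
rewrite /mu !lebesgue_measure_itv /= !lte_fin ltr_nM2r ?invr_lt0// ltrD2r.
case: ifP => uv; last by rewrite mule0.
rewrite -!EFinD -EFinM ltr0_norm//; congr EFin.
by field.
Qed.

Lemma ge0_integral_affine (c b : R) (f : R -> \bar R) : c != 0%R ->
  measurable_fun setT f -> (forall x, 0 <= f x) ->
  \int[mu]_x f (c * x + b)%R = (`|c|^-1)%:E * \int[mu]_x f x.
Proof.
move=> c0 mf f0; have pos : (0 < `|c|)%R by rewrite normr_gt0.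
have -> : \int[mu]_x f x = `|c|%:E * \int[mu]_x f (c * x + b)%R.
  transitivity (\int[mscale (NngNum (normr_ge0 c)) (affine_pushforward c b)]_x f x).
    by apply: eq_measure_integral => A mA _; exact: (@lebesgue_affine c b).
  rewrite ge0_integral_mscale//= ; congr (_ * _).
  by rewrite ge0_integral_pushforward//; exact: measurable_affine.
by rewrite muleA -EFinM mulVf ?gt_eqF// mul1e.
Qed.

(** Positive and negative parts are transformed separately, so no integrability is asked for. *)
Lemma integral_isometry (c b : R) (f : R -> \bar R) : `|c|%R = 1%R ->
  measurable_fun setT f -> \int[mu]_x f (c * x + b)%R = \int[mu]_x f x.
Proof.
move=> c1 mf; have c0 : c != 0%R by rewrite -normr_eq0 c1 oner_eq0.
have E g : measurable_fun setT g -> (forall x, 0 <= g x) ->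
    \int[mu]_x g (c * x + b)%R = \int[mu]_x g x.
  by move=> mg g0; rewrite ge0_integral_affine// c1 invr1 mul1e.
rewrite integralE [RHS]integralE; congr (_ - _).
  rewrite -(E f^\+); [|exact: measurable_funepos|by move=> ?; exact: funepos_ge0].
  by apply: eq_integral => x _; rewrite !funeposE.
rewrite -(E f^\-); [|exact: measurable_funeneg|by move=> ?; exact: funeneg_ge0].
by apply: eq_integral => x _; rewrite !funenegE.
Qed.

End AffineChange.

(** * Characteristic functions of exponential densities *)

Section FourierKernels.
Variable R : realType.
Let mu := @lebesgue_measure R.
Implicit Types (f g : R -> R) (P Q : R -> R[i]).

Lemma EFin_Rintegral f : mu.-integrable setT (EFin \o f) ->
  (\int[mu]_x f x)%:E = (\int[mu]_x (f x)%:E)%E.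
Proof. by move=> fi; rewrite fineK//; exact: integrable_fin_num. Qed.

Lemma measurable_halfline (g : R -> R) : measurable_fun setT g ->
  measurable_fun setT (fun s : R => if 0 <= s then g s else 0).
Proof.
by move=> mg; apply: measurable_fun_ifT => //; exact: measurable_fun_ler.
Qed.

Lemma integral_halfline (g : R -> R) :
  (\int[mu]_s (if 0 <= s then g s else 0)%:E = \int[mu]_(s in `[0%R, +oo[) (g s)%:E)%E.
Proof.
rewrite [RHS]integral_mkcond; apply: eq_integral => s _.
by rewrite patchE mem_setE in_itv /= andbT; case: ifP.
Qed.

Lemma ftc_halfline (g G : R -> R) (l : R) :
  (forall s : R, is_derive s (1 : R) G (g s)) -> continuous g ->
  (forall s, 0 <= s -> 0 <= g s) -> G s @[s --> +oo] --> l ->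
  (\int[mu]_s (if 0 <= s then g s else 0)%:E = (l - G 0)%:E)%E.
Proof.
move=> dG cg g0 Gl; rewrite integral_halfline EFinB.
have dG' s : derivable G s 1 by have [] := dG s.
apply: ge0_continuous_FTC2y => //.
- exact: continuous_subspaceT.
- by apply/cvg_at_right_filter/differentiable_continuous/derivable1_diffP.
- by move=> s _; rewrite derive1E derive_val.
Qed.

Lemma cvg_expR_trig (a x p q r : R) : 0 < a ->
  expR (- a * s) * (p * cos (x * s) + q * sin (x * s) + r) @[s --> +oo] --> (0 : R).
Proof.
move=> a0; pose M := `|p| + `|q| + `|r|.
have e0 : expR (- a * s) * M @[s --> +oo] --> (0 : R).
  rewrite -[X in _ --> X](mul0r M); apply: cvgM; last exact: cvg_cst.
  rewrite (_ : (fun s => expR (- a * s)) = (fun z => expR (- z)) \o (fun z => a * z)).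
    by apply: (@cvg_comp _ _ _ _ _ _ (pinfty_nbhs R)); [exact: gt0_cvgMry|exact: cvgr_expR].
  by apply/funext => s /=; rewrite mulNr.
apply/norm_cvg0P; apply: squeeze_cvgr (cvg_cst 0) e0.
  apply: nearW => s; rewrite normr_ge0 /= normrM ger0_norm ?expR_ge0//.
  rewrite ler_wpM2l ?expR_ge0// (le_trans (ler_normD _ _))// lerD2r.
  rewrite (le_trans (ler_normD _ _))// !normrM lerD// ler_piMr// ler_norml.
    by rewrite cos_geN1 cos_le1.
  by rewrite sin_geN1 sin_le1.
Qed.

(** The constant r serves to make the integrand nonnegative, as [ftc_halfline] requires; the
    antiderivative [G] is explicit. *)
Lemma integral_expR_trig (a x p q r : R) : 0 < a ->
  (forall s, 0 <= p * cos (x * s) + q * sin (x * s) + r) ->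
  (\int[mu]_s (if (0 <= s)%R then
     expR (- a * s) * (p * cos (x * s) + q * sin (x * s) + r) else 0)%:E =
   ((p * a + q * x) / (a ^+ 2 + x ^+ 2) + r / a)%:E)%E.
Proof.
move=> a0 h0; pose d := a ^+ 2 + x ^+ 2.
have d0 : d != 0 by rewrite gt_eqF// ltr_pwDl ?sqr_ge0// exprn_gt0.
pose G s := expR (- a * s) * ((- (p * a + q * x) / d) * cos (x * s) +
  ((p * x - q * a) / d) * sin (x * s) + (- r / a)).
transitivity (0 - G 0)%:E; last first.
  congr EFin; rewrite /G /d !mulr0 expR0 cos0 sin0; field.
  by rewrite -/d d0 gt_eqF.
apply: ftc_halfline.
- move=> s; apply: is_derive_eq; rewrite /GRing.scale /= /d; field.
  by rewrite -/d d0 gt_eqF.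
- move=> s; apply: differentiable_continuous; apply/derivable1_diffP.
  exact: ex_derive.
- by move=> s _; rewrite mulr_ge0 ?expR_ge0.
- exact: cvg_expR_trig.
Qed.

Lemma integrable_bounded_mul (t f : R -> R) : measurable_fun setT t ->
  (forall s, `|t s| <= 1) -> mu.-integrable setT (EFin \o f) ->
  mu.-integrable setT (EFin \o (fun s => t s * f s)).
Proof.
move=> mt t1 fi; have mf : measurable_fun setT f by apply/measurable_EFinP; case/integrableP: fi.
apply: le_integrable fi => //; first exact/measurable_EFinP/measurable_funM.
by move=> s _ /=; rewrite lee_fin normrM ler_piMl.
Qed.

Lemma measurable_cosM (x : R) : measurable_fun setT (fun s : R => cos (x * s)).
Proof.
apply: continuous_measurable_fun => s; apply: differentiable_continuous.
by apply/derivable1_diffP; exact: ex_derive.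
Qed.

Lemma measurable_sinM (x : R) : measurable_fun setT (fun s : R => sin (x * s)).
Proof.
apply: continuous_measurable_fun => s; apply: differentiable_continuous.
by apply/derivable1_diffP; exact: ex_derive.
Qed.

Lemma normr_cos_le1 (x : R) : `|cos x| <= 1.
Proof. by rewrite ler_norml cos_geN1 cos_le1. Qed.

Lemma normr_sin_le1 (x : R) : `|sin x| <= 1.
Proof. by rewrite ler_norml sin_geN1 sin_le1. Qed.

(** P is the characteristic function x |-> integral of e^(ixs) f (s), split into real and imaginary
    parts. Boundedness is included so that convolutions are finite at every point and limits can be
    dominated. *)
Record ft f P : Prop := FT {
  ft_ge0 : forall s, 0 <= f s ;
  ft_meas : measurable_fun setT f ;
  ft_bnd : exists M : R, forall s, f s <= M ;
  ft_int : mu.-integrable setT (EFin \o f) ;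
  ftE : forall x, P x =
    (\int[mu]_s (cos (x * s) * f s)) +i* (\int[mu]_s (sin (x * s) * f s))
}.

(** The Gamma density without its normalization: for a > 0 the mass is a^(-m-1). The value a = 0, a
    truncated power, is the building block of the Dirichlet weight. For m = 0 there is a jump at 0,
    where the value is 1. *)
Definition gam (m : nat) (a s : R) : R :=
  if 0 <= s then expR (- a * s) * (s ^+ m / m`!%:R) else 0.

Lemma gam_ge0 m a s : 0 <= gam m a s.
Proof.
rewrite /gam; case: ifP => // s0.
by rewrite mulr_ge0 ?expR_ge0// divr_ge0 ?exprn_ge0.
Qed.

Lemma measurable_gam m a : measurable_fun setT (gam m a).
Proof.
apply: measurable_halfline; apply: measurable_funM.
  exact: measurableT_comp.
by apply: measurable_funM => //; exact: measurable_funX.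
Qed.

Lemma gam0E a s : gam 0 a s = if 0 <= s then expR (- a * s) else 0.
Proof. by rewrite /gam expr0 fact0 divr1 mulr1. Qed.

Lemma integral_gam0 a : 0 < a -> (\int[mu]_s (gam 0 a s)%:E = (a^-1)%:E)%E.
Proof.
move=> a0; rewrite -[RHS]/((a^-1)%:E).
have H s : 0 <= 0 * cos (0 * s) + 0 * sin (0 * s) + 1 :> R by lra.
transitivity ((0 * a + 0 * 0) / (a ^+ 2 + 0 ^+ 2) + 1 / a)%:E; last first.
  by congr EFin; rewrite !mul0r addr0 mul0r add0r div1r.
rewrite -(integral_expR_trig a0 H); apply: eq_integral => s _.
by rewrite gam0E; case: ifP => // _; congr EFin; ring.
Qed.

Lemma integrable_gam0 a : 0 < a -> mu.-integrable setT (EFin \o gam 0 a).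
Proof.
move=> a0; apply/integrableP; split; first by apply/measurable_EFinP; exact: measurable_gam.
under eq_integral do rewrite /= ger0_norm ?gam_ge0//.
by rewrite integral_gam0// ltry.
Qed.

Lemma integral_cos_gam0 a x : 0 < a ->
  \int[mu]_s (cos (x * s) * gam 0 a s) = a / (a ^+ 2 + x ^+ 2).
Proof.
move=> a0; have gi := integrable_gam0 a0.
have ci := integrable_bounded_mul (measurable_cosM x) (fun s => normr_cos_le1 _) gi.
(* Adding the mass 1 / a replaces cos by the nonnegative function cos + 1. *)
apply: (@addIr _ (a^-1)); have -> : a^-1 = \int[mu]_s gam 0 a s.
  by rewrite /Rintegral integral_gam0.
rewrite -RintegralD//; have := @integral_expR_trig a x 1 0 1 a0.
rewrite mul1r mul0r addr0 /Rintegral integral_gam0//= div1r => H.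
rewrite -[RHS]/(fine (_%:E)) -H.
  congr fine; apply: eq_integral => s _; rewrite gam0E; case: ifP => _.
    by congr EFin; ring.
  by rewrite mulr0 addr0.
move=> s; have := cos_geN1 (x * s); lra.
Qed.

Lemma integral_sin_gam0 a x : 0 < a ->
  \int[mu]_s (sin (x * s) * gam 0 a s) = x / (a ^+ 2 + x ^+ 2).
Proof.
move=> a0; have gi := integrable_gam0 a0.
have ci := integrable_bounded_mul (measurable_sinM x) (fun s => normr_sin_le1 _) gi.
apply: (@addIr _ (a^-1)); have -> : a^-1 = \int[mu]_s gam 0 a s.
  by rewrite /Rintegral integral_gam0.
rewrite -RintegralD//; have := @integral_expR_trig a x 0 1 1 a0.
rewrite mul1r mul0r add0r /Rintegral integral_gam0//= div1r => H.
rewrite -[RHS]/(fine (_%:E)) -H.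
  congr fine; apply: eq_integral => s _; rewrite gam0E; case: ifP => _.
    by congr EFin; ring.
  by rewrite mulr0 addr0.
move=> s; have := sin_geN1 (x * s); lra.
Qed.

Lemma ft_gam0 a : 0 < a -> ft (gam 0 a) (fun x => (a -i* x)^-1).
Proof.
move=> a0; split; [exact: gam_ge0|exact: measurable_gam| |exact: integrable_gam0|].
  exists 1 => s; rewrite gam0E; case: ifP => // s0.
  by rewrite -expR0 ler_expR mulNr oppr_le0 mulr_ge0// ltW.
move=> x; rewrite integral_cos_gam0// integral_sin_gam0//.
have d0 : a ^+ 2 + x ^+ 2 != 0 by rewrite gt_eqF// ltr_pwDl ?sqr_ge0// exprn_gt0.
have n0 : a -i* x != 0 by rewrite eq_complex /= negb_and gt_eqF.
apply: (mulfI n0); rewrite mulfV//; apply/esym/eqP; rewrite eq_complex /=.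
by apply/andP; split; apply/eqP; field.
Qed.

End FourierKernels.

(** * Convolutions of bounded integrable functions *)

Section Convolution.
Variable R : realType.
Let mu := @lebesgue_measure R.
Implicit Types (f g : R -> R) (P Q : R -> R[i]).

Definition convol f g (s : R) : R := \int[mu]_y (f y * g (s - y)).

Section Pair.
Variables f g : R -> R.
Hypotheses (f0 : forall s, 0 <= f s) (mf : measurable_fun setT f)
  (fi : mu.-integrable setT (EFin \o f)).
Hypotheses (g0 : forall s, 0 <= g s) (mg : measurable_fun setT g)
  (gi : mu.-integrable setT (EFin \o g)).
Variable M : R.
Hypothesis gM : forall s, g s <= M.

Lemma measurable_reflect (s : R) : measurable_fun setT (fun y : R => g (s - y)).
Proof. by apply: (measurableT_comp mg); exact: measurable_funB. Qed.

Lemma conv_integrable s : mu.-integrable setT (EFin \o (fun y : R => f y * g (s - y))).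
Proof.
apply: le_integrable (integrableZl measurableT M fi) => //.
  by apply/measurable_EFinP; apply: measurable_funM => //; exact: measurable_reflect.
move=> y _ /=; rewrite lee_fin ger0_norm ?mulr_ge0// normrM (ger0_norm (f0 y)) mulrC.
by rewrite ler_wpM2r// ler_normr gM.
Qed.

Lemma convE s : (convol f g s)%:E = (\int[mu]_y (f y * g (s - y))%:E)%E.
Proof. exact: EFin_Rintegral (conv_integrable s). Qed.

Lemma conv_ge0 s : 0 <= convol f g s.
Proof. by apply: Rintegral_ge0 => y _; rewrite mulr_ge0. Qed.

Lemma conv_le s : convol f g s <= M * \int[mu]_y f y.
Proof.
rewrite -RintegralZl//; apply: le_Rintegral => //; first exact: conv_integrable.
  by have := integrableZl measurableT M fi; apply: eq_integrable.
by move=> y _; rewrite mulrC ler_wpM2r.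
Qed.

Let measurable_kernel : measurable_fun setT (fun p : R * R => f p.2 * g (p.1 - p.2)).
Proof.
apply: measurable_funM; first exact: measurableT_comp.
by apply: (measurableT_comp mg); exact: measurable_funB.
Qed.

Lemma measurable_conv : measurable_fun setT (convol f g).
Proof.
pose F (p : R * R) := (f p.2 * g (p.1 - p.2))%:E.
have mF : measurable_fun setT F by apply/measurable_EFinP.
have F0 p : (0 <= F p)%E by rewrite lee_fin mulr_ge0.
have := measurable_fun_fubini_tonelli_F (m2 := mu) F mF F0.
exact: measurableT_comp.
Qed.

(** Fubini against a bounded test function t: t = 1 gives integrability of the convolution, cosines
    and sines give its characteristic function. *)
Lemma integral_conv (t : R -> R) : measurable_fun setT t -> (forall s, `|t s| <= 1) ->
  mu.-integrable setT (EFin \o (fun s => t s * convol f g s)) /\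
  \int[mu]_s (t s * convol f g s) = \int[mu]_y (f y * \int[mu]_s (t (s + y) * g s)).
Proof.
move=> mt t1; pose F (p : R * R) := (t p.1 * (f p.2 * g (p.1 - p.2)))%:E.
have mF : measurable_fun setT F.
  by apply/measurable_EFinP/measurable_funM => //; exact: measurableT_comp.
have iF : (mu \x mu)%E.-integrable setT F.
  apply/integrable21ltyP => //.
  apply: (@le_lt_trans _ _ (\int[mu]_y ((f y)%:E * \int[mu]_s (g s)%:E))%E).
    apply: ge0_le_integral => //.
    - by move=> y _; apply: integral_ge0.
    - have mFa : measurable_fun setT (fun p => `|F p|)%E by exact: measurableT_comp.
      exact: (measurable_fun_fubini_tonelli_G (m1 := mu) _ mFa).
    - apply: emeasurable_funM; last exact: measurable_cst.
      exact/measurable_EFinP.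
    - move=> y _; rewrite -(@integral_isometry R 1 (- y) (fun s => (g s)%:E)) ?normr1//; last exact/measurable_EFinP.
      rewrite -ge0_integralZl//; last 3 first.
      + by apply/measurable_EFinP/(measurableT_comp mg); exact: measurable_affine.
      + by move=> s _; rewrite lee_fin.
      + by rewrite lee_fin.
      apply: ge0_le_integral => //.
      + by apply: measurableT_comp => //; exact: measurableT_comp.
      + apply: emeasurable_funM; first exact: measurable_cst.
        by apply/measurable_EFinP/(measurableT_comp mg); exact: measurable_affine.
      + move=> s _; rewrite /F /= -EFinM lee_fin normrM mul1r.
        by rewrite (ger0_norm (mulr_ge0 _ _))// ler_piMl// mulr_ge0.
  rewrite ge0_integralZr//; last 3 first.
  + exact/measurable_EFinP.
  + by move=> y _; rewrite lee_fin.
  + by apply: integral_ge0 => s _; rewrite lee_fin.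
  by rewrite -EFin_Rintegral// -EFin_Rintegral// -EFinM ltry.
have E1 s : (\int[mu]_y F (s, y) = (t s * convol f g s)%:E)%E.
  rewrite EFinM convE -integralZl//; last exact: conv_integrable.
have E2 y : (\int[mu]_s F (s, y) = (f y * \int[mu]_s (t (s + y) * g s))%:E)%E.
  have mty : measurable_fun setT (fun s : R => t (s + y)).
    by apply: (measurableT_comp mt); exact: measurable_funD.
  have tgi := integrable_bounded_mul mty (fun s => t1 _) gi.
  rewrite EFinM EFin_Rintegral// -integralZl//.
  rewrite -(@integral_isometry R 1 (- y) (fun s => ((f y)%:E * (t (s + y) * g s)%:E)%E)) ?normr1//.
    by apply: eq_integral => s _; rewrite mul1r subrK /F /= -EFinM; congr EFin; ring.
  apply: emeasurable_funM; first exact: measurable_cst.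
  by apply/measurable_EFinP/measurable_funM.
split.
  by have := integrable_fubini_F iF; apply: eq_integrable => // s _ /=; rewrite -E1.
congr fine; under eq_integral do rewrite -E1.
by under [RHS]eq_integral do rewrite -E2; exact: Fubini.
Qed.

Lemma conv_is_integrable : mu.-integrable setT (EFin \o convol f g).
Proof.
have [|//|+ _] := @integral_conv (cst 1); first exact: measurable_cst.
  by move=> s /=; rewrite normr1.
by apply: eq_integrable => // s _ /=; rewrite mul1r.
Qed.

End Pair.

Lemma ft_conv f g P Q : ft f P -> ft g Q -> ft (convol f g) (fun x => P x * Q x).
Proof.
move=> [f0 mf _ fi fP] [g0 mg [M gM] gi gQ]; split.
- by move=> s; exact: conv_ge0.
- exact: measurable_conv.
- by exists (M * \int[mu]_y f y) => s; exact: conv_le.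
- exact: conv_is_integrable.
move=> x; have mc := measurable_cosM x; have ms := measurable_sinM x.
have c1 (s : R) : `|cos (x * s)| <= 1 := normr_cos_le1 _.
have s1 (s : R) : `|sin (x * s)| <= 1 := normr_sin_le1 _.
have [_ ->] := integral_conv f0 mf fi g0 mg gi gM mc c1.
have [_ ->] := integral_conv f0 mf fi g0 mg gi gM ms s1.
rewrite fP gQ; set Cg := (X in _ * (X +i* _)); set Sg := (X in _ * (_ +i* X)).
have cgi := integrable_bounded_mul mc c1 gi; have sgi := integrable_bounded_mul ms s1 gi.
have cfi := integrable_bounded_mul mc c1 fi; have sfi := integrable_bounded_mul ms s1 fi.
have iZl (h : R -> R) (c : R) : mu.-integrable setT (EFin \o h) ->
    mu.-integrable setT (EFin \o (fun s => c * h s)).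
  by move=> hi; have := integrableZl measurableT c hi; apply: eq_integrable.
have Ec y : \int[mu]_s (cos (x * (s + y)) * g s) = cos (x * y) * Cg - sin (x * y) * Sg.
  rewrite -RintegralZl// -(RintegralZl (sin (x * y)))// -RintegralB//; try exact: iZl.
  by apply: eq_Rintegral => s _; rewrite mulrDr cosD; ring.
have Es y : \int[mu]_s (sin (x * (s + y)) * g s) = sin (x * y) * Cg + cos (x * y) * Sg.
  rewrite -RintegralZl// -(RintegralZl (cos (x * y)))// -RintegralD//; try exact: iZl.
  by apply: eq_Rintegral => s _; rewrite mulrDr sinD; ring.
apply/eqP; rewrite eq_complex /=; apply/andP; split; apply/eqP.
  rewrite -(RintegralZr Cg)// -(RintegralZr Sg)// -RintegralB//.
  - by apply: eq_Rintegral => y _; rewrite Ec; ring.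
  - by have := iZl _ Cg cfi; apply: eq_integrable => // y _ /=; rewrite mulrC.
  - by have := iZl _ Sg sfi; apply: eq_integrable => // y _ /=; rewrite mulrC.
rewrite addrC -(RintegralZr Cg)// -(RintegralZr Sg)// -RintegralD//.
- by apply: eq_Rintegral => y _; rewrite Es; ring.
- by have := iZl _ Cg sfi; apply: eq_integrable => // y _ /=; rewrite mulrC.
- by have := iZl _ Sg cfi; apply: eq_integrable => // y _ /=; rewrite mulrC.
Qed.

End Convolution.

(** * Fourier inversion at the point 1 *)

Section FourierInversion.
Variable R : realType.
Let mu := @lebesgue_measure R.
Implicit Types (f g : R -> R) (P Q : R -> R[i]).

(** One exceptional point is allowed, to accommodate the value 2 of the Abel weight at 0 and the
    jump of [gam] at 0. *)
Lemma dominated_cvg_off (c : R) (h : nat -> R -> R) (l b : R -> R) :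
  (forall n, measurable_fun setT (h n)) -> measurable_fun setT l ->
  (forall x, x != c -> h n x @[n --> \oo] --> l x) ->
  mu.-integrable setT (EFin \o b) -> (forall n x, `|h n x| <= b x) ->
  (\int[mu]_x (h n x)%:E @[n --> \oo] --> \int[mu]_x (l x)%:E)%E.
Proof.
move=> mh ml hl bi hb.
have [|||||_ _ H] := @dominated_convergence _ _ _ mu setT measurableT
    (fun n x => (h n x)%:E) (fun x => (l x)%:E) (EFin \o b).
- by move=> n; apply/measurable_EFinP; exact: mh.
- exact/measurable_EFinP.
- exists [set c]; split => //; first exact: lebesgue_measure_set1.
  move=> x /= H; apply/eqP/negPn/negP => /hl hx; apply: H => _.
  by apply: cvg_EFin; [exact: nearW|exact: hx].
- exact: bi.
- by apply: aeW => x n _ /=; rewrite lee_fin.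
- exact: H.
Qed.

Lemma onesqr_gt0 (x : R) : 0 < 1 + x ^+ 2.
Proof. by rewrite ltr_pwDl ?sqr_ge0. Qed.

Lemma continuous_cauchy : continuous (fun x : R => (1 + x ^+ 2)^-1).
Proof.
move=> x; apply: cvgV; first by rewrite gt_eqF// onesqr_gt0.
by apply: cvgD; [exact: cvg_cst|exact: exprn_continuous].
Qed.

Lemma integral_cauchy : (\int[mu]_x ((1 + x ^+ 2)^-1)%:E = pi%:E)%E.
Proof.
rewrite ge0_symfun_integralT; last 3 first.
- by move=> x; rewrite invr_ge0 ltW// onesqr_gt0.
- exact: continuous_cauchy.
- by move=> x /=; rewrite sqrrN.
rewrite -set_itvcy -integral_halfline.
have H : (\int[mu]_x (if 0 <= x then (1 + x ^+ 2)^-1 else 0)%:E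
    = (pi / 2 - atan 0)%:E :> \bar R)%E.
  apply: (@ftc_halfline _ (fun x : R => (1 + x ^+ 2)^-1) (@atan R) (pi / 2)); [exact: continuous_cauchy| |exact: cvgy_atan].
  by move=> x _; rewrite invr_ge0 ltW// onesqr_gt0.
rewrite H atan0 subr0 -EFinM; congr EFin.
by rewrite mulrC divfK.
Qed.

Lemma integrable_cauchy (c : R) :
  mu.-integrable setT (EFin \o (fun x => c / (1 + x ^+ 2))).
Proof.
have : mu.-integrable setT (EFin \o (fun x : R => (1 + x ^+ 2)^-1)).
  apply/integrableP; split.
    by apply/measurable_EFinP; apply: (@continuous_measurable_fun R _ (@continuous_cauchy)).
  under eq_integral do rewrite /= ger0_norm ?invr_ge0 ?(ltW (onesqr_gt0 _))//.
  by rewrite integral_cauchy ltry.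
by move/(integrableZl measurableT c); apply: eq_integrable.
Qed.

(** Continuity along sequences at one point, the form in which dominated convergence consumes and
    produces it. *)
Definition scont f (s : R) := forall u : nat -> R,
  u n @[n --> \oo] --> s -> f (u n) @[n --> \oo] --> f s.

(* e^(- e |x|), except for the value 2 at 0. *)
Definition abel_weight (e x : R) := gam 0 e x + gam 0 e (- x).

Lemma measurable_abel_weight e : measurable_fun setT (abel_weight e).
Proof.
apply: measurable_funD; first exact: measurable_gam.
by apply: measurableT_comp => //; exact: measurable_gam.
Qed.

Lemma abel_weight_ge0 e x : 0 <= abel_weight e x.
Proof. by rewrite addr_ge0// gam_ge0. Qed.

Lemma abel_weight_le2 e x : 0 < e -> abel_weight e x <= 2.
Proof.
have le1 y : 0 < e -> gam 0 e y <= 1.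
  move=> e0; rewrite gam0E; case: ifP => // y0.
  by rewrite -expR0 ler_expR mulNr oppr_le0 mulr_ge0// ltW.
by move=> e0; rewrite (_ : 2 = 1 + 1)// lerD// le1.
Qed.

Lemma abel_weight_cvg x : x != 0 ->
  abel_weight (n.+1%:R^-1) x @[n --> \oo] --> (1 : R).
Proof.
move=> x0.
have E n : abel_weight (n.+1%:R^-1) x = expR (- (n.+1%:R^-1 * `|x|)).
  rewrite /abel_weight !gam0E oppr_ge0.
  have [xp|xn] := ltP 0 x.
    by rewrite ltW// addr0 gtr0_norm// mulNr.
  have xn' : x < 0 by rewrite lt_neqAle x0.
  by rewrite leNgt xn' add0r ltr0_norm// mulNr.
rewrite (_ : (fun n => _) = (fun n : nat => expR (- (n.+1%:R^-1 * `|x|)))); last exact/funext.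
have H : - (n.+1%:R^-1 * `|x|) @[n --> \oo] --> (0 : R).
  rewrite -[X in _ --> X]oppr0 -[X in _ --> - X](mul0r `|x|).
  by apply: cvgN; apply: cvgM; [exact: cvg_harmonic|exact: cvg_cst].
by rewrite -[X in _ --> X](@expR0 R); exact: (cvg_comp _ _ H (@continuous_expR R 0)).
Qed.

Lemma integrable_opp f : mu.-integrable setT (EFin \o f) ->
  mu.-integrable setT (EFin \o (fun x => f (- x))).
Proof.
move=> fi; have mf : measurable_fun setT f by apply/measurable_EFinP; case/integrableP: fi.
apply/integrableP; split; first by apply/measurable_EFinP/(measurableT_comp mf).
have H := @integral_isometry R (-1) 0 (fun x => `|(f x)%:E|%E) (normrN1 _).
have -> : (\int[mu]_x `|(f (- x)%R)%:E| =
    \int[mu]_x `|(f (-1 * x + 0))%:E|)%E.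
  by apply: eq_integral => x _ /=; rewrite mulN1r addr0.
rewrite H; first by case/integrableP: fi.
by apply: measurableT_comp => //; exact/measurable_EFinP.
Qed.

Lemma Rintegral_opp f : measurable_fun setT f ->
  \int[mu]_x f (- x) = \int[mu]_x f x.
Proof.
move=> mf; congr fine.
rewrite -(@integral_isometry R (-1) 0 (fun x => (f x)%:E)) ?normrN1//; last exact/measurable_EFinP.
by apply: eq_integral => x _; rewrite mulN1r addr0.
Qed.

Lemma integrable_abel_weight e : 0 < e -> mu.-integrable setT (EFin \o abel_weight e).
Proof.
move=> e0; have gi := integrable_gam0 e0.
by have := integrableD measurableT gi (integrable_opp gi); apply: eq_integrable.
Qed.

Lemma integral_abel_weight_cos e c : 0 < e ->
  \int[mu]_x (abel_weight e x * cos (x * c)) = 2 * (e / (e ^+ 2 + c ^+ 2)).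
Proof.
move=> e0; have gi := integrable_gam0 e0.
pose h (x : R) := cos (c * x) * gam 0 e x.
have hi : mu.-integrable setT (EFin \o h).
  exact: (integrable_bounded_mul (measurable_cosM c) (fun s => normr_cos_le1 _) gi).
have mh : measurable_fun setT h by apply/measurable_EFinP; case/integrableP: hi.
have E : \int[mu]_x h x = e / (e ^+ 2 + c ^+ 2) by exact: integral_cos_gam0.
transitivity (\int[mu]_x (h x + h (- x))).
  apply: eq_Rintegral => x _; rewrite /abel_weight /h mulrN cosN [x * c]mulrC.
  by rewrite mulrDl; congr (_ + _); exact: mulrC.
rewrite RintegralD//; last exact: integrable_opp.
by rewrite Rintegral_opp// E; ring.
Qed.

Section Inversion.
Variables (f : R -> R) (P : R -> R[i]) (c : R).
Hypotheses (hf : ft f P) (fc : scont f 1)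
  (Pc : forall x, cabs (P x) <= c / (1 + x ^+ 2)).

Let f0 := ft_ge0 hf.
Let mf := ft_meas hf.
Let fi := ft_int hf.

Let C (x : R) := \int[mu]_s (cos (x * (s - 1)) * f s).
Let S (x : R) := \int[mu]_s (sin (x * (s - 1)) * f s).

Let mtrig (t : R -> R) : continuous t ->
  measurable_fun setT (fun p : R * R => t (p.1 * (p.2 - 1))).
Proof.
move=> ct; apply: (measurableT_comp (f := t)); first exact: continuous_measurable_fun.
by apply: measurable_funM => //; apply: measurable_funB.
Qed.

Let mtrig2 (t : R -> R) x : continuous t ->
  measurable_fun setT (fun s : R => t (x * (s - 1))).
Proof.
move=> ct; apply: (measurableT_comp (f := t)); first exact: continuous_measurable_fun.
by apply: measurable_funM => //; apply: measurable_funB.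
Qed.

(** Tonelli's measurability statement asks for a nonnegative kernel: 1 + t is integrated against f,
    and the integral of f is subtracted. *)
Let measurable_trans (t : R -> R) : continuous t -> (forall x, `|t x| <= 1) ->
  measurable_fun setT (fun x : R => \int[mu]_s (t (x * (s - 1)) * f s)).
Proof.
move=> ct t1; pose F (p : R * R) := ((1 + t (p.1 * (p.2 - 1))) * f p.2)%:E.
have mF : measurable_fun setT F.
  apply/measurable_EFinP/measurable_funM; last exact: measurableT_comp.
  by apply: measurable_funD => //; exact: mtrig.
have F0 p : (0 <= F p)%E.
  rewrite lee_fin mulr_ge0//; have := t1 (p.1 * (p.2 - 1)).
  by rewrite ler_norml => /andP[+ _]; rewrite -lerBlDl sub0r.
have mG : measurable_fun setT (fun x : R => fine (\int[mu]_s F (x, s))%E).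
  have := measurable_fun_fubini_tonelli_F (m2 := mu) F mF F0.
  exact: measurableT_comp.
have -> : (fun x : R => \int[mu]_s (t (x * (s - 1)) * f s)) =
    (fun x : R => fine (\int[mu]_s F (x, s))%E - \int[mu]_s f s).
  apply/funext => x; apply/(canRL (addrK _)); rewrite -RintegralD//.
    by congr fine; apply: eq_integral => s _; rewrite /F /=; congr EFin; ring.
  exact: integrable_bounded_mul (mtrig2 x ct) (fun s => t1 _) fi.
exact: measurable_funB.
Qed.

Let PE x : (cos x -i* sin x) * P x = C x +i* S x.
Proof.
have mc := measurable_cosM x; have ms := measurable_sinM x.
have cfi := integrable_bounded_mul mc (fun s => normr_cos_le1 _) fi.
have sfi := integrable_bounded_mul ms (fun s => normr_sin_le1 _) fi.
have iZl (h : R -> R) (a : R) : mu.-integrable setT (EFin \o h) ->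
    mu.-integrable setT (EFin \o (fun s => a * h s)).
  by move=> hi; have := integrableZl measurableT a hi; apply: eq_integrable.
rewrite (ftE hf); apply/eqP; rewrite eq_complex /=; apply/andP; split; apply/eqP.
  rewrite mulNr opprK -!RintegralZl// -RintegralD//; try exact: iZl.
  by apply: eq_Rintegral => s _; rewrite mulrBr mulr1 cosB; ring.
rewrite mulNr -!RintegralZl// -RintegralB//; try exact: iZl.
by apply: eq_Rintegral => s _; rewrite mulrBr mulr1 sinB; ring.
Qed.

Let CS_le x : `|C x| <= c / (1 + x ^+ 2) /\ `|S x| <= c / (1 + x ^+ 2).
Proof.
have H : cabs (C x +i* S x) <= c / (1 + x ^+ 2).
  rewrite -PE cabsM (_ : cabs (cos x -i* sin x) = 1) ?mul1r//.
  by rewrite cabsE /= sqrrN cos2Dsin2 sqrtr1.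
by split; apply: le_trans H; [exact: (Re_le_cabs (_ +i* _))|exact: (Im_le_cabs (_ +i* _))].
Qed.

Let mC : measurable_fun setT C.
Proof. by apply: measurable_trans; [exact: continuous_cos|exact: normr_cos_le1]. Qed.

Let mS : measurable_fun setT S.
Proof. by apply: measurable_trans; [exact: continuous_sin|exact: normr_sin_le1]. Qed.

Let iC : mu.-integrable setT (EFin \o C).
Proof.
apply: le_integrable (integrable_cauchy c) => //; first exact/measurable_EFinP.
by move=> x _ /=; rewrite lee_fin (le_trans (CS_le x).1)// ler_norm.
Qed.

Let iS : mu.-integrable setT (EFin \o S).
Proof.
apply: le_integrable (integrable_cauchy c) => //; first exact/measurable_EFinP.
by move=> x _ /=; rewrite lee_fin (le_trans (CS_le x).2)// ler_norm.
Qed.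

Let integral_S : \int[mu]_x S x = 0.
Proof.
have : \int[mu]_x S (- x) = - \int[mu]_x S x.
  rewrite -mulN1r -RintegralZl//; apply: eq_Rintegral => x _.
  rewrite /S -RintegralZl//; last first.
    exact: integrable_bounded_mul (mtrig2 x (@continuous_sin R)) (fun s => normr_sin_le1 _) fi.
  by apply: eq_Rintegral => s _; rewrite mulNr sinN; ring.
rewrite Rintegral_opp// => e; lra.
Qed.

(** The Fourier transform of e^(-e|x|) is the kernel 2 e / (e^2 + (s - 1)^2). The substitution s = e
    y + 1 moves the dependence on e from the kernel into the argument of f. *)
Let abelE e : 0 < e -> (\int[mu]_x (abel_weight e x * C x)%:E =
  \int[mu]_y (f (e * y + 1) * (2 / (1 + y ^+ 2)))%:E)%E.
Proof.
move=> e0; pose F (p : R * R) := (abel_weight e p.1 * (cos (p.1 * (p.2 - 1)) * f p.2))%:E.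
have mw := measurable_abel_weight e; have wi := integrable_abel_weight e0.
have mF : measurable_fun setT F.
  apply/measurable_EFinP/measurable_funM; first exact: measurableT_comp.
  apply: measurable_funM; first by apply: mtrig; exact: continuous_cos.
  exact: measurableT_comp.
have cfi x : mu.-integrable setT (EFin \o (fun s => cos (x * (s - 1)) * f s)).
  exact: integrable_bounded_mul (mtrig2 x (@continuous_cos R)) (fun s => normr_cos_le1 _) fi.
have iF : (mu \x mu)%E.-integrable setT F.
  apply/integrable12ltyP => //.
  apply: (@le_lt_trans _ _ (\int[mu]_x ((abel_weight e x)%:E * \int[mu]_s (f s)%:E))%E).
    apply: ge0_le_integral => //.
    - by move=> y _; apply: integral_ge0.
    - have mFa : measurable_fun setT (fun p => `|F p|)%E by exact: measurableT_comp.
      exact: (measurable_fun_fubini_tonelli_F (m2 := mu) _ mFa).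
    - apply: emeasurable_funM; last exact: measurable_cst.
      exact/measurable_EFinP.
    - move=> x _; rewrite -ge0_integralZl//; last 3 first.
      + exact/measurable_EFinP.
      + by move=> s _; rewrite lee_fin.
      + by rewrite lee_fin abel_weight_ge0.
      apply: ge0_le_integral => //.
      + by apply: measurableT_comp => //; exact: measurableT_comp.
      + apply: emeasurable_funM; first exact: measurable_cst.
        exact/measurable_EFinP.
      + move=> s _; rewrite /F /= -EFinM lee_fin normrM ger0_norm ?abel_weight_ge0//.
        rewrite ler_wpM2l ?abel_weight_ge0// normrM (ger0_norm (f0 s)).
        by rewrite ler_piMl// normr_cos_le1.
  rewrite ge0_integralZr//; last 3 first.
  + exact/measurable_EFinP.
  + by move=> y _; rewrite lee_fin abel_weight_ge0.
  + by apply: integral_ge0 => s _; rewrite lee_fin.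
  by rewrite -EFin_Rintegral// -EFin_Rintegral// -EFinM ltry.
have E1 x : (\int[mu]_s F (x, s) = (abel_weight e x * C x)%:E)%E.
  by rewrite EFinM EFin_Rintegral// -integralZl//; exact: cfi.
have E2 s : (\int[mu]_x F (x, s) = (f s * (2 * (e / (e ^+ 2 + (s - 1) ^+ 2))))%:E)%E.
  have mcs : measurable_fun setT (fun x : R => cos (x * (s - 1))).
    by under eq_fun do rewrite mulrC; exact: measurable_cosM.
  have wci : mu.-integrable setT (EFin \o (fun x => abel_weight e x * cos (x * (s - 1)))).
    have := integrable_bounded_mul mcs (fun x => normr_cos_le1 _) wi.
    by apply: eq_integrable => // x _ /=; rewrite mulrC.
  rewrite -integral_abel_weight_cos// EFinM EFin_Rintegral// -integralZl//.
  by apply: eq_integral => x _; rewrite /F /= -EFinM; congr EFin; ring.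
under eq_integral do rewrite -E1.
transitivity (\int[mu]_s \int[mu]_x F (x, s))%E; first exact: Fubini.
pose g (s : R) := (f s * (2 * (e / (e ^+ 2 + (s - 1) ^+ 2))))%:E.
have d0 (s : R) : 0 < e ^+ 2 + (s - 1) ^+ 2 by rewrite ltr_pwDl ?sqr_ge0// exprn_gt0.
have g0 s : (0 <= g s)%E by rewrite lee_fin mulr_ge0// mulr_ge0// divr_ge0 ?(ltW (d0 _))// ltW.
have mg : measurable_fun setT g.
  apply/measurable_EFinP/measurable_funM => //; apply: measurable_funM => //.
  apply: measurable_funM => //; apply: continuous_measurable_fun => s.
  apply: cvgV; first by rewrite gt_eqF.
  apply: cvgD; first exact: cvg_cst.
  apply: (@cvg_comp _ _ _ (fun s => s - 1) (fun s => s ^+ 2)); last exact: exprn_continuous.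
  by apply: cvgB; [exact: cvg_id|exact: cvg_cst].
transitivity (\int[mu]_s g s)%E; first by apply: eq_integral => s _; exact: E2.
have e0' : e != 0 by rewrite gt_eqF.
have := ge0_integral_affine 1 e0' mg g0; rewrite gtr0_norm// => H.
transitivity (e%:E * \int[mu]_y g (e * y + 1)%R)%E.
  by rewrite H muleA -EFinM divff// mul1e.
rewrite -ge0_integralZl//; last 2 first.
- by apply: (measurableT_comp mg); exact: measurable_affine.
- by rewrite lee_fin ltW.
apply: eq_integral => y _; rewrite /g -EFinM; congr EFin.
have y0 : 1 + y ^+ 2 != 0 by rewrite gt_eqF// onesqr_gt0.
by rewrite addrK; field; rewrite y0 gt_eqF// ltr_pwDl ?sqr_ge0// exprn_gt0.
Qed.

(** Both sides of [abelE] converge as e tends to 0. The left is dominated by 2 |C|, the right by 2 M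
    / (1 + y^2); the limit on the right is f 1 times the mass 2 pi of 2 / (1 + y^2). *)
Let integral_C : \int[mu]_x C x = 2 * pi * f 1.
Proof.
have [M fM] := ft_bnd hf.
have M0 : 0 <= M by rewrite (le_trans (f0 0)).
pose e (n : nat) : R := n.+1%:R^-1; have e0 n : 0 < e n by rewrite invr_gt0.
have L1 : (\int[mu]_x (abel_weight (e n) x * C x)%:E @[n --> \oo] -->
    \int[mu]_x (C x)%:E)%E.
  apply: (@dominated_cvg_off 0 (fun n x => abel_weight (e n) x * C x) C
    (fun x => 2 * `|C x|)) => //.
  - by move=> n; apply: measurable_funM => //; exact: measurable_abel_weight.
  - move=> x x0; rewrite -[X in _ --> X]mul1r; apply: cvgM; last exact: cvg_cst.
    exact: abel_weight_cvg.
  - have := integrableZl measurableT 2 (integrable_norm iC).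
    by apply: eq_integrable.
  - move=> n x; rewrite normrM ler_wpM2r// ger0_norm ?abel_weight_ge0//.
    exact: abel_weight_le2.
have L2 : (\int[mu]_y (f (e n * y + 1) * (2 / (1 + y ^+ 2)))%:E @[n --> \oo] -->
    \int[mu]_y (f 1 * (2 / (1 + y ^+ 2)))%:E)%E.
  have mcau a : measurable_fun setT (fun y : R => a / (1 + y ^+ 2)).
    by apply/measurable_EFinP; case/integrableP: (integrable_cauchy a).
  apply: (@dominated_cvg_off 0 (fun n y => f (e n * y + 1) * (2 / (1 + y ^+ 2)))
    (fun y => f 1 * (2 / (1 + y ^+ 2))) (fun y => (M * 2) / (1 + y ^+ 2))) => //.
  - move=> n; apply: measurable_funM; last exact: mcau.
    by apply: (measurableT_comp mf); exact: measurable_affine.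
  - by apply: measurable_funM; last exact: mcau.
  - move=> y _; apply: cvgM; last exact: cvg_cst.
    apply: fc; rewrite -[X in _ --> X]add0r; apply: cvgD; last exact: cvg_cst.
    rewrite -[X in _ --> X](mul0r y); apply: cvgM; last exact: cvg_cst.
    exact: cvg_harmonic.
  - exact: integrable_cauchy.
  - move=> n y; have q0 : 0 <= 2 / (1 + y ^+ 2) by rewrite divr_ge0// ltW// onesqr_gt0.
    by rewrite (ger0_norm (mulr_ge0 (f0 _) q0)) -mulrA ler_wpM2r.
have {}L1 : (\int[mu]_y (f (e n * y + 1) * (2 / (1 + y ^+ 2)))%:E @[n --> \oo] -->
    \int[mu]_x (C x)%:E)%E.
  by move: L1; under eq_fun do rewrite abelE//.
rewrite /Rintegral -(cvg_unique _ L2 L1)//.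
have -> : (\int[mu]_y (f 1 * (2 / (1 + y ^+ 2)))%:E =
    (f 1 * 2)%:E * \int[mu]_y ((1 + y ^+ 2)^-1)%:E)%E.
  rewrite -ge0_integralZl//; last 3 first.
  - apply/measurable_EFinP; apply: (@continuous_measurable_fun R _ (@continuous_cauchy)).
  - by move=> y _; rewrite lee_fin invr_ge0 ltW// onesqr_gt0.
  - by rewrite lee_fin mulr_ge0.
  by apply: eq_integral => y _; rewrite -EFinM mulrA.
by rewrite integral_cauchy -EFinM /=; ring.
Qed.

Lemma ft_inversion :
  complex_integral (fun x => (cos x -i* sin x) * P x) = (2 * pi * f 1)%:C.
Proof.
rewrite /complex_integral; apply/eqP; rewrite eq_complex /=.
apply/andP; split; apply/eqP.
  rewrite -integral_C; apply: eq_Rintegral => x _.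
  by rewrite -[X in complex.Re X]/((cos x -i* sin x) * P x) PE.
rewrite -integral_S; apply: eq_Rintegral => x _.
by rewrite -[X in complex.Im X]/((cos x -i* sin x) * P x) PE.
Qed.

End Inversion.

End FourierInversion.

(** * Gamma densities and the representation of G *)

Section GammaConvolutions.
Variable R : realType.
Let mu := @lebesgue_measure R.
Implicit Types (f g : R -> R).

Lemma is_derive_exprn (x : R) n :
  is_derive (x : R) (1 : R) (fun y : R => y ^+ n) (n%:R * x ^+ n.-1).
Proof.
apply: DeriveDef; first exact: exprn_derivable.
by rewrite exp_derive /GRing.scale /= mulr1.
Qed.

Lemma integral_exprn_fact n (s : R) : 0 < s ->
  (\int[mu]_(y in `[0%R, s]) (y ^+ n / n`!%:R)%:E = (s ^+ n.+1 / (n.+1)`!%:R)%:E)%E.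
Proof.
move=> s0; pose F (y : R) := y ^+ n.+1 / (n.+1)`!%:R.
have dF (x : R) : is_derive (x : R) (1 : R) F (x ^+ n / n`!%:R).
  have dX := is_derive_exprn x n.+1.
  apply: is_derive_eq; rewrite /GRing.scale /= factS natrM invfM; field.
  by rewrite pnatr_eq0 -lt0n fact_gt0 gt_eqF// ltr_pwDl.
have cF : continuous F.
  move=> x; apply: differentiable_continuous; apply/derivable1_diffP.
  by have [] := dF x.
transitivity ((F s)%:E - (F 0)%:E)%E; last by rewrite /F expr0n mul0r sube0.
apply: continuous_FTC2 => //.
- apply: continuous_subspaceT => x; apply: cvgM; last exact: cvg_cst.
  exact: exprn_continuous.
- split.
  + by move=> x _; have [] := dF x.
  + by apply: cvg_at_right_filter; exact: cF.
  + by apply: cvg_at_left_filter; exact: cF.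
- by move=> x _; rewrite derive1E; have [_] := dF x.
Qed.

(** On 0 <= y <= s the exponentials multiply to the constant e^(-as), which leaves the integral of
    y^m / m!. Powers of a resolvent are thus obtained from the first power by induction. *)
Lemma convol_gam m (a : R) : convol (gam m a) (gam 0 a) = gam m.+1 a.
Proof.
apply/funext => s; rewrite /convol.
pose c := expR (- a * s).
have E y : gam m a y * gam 0 a (s - y) = if (0 <= y <= s) then c * (y ^+ m / m`!%:R) else 0.
  rewrite /gam expr0 fact0 divr1 mulr1 subr_ge0; case: (0 <= y) => /=; last by rewrite mul0r.
  case: ifP => _; last by rewrite mulr0.
  rewrite mulrAC -expRD /c; congr (expR _ * _); ring.
have [s0|s0] := ltP s 0.
  rewrite [RHS]/gam leNgt s0 /= /Rintegral integral0_eq// => y _.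
  by rewrite E; case: ifP => // /andP[y0 ys]; move: (le_trans y0 ys); rewrite leNgt s0.
have -> : \int[mu]_y (gam m a y * gam 0 a (s - y)) =
    fine (\int[mu]_(y in `[0%R, s]) (c * (y ^+ m / m`!%:R))%:E)%E.
  congr fine; rewrite [RHS]integral_mkcond; apply: eq_integral => y _.
  by rewrite patchE mem_setE in_itv /= E; case: ifP.
rewrite /gam s0; move: s0; rewrite le_eqVlt => /predU1P[<-|s0].
  by rewrite set_itv1 integral_set1 expr0n mul0r mulr0.
under eq_integral do rewrite EFinM.
rewrite ge0_integralZl//; last 3 first.
- apply/measurable_EFinP; apply: measurable_funTS; apply: measurable_funM => //.
- by move=> y /=; rewrite in_itv /= => /andP[y0 _]; rewrite lee_fin divr_ge0 ?exprn_ge0.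
- by rewrite lee_fin expR_ge0.
by rewrite integral_exprn_fact.
Qed.

Lemma scont_gam m (a s : R) : s != 0 -> scont (gam m a) s.
Proof.
have near_scont (h : R -> R) (u : nat -> R) : u n @[n --> \oo] --> s -> continuous h ->
    gam m a s = h s -> (\forall n \near \oo, gam m a (u n) = h (u n)) ->
    gam m a (u n) @[n --> \oo] --> gam m a s.
  move=> us hc -> E; have := cvg_comp u h us (hc s).
  apply: cvg_trans; apply: near_eq_cvg.
  by case: E => N _ HN; exists N => // n /HN /= ->.
move=> s0 u us; have [sp|sn] := ltP 0 s.
  apply: (near_scont (fun y => expR (- a * y) * (y ^+ m / m`!%:R))) => //.
  - move=> y; apply: cvgM; last first.
      by apply: cvgM; [exact: exprn_continuous|exact: cvg_cst].
    apply: (@cvg_comp _ _ _ (fun y => - a * y) (@expR R) _ (nbhs (- a * y))).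
      by apply: cvgM; [exact: cvg_cst|exact: cvg_id].
    exact: continuous_expR.
  - by rewrite /gam ltW.
  - have [N _ HN] := cvgr_gt _ us _ sp; exists N => // n /HN un /=.
    by rewrite /gam ltW.
have sneg : s < 0 by rewrite lt_neqAle s0.
apply: (near_scont (cst 0)) => //; first by move=> y; exact: cvg_cst.
  by rewrite /gam leNgt sneg.
have [N _ HN] := cvgr_lt _ us _ sneg; exists N => // n /HN un /=.
by rewrite /gam leNgt un.
Qed.

(** A jump of g at 0 is felt at the single point y = s, a null set; one convolution therefore
    restores continuity everywhere. *)
Lemma scont_conv f g M s : (forall s, 0 <= f s) -> measurable_fun setT f ->
  mu.-integrable setT (EFin \o f) -> (forall s, 0 <= g s) ->
  measurable_fun setT g -> (forall s, g s <= M) ->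
  (forall t, t != 0 -> scont g t) -> scont (convol f g) s.
Proof.
move=> f0 mf fi g0 mg gM gc u us.
have H : (\int[mu]_y (f y * g (u n - y))%:E @[n --> \oo] -->
    \int[mu]_y (f y * g (s - y))%:E)%E.
  apply: (@dominated_cvg_off _ s (fun n y => f y * g (u n - y))
    (fun y => f y * g (s - y)) (fun y => M * f y)).
  - by move=> n; apply: measurable_funM => //; exact: measurable_reflect.
  - by apply: measurable_funM => //; exact: measurable_reflect.
  - move=> y ys; apply: cvgM; first exact: cvg_cst.
    apply: gc; first by rewrite subr_eq0 eq_sym.
    by apply: cvgB => //; exact: cvg_cst.
  - by have := integrableZl measurableT M fi; apply: eq_integrable.
  - by move=> n y; rewrite ger0_norm ?mulr_ge0// mulrC ler_wpM2r.
have iE t : (\int[mu]_y (f y * g (t - y))%:E = (convol f g t)%:E)%E.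
  by rewrite (convE f0 mf fi g0 mg gM).
move: H; rewrite iE; under eq_fun do rewrite iE.
by move=> /fine_cvgP[].
Qed.

Lemma eq_ft f (P Q : R -> R[i]) : P =1 Q -> ft f P -> ft f Q.
Proof. by move=> PQ [? ? ? ? h]; split => // x; rewrite -PQ. Qed.

Lemma ft_gam m (a : R) : 0 < a -> ft (gam m a) (fun x => (a -i* x) ^- m.+1).
Proof.
move=> a0; elim: m => [|m ih].
  by apply: (eq_ft _ (ft_gam0 a0)) => x; rewrite expr1.
rewrite -convol_gam; apply: (eq_ft _ (ft_conv ih (ft_gam0 a0))) => x.
by rewrite [in RHS]exprSr invfM mulrC.
Qed.

Lemma integral_gam m (a : R) : 0 < a -> \int[mu]_s gam m a s = a ^- m.+1.
Proof.
move=> a0; have := ftE (ft_gam m a0) 0.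
move=> /(congr1 (@complex.Re R)) /=.
have -> : a -i* 0 = a%:C by apply/eqP; rewrite eq_complex /= oppr0 !eqxx.
rewrite -rmorphXn -fmorphV /= => ->.
by apply: eq_Rintegral => s _; rewrite mul0r cos0 mul1r.
Qed.

(** The integrand of Gamma is m! times the density [gam m 1], whose mass is the value of its
    characteristic function at 0. *)
Lemma Gamma_nat m : Gamma m.+1%:R = m`!%:R :> R.
Proof.
have := integral_gam m (@ltr01 R); rewrite expr1n invr1 => H.
have fm : m`!%:R != 0 :> R by rewrite pnatr_eq0 -lt0n fact_gt0.
transitivity (m`!%:R * \int[mu]_s gam m 1 s); last by rewrite H mulr1.
rewrite -RintegralZl//; last exact: ft_int (ft_gam m ltr01).
rewrite /Gamma /Rintegral integral_itv_obnd_cbnd; last first.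
  apply/measurable_EFinP; apply: measurable_funM; last exact: measurableT_comp.
  by apply: measurable_funTS; exact: measurable_powR.
congr fine; rewrite [LHS]integral_mkcond; apply: eq_integral => t _.
rewrite patchE mem_setE in_itv /= andbT /gam; case: ifP => t0; last by rewrite mulr0.
congr EFin; rewrite -natr1 addrK powR_mulrn// mulN1r.
by rewrite mulrCA [_ * (_ / _)]mulrC divfK// mulrC.
Qed.

(* Index 1 rather than 0 is split off, so that the variables integrated out are
   those of index > 0, as in [lauricellaD]. *)
Fixpoint kconv (n : nat) : ('I_n.+1 -> nat) -> ('I_n.+1 -> R) -> R -> R :=
  match n return ('I_n.+1 -> nat) -> ('I_n.+1 -> R) -> R -> R with
  | 0%N => fun m a => gam (m ord0) (a ord0)
  | p.+1 => fun m a =>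
      let i1 : 'I_p.+2 := lift ord0 ord0 in
      convol (gam (m i1) (a i1)) (kconv (fun j => m (lift i1 j)) (fun j => a (lift i1 j)))
  end.

Lemma ft_kconv n m (a : 'I_n.+1 -> R) : (forall j, 0 < a j) ->
  ft (kconv m a) (fun x => \prod_j (a j -i* x) ^- (m j).+1).
Proof.
elim: n m a => [|n ih] m a a0.
  by apply: (eq_ft _ (ft_gam _ (a0 _))) => x; rewrite big_ord1.
apply: (eq_ft _ (ft_conv (ft_gam _ (a0 _)) (ih _ _ _))) => // x.
by rewrite (bigD1_ord (lift ord0 ord0)).
Qed.

Lemma scont_kconv n m (a : 'I_n.+1 -> R) s : (forall j, 0 < a j) ->
  (s != 0) || (0 < n)%N -> scont (kconv m a) s.
Proof.
elim: n m a s => [|n ih] m a s a0; first by rewrite orbF => s0; exact: scont_gam.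
move=> _; set i1 : 'I_n.+2 := lift ord0 ord0.
have hf := ft_gam (m i1) (a0 i1).
have hk := @ft_kconv n (fun j => m (lift i1 j)) (fun j => a (lift i1 j)) (fun j => a0 _).
have [M kM] := ft_bnd hk.
apply: (@scont_conv _ _ M _ (ft_ge0 hf) (ft_meas hf) (ft_int hf) (ft_ge0 hk) (ft_meas hk) kM).
by move=> t t0; apply: ih => //; rewrite t0.
Qed.

(** Each factor has squared modulus O(1 / (1 + x^2)), so the n + 1 >= 2 factors give the square of
    the required bound. *)
Lemma prod_resolvent_le n m (a : 'I_n.+1 -> R) : (0 < n)%N -> (forall j, 0 < a j) ->
  exists c, forall x, cabs (\prod_j (a j -i* x) ^- (m j).+1) <= c / (1 + x ^+ 2).
Proof.
move=> n0 a0.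
pose q := \prod_j Num.min 1 (a j ^+ 2).
(* Chosen so that r_j (1 + x^2) <= a_j^2 + x^2. *)
pose r j := Num.min 1 (a j ^+ 2).
have r0 j : 0 < r j by rewrite lt_min ltr01 exprn_gt0.
have r1 j : r j <= 1 by rewrite ge_min lexx.
have rp j x : r j * (1 + x ^+ 2) <= cabs (a j -i* x) ^+ 2.
  rewrite cabs_sqr /= sqrrN mulrDr mulr1 lerD//; first by rewrite ge_min lexx orbT.
  by rewrite ler_piMl// sqr_ge0.
have key j x : cabs ((a j -i* x) ^- (m j).+1) ^+ 2 <= (r j ^- (m j).+1) * (1 + x ^+ 2)^-1.
  have c1 : 0 < cabs (a j -i* x).
    by rewrite (lt_le_trans _ (Re_le_cabs _))//= gtr0_norm.
  have c0 : 0 < cabs (a j -i* x) ^+ 2.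
    by rewrite (lt_le_trans _ (rp j x))// mulr_gt0// onesqr_gt0.
  have -> : cabs ((a j -i* x) ^- (m j).+1) ^+ 2 = ((cabs (a j -i* x) ^+ 2) ^+ (m j).+1)^-1.
    have -> : cabs ((a j -i* x) ^- (m j).+1) = (cabs ((a j -i* x) ^+ (m j).+1))^-1.
      exact: Normc.normcV.
    by rewrite cabsX exprVn -!exprM mulnC.
  rewrite -invfM lef_pV2 ?posrE ?mulr_gt0 ?exprn_gt0 ?onesqr_gt0//.
  apply: (@le_trans _ _ ((r j * (1 + x ^+ 2)) ^+ (m j).+1)).
    rewrite exprMn ler_pM2l ?exprn_gt0//.
    by rewrite ler_eXnr// lerDl sqr_ge0.
  by rewrite lerXn2r ?nnegrE ?(ltW c0) ?mulr_ge0 ?(ltW (r0 _)) ?(ltW (onesqr_gt0 _))//.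
pose C := \prod_j (r j ^- (m j).+1).
have C0 : 0 <= C by apply: prodr_ge0 => j _; rewrite invr_ge0 exprn_ge0// ltW.
exists (Num.sqrt C) => x; have x0 := onesqr_gt0 x.
have cabs_prod : cabs (\prod_j (a j -i* x) ^- (m j).+1) =
    \prod_j cabs ((a j -i* x) ^- (m j).+1).
  by elim/big_ind2 : _ => [|u v w z <- <-|//]; [exact: cabs1|exact: cabsM].
rewrite -(@ler_pXn2r _ 2)// ?nnegrE ?cabs_ge0 ?divr_ge0 ?sqrtr_ge0 ?(ltW x0)//.
rewrite expr_div_n sqr_sqrtr// cabs_prod -prodrXl.
apply: (@le_trans _ _ (\prod_j (r j ^- (m j).+1 * (1 + x ^+ 2)^-1))).
  by apply: ler_prod => j _; rewrite sqr_ge0 key.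
rewrite big_split /= prodr_const card_ord ler_wpM2l//.
(* Two of the n + 1 factors (1 + x^2)^-1 are kept, the others are at most 1. *)
case: n n0 {m a a0 q r r0 r1 rp key C C0 cabs_prod} => // n _.
rewrite -exprVn -(addn2 n) exprD ler_piMl ?sqr_ge0// exprn_ile1 ?invr_ge0 ?(ltW x0)//.
by rewrite invf_le1// lerDl sqr_ge0.
Qed.

Theorem Gfun_kconv n (alpha : 'I_n.+1 -> nat) (a : 'I_n.+1 -> R) : (0 < n)%N ->
  (forall j, (0 < alpha j)%N) -> (forall j, 0 < a j) ->
  Gfun alpha a = (kconv (fun j => (alpha j).-1) a 1)%:C.
Proof.
move=> n0 al0 a0; pose m j := (alpha j).-1.
have hk := ft_kconv m a0.
have sc : scont (kconv m a) 1 by apply: scont_kconv => //; rewrite oner_eq0.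
have [c Pc] := prod_resolvent_le m n0 a0.
rewrite /Gfun.
have := ft_inversion hk sc Pc.
have -> : (fun x => (cos x -i* sin x) * \prod_j (a j -i* x) ^- (m j).+1) =
    (fun x => (cos x -i* sin x) * \prod_(j < n.+1) (a j -i* x) ^- (alpha j)).
  apply/funext => x; congr (_ * _); apply: eq_bigr => j _.
  by rewrite /m prednK.
move=> ->; rewrite -rmorphM /=; congr (_%:C).
by rewrite mulrA mulVf ?mul1r// mulf_neq0// gt_eqF// pi_gt0.
Qed.

End GammaConvolutions.

(** * Integrals over the simplex *)

Section IteratedIntegral.
Variable R : realType.
Let mu := @lebesgue_measure R.
Local Open Scope ereal_scope.

Lemma cons_vec0 n (x : R) (u : 'I_n -> R) : cons_vec x u ord0 = x.
Proof. by rewrite /cons_vec unlift_none. Qed.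

Lemma cons_vec_lift n (x : R) (u : 'I_n -> R) j : cons_vec x u (lift ord0 j) = u j.
Proof. by rewrite /cons_vec liftK. Qed.

(* There is no measurable structure on ['I_n -> R]; a function of a parameter and
   of a vector is tested against all vectors of measurable functions. *)
Definition vmeas d (T : measurableType d) n (f : T -> ('I_n -> R) -> \bar R) : Prop :=
  forall d' (S : measurableType d') (p : S -> T) (v : S -> 'I_n -> R),
    measurable_fun setT p -> (forall j, measurable_fun setT (fun s => v s j)) ->
    measurable_fun setT (fun s => f (p s) (v s)).

Lemma vmeas_cons d (T : measurableType d) n (f : T -> ('I_n.+1 -> R) -> \bar R) :
  vmeas f -> vmeas (fun (q : T * R) u => f q.1 (cons_vec q.2 u)).
Proof.
move=> mf d' S p v mp mv; apply: (mf d' S (fst \o p)).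
  exact: measurableT_comp.
move=> i; rewrite /cons_vec; case: (unliftP ord0 i) => [j _|_] /=; first exact: mv.
exact: (measurableT_comp measurable_snd mp).
Qed.

Lemma vmeas_cons_at d (T : measurableType d) n (f : T -> ('I_n.+1 -> R) -> \bar R) t :
  vmeas f -> vmeas (fun (x : R) u => f t (cons_vec x u)).
Proof.
move=> mf d' S p v mp mv.
apply: (vmeas_cons mf (p := fun s => (t, p s))) => //.
exact: measurable_fun_pair.
Qed.

Lemma iterated_ge0 n (f : ('I_n -> R) -> \bar R) : (forall u, 0 <= f u) ->
  0 <= iterated_integral f.
Proof.
elim: n f => [|n ih] f f0 /=; first exact: f0.
by apply: integral_ge0 => x _; apply: ih.
Qed.

Lemma eq_iterated n (f g : ('I_n -> R) -> \bar R) : f =1 g ->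
  iterated_integral f = iterated_integral g.
Proof. by move=> fg; congr iterated_integral; exact/funext. Qed.

(** In the induction the first coordinate of the vector joins the parameter, whose type grows from T
    to T * R; hence the quantification over T. *)
Lemma measurable_iterated d (T : measurableType d) n (f : T -> ('I_n -> R) -> \bar R) :
  vmeas f -> (forall t u, 0 <= f t u) ->
  measurable_fun setT (fun t => iterated_integral (f t)).
Proof.
elim: n d T f => [|n ih] d T f mf f0 /=; first by apply: (mf _ T idfun (fun _ _ => 0%R)); [exact: measurable_id|move=> j; exact: measurable_cst].
pose F (q : T * R) := iterated_integral (fun u => f q.1 (cons_vec q.2 u)).
have mF : measurable_fun setT F by apply: (ih _ _ (fun (q : T * R) u => f q.1 (cons_vec q.2 u))) => //; exact: (vmeas_cons mf).
have F0 q : 0 <= F q by apply: iterated_ge0 => u; exact: f0.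
exact: (measurable_fun_fubini_tonelli_F (m2 := mu) F mF F0).
Qed.

Lemma measurable_iterated_cons d (T : measurableType d) n
    (f : T -> ('I_n.+1 -> R) -> \bar R) t : vmeas f -> (forall t u, 0 <= f t u) ->
  measurable_fun setT (fun x : R => iterated_integral (fun u => f t (cons_vec x u))).
Proof. by move=> mf f0; apply: (measurable_iterated (vmeas_cons_at t mf)). Qed.

Lemma le_iterated d (T : measurableType d) n (f g : T -> ('I_n -> R) -> \bar R) t :
  vmeas f -> vmeas g -> (forall t u, 0 <= f t u) -> (forall t u, f t u <= g t u) ->
  iterated_integral (f t) <= iterated_integral (g t).
Proof.
elim: n d T f g t => [|n ih] d T f g t mf mg f0 fg /=; first exact: fg.
have g0 t' u : 0 <= g t' u by exact: le_trans (f0 _ _) (fg _ _).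
apply: ge0_le_integral => //.
- by move=> x _; apply: iterated_ge0 => u.
- exact: measurable_iterated_cons.
- exact: measurable_iterated_cons.
- move=> x _; apply: (ih _ _ (fun (x : R) u => f t (cons_vec x u))
    (fun (x : R) u => g t (cons_vec x u))) => //; exact: vmeas_cons_at.
Qed.

Lemma iteratedZ d (T : measurableType d) n (f : T -> ('I_n -> R) -> \bar R) t (k : R) :
  (0 <= k)%R -> vmeas f -> (forall t u, 0 <= f t u) ->
  iterated_integral (fun u => k%:E * f t u) = k%:E * iterated_integral (f t).
Proof.
move=> k0; elim: n d T f t => [|n ih] d T f t mf f0 //=.
rewrite -ge0_integralZl//; last 2 first.
- exact: measurable_iterated_cons.
- by move=> x _; apply: iterated_ge0 => u.
apply: eq_integral => x _.
by apply: (ih _ _ (fun (x : R) u => f t (cons_vec x u))) => //; exact: vmeas_cons_at.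
Qed.

Lemma iteratedD d (T : measurableType d) n (f g : T -> ('I_n -> R) -> \bar R) t :
  vmeas f -> vmeas g -> (forall t u, 0 <= f t u) -> (forall t u, 0 <= g t u) ->
  iterated_integral (fun u => f t u + g t u) =
  iterated_integral (f t) + iterated_integral (g t).
Proof.
elim: n d T f g t => [|n ih] d T f g t mf mg f0 g0 //=.
rewrite -ge0_integralD//.
- apply: eq_integral => x _.
  by apply: (ih _ _ (fun (x : R) u => f t (cons_vec x u))
    (fun (x : R) u => g t (cons_vec x u))) => //; exact: vmeas_cons_at.
- by move=> x _; apply: iterated_ge0 => u.
- exact: measurable_iterated_cons.
- by move=> x _; apply: iterated_ge0 => u.
- exact: measurable_iterated_cons.
Qed.

Lemma iterated_tonelli n (f : R -> ('I_n -> R) -> \bar R) :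
  vmeas f -> (forall t u, 0 <= f t u) ->
  \int[mu]_r iterated_integral (f r) = iterated_integral (fun u => \int[mu]_r f r u).
Proof.
elim: n f => [|n ih] f mf f0 //=.
pose F (q : R * R) := iterated_integral (fun u => f q.1 (cons_vec q.2 u)).
have mF : measurable_fun setT F by apply: (measurable_iterated (vmeas_cons mf)).
have F0 q : 0 <= F q by apply: iterated_ge0 => u; exact: f0.
transitivity (\int[mu]_x \int[mu]_r F (r, x)).
  exact: (fubini_tonelli (m1 := mu) (m2 := mu) F mF F0).
apply: eq_integral => x _.
rewrite /F /= ih// => d' S p v mp mv.
apply: (vmeas_cons mf (p := fun s => (p s, x))) => //.
exact: measurable_fun_pair.
Qed.

Lemma vmeasEFin d (T : measurableType d) n (h : T -> ('I_n -> R) -> R) :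
  (forall d' (S : measurableType d') (p : S -> T) (v : S -> 'I_n -> R),
    measurable_fun setT p -> (forall j, measurable_fun setT (fun s => v s j)) ->
    measurable_fun setT (fun s => h (p s) (v s))) ->
  vmeas (fun t u => (h t u)%:E).
Proof. by move=> mh d' S p v mp mv; apply/measurable_EFinP; exact: mh. Qed.

(** The integrand of the (n+1)-fold convolution at s: the u_j are n of the summands and s - sum u_j
    is the remaining one, of index 0. It vanishes off the simplex of size s. *)
Definition simplex_kernel n (m : 'I_n.+1 -> nat) (a : 'I_n.+1 -> R) (s : R) (u : 'I_n -> R) : R :=
  (gam (m ord0) (a ord0) (s - \sum_j u j) *
   \prod_j gam (m (lift ord0 j)) (a (lift ord0 j)) (u j))%R.

Lemma simplex_kernel_ge0 n m (a : 'I_n.+1 -> R) s u : (0 <= simplex_kernel m a s u)%R.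
Proof. by rewrite mulr_ge0 ?gam_ge0// prodr_ge0// => j _; exact: gam_ge0. Qed.

Lemma vmeas_simplex_kernel n m (a : 'I_n.+1 -> R) :
  vmeas (fun s u => (simplex_kernel m a s u)%:E).
Proof.
apply: vmeasEFin => d' S p v mp mv; apply: measurable_funM.
  apply: (measurableT_comp (@measurable_gam R _ _)); apply: measurable_funB => //.
  exact: measurable_sum.
by apply: measurable_prod => j _; exact: (measurableT_comp (@measurable_gam R _ _)).
Qed.

Lemma kconv_iterated n m (a : 'I_n.+1 -> R) s : (forall j, 0 < a j)%R ->
  (kconv m a s)%:E = iterated_integral (fun u => (simplex_kernel m a s u)%:E).
Proof.
elim: n m a s => [|n ih] m a s a0 /=.
  by rewrite /simplex_kernel !big_ord0 subr0 mulr1.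
set i1 : 'I_n.+2 := lift ord0 ord0.
pose m' j := m (lift i1 j); pose a' j := a (lift i1 j).
have hf := ft_gam (m i1) (a0 i1).
have hk := @ft_kconv R n m' a' (fun j => a0 _).
have [M kM] := ft_bnd hk.
rewrite (convE (ft_ge0 hf) (ft_meas hf) (ft_int hf) (ft_ge0 hk) (ft_meas hk) kM).
apply: eq_integral => x _.
rewrite EFinM (ih m' a' _ (fun j => a0 _)).
rewrite -(iteratedZ (T := R) (f := fun s u => (simplex_kernel m' a' s u)%:E))//.
- apply: eq_iterated => u; rewrite -EFinM; congr EFin.
  rewrite /simplex_kernel big_ord_recl [in RHS]big_ord_recl !cons_vec0.
  (* Deleting index 1 leaves index 0 in place and shifts the others, so the recursion of [kconv]
     matches that of [iterated_integral]. *)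
  have e0 : lift i1 ord0 = ord0 by exact/val_inj.
  have ej j : lift i1 (lift ord0 j) = lift ord0 (lift ord0 j) by exact/val_inj.
  rewrite /m' /a' e0 mulrCA; congr (_ * _)%R.
    congr gam; rewrite -addrA -opprD; congr (s - (x + _))%R.
    by apply: eq_bigr => j _; rewrite cons_vec_lift.
  congr (_ * _)%R; apply: eq_bigr => j _.
  by rewrite ej cons_vec_lift.
- exact: gam_ge0.
- exact: vmeas_simplex_kernel.
- by move=> t u; rewrite lee_fin simplex_kernel_ge0.
Qed.

End IteratedIntegral.

(** * Lipschitz bounds for powers and exponentials *)

Section PowerLipschitz.
Variable R : realType.

Lemma ln_le_sub1 (x : R) : 0 < x -> ln x <= x - 1.
Proof. by move=> x0; rewrite lerBrDl -{2}(lnK x0) expR_ge1Dx. Qed.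

(** For x <= y the ratio of the powers is e^(q l) with l = ln (y / x) <= (y - x) / delta. Factoring
    out the larger of the two powers, which the sign of q decides, leaves 1 - e^(-t) <= t with t =
    |q| l. *)
Lemma powR_lipschitz (q delta M x y : R) : 0 < delta -> delta <= x -> delta <= y ->
  x `^ q <= M -> y `^ q <= M -> `|x `^ q - y `^ q| <= M * `|q| / delta * `|x - y|.
Proof.
move=> d0; wlog xy : x y / x <= y => [H|] dx dy xM yM.
  by have [xy|/ltW yx] := leP x y; [|rewrite distrC (distrC x)]; exact: H.
have x0 : 0 < x by exact: lt_le_trans dx.
have y0 : 0 < y by exact: lt_le_trans dy.
have M0 : 0 <= M by rewrite (le_trans _ xM)// powR_ge0.
have key t (z : R) : 0 <= z -> z <= M -> `|z - z * expR (- t)| <= M * `|1 - expR (- t)|.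
  by move=> z0 zM; rewrite -{1}(mulr1 z) -mulrBr normrM ger0_norm// ler_wpM2r.
pose l := ln (y / x).
have l0 : 0 <= l by rewrite ln_ge0// ler_pdivlMr// mul1r.
have ll : l <= (y - x) / delta.
  apply: (@le_trans _ _ (y / x - 1)); first by rewrite ln_le_sub1// divr_gt0.
  have -> : y / x - 1 = (y - x) / x by rewrite mulrBl divff// gt_eqF.
  apply: ler_wpM2l; first by rewrite subr_ge0.
  by rewrite lef_pV2.
have yxl : y = x * expR l by rewrite lnK ?posrE ?divr_gt0// mulrC divfK// gt_eqF.
clearbody l.
have pw : y `^ q = x `^ q * expR (q * l).
  by rewrite yxl (powRM _ (ltW x0) (expR_ge0 _)) -expRM (mulrC l).
have e1 (t : R) : 0 <= t -> `|1 - expR (- t)| <= t.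
  move=> t0; rewrite ger0_norm; last first.
    by rewrite subr_ge0 -expR0 ler_expR oppr_le0.
  by rewrite lerBlDr -lerBlDl expR_ge1Dx.
have fin (t : R) : 0 <= t -> t = `|q| * l -> M * t <= M * `|q| / delta * `|x - y|.
  move=> _ ->; have -> : `|x - y| = y - x by rewrite distrC ger0_norm ?subr_ge0.
  have -> : M * `|q| / delta * (y - x) = M * (`|q| * ((y - x) / delta)) by ring.
  by rewrite ler_wpM2l// ler_wpM2l.
have [q0|q0] := leP 0 q.
  have -> : x `^ q = y `^ q * expR (- (q * l)) by rewrite pw -mulrA -expRD subrr expR0 mulr1.
  have ql : 0 <= q * l by exact: mulr_ge0.
  rewrite distrC (le_trans (key _ _ (powR_ge0 _ _) yM))//.
  rewrite (le_trans (ler_wpM2l M0 (e1 _ ql)))//; apply: fin => //.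
  by rewrite ger0_norm.
rewrite pw -(opprK (q * l)).
have ql : 0 <= - (q * l) by rewrite -mulNr mulr_ge0// oppr_ge0 ltW.
rewrite (le_trans (key _ _ (powR_ge0 _ _) xM))//.
rewrite (le_trans (ler_wpM2l M0 (e1 _ ql)))//; apply: fin => //.
by rewrite ltr0_norm// mulNr.
Qed.

Lemma expR_lipschitz (x y : R) : 0 <= x -> 0 <= y ->
  `|expR (- x) - expR (- y)| <= `|x - y|.
Proof.
wlog xy : x y / x <= y => [H|] x0 y0.
  by have [xy|/ltW yx] := leP x y; [|rewrite distrC (distrC x)]; exact: H.
rewrite distrC ler0_norm ?subr_le0 ?ler_expR ?lerN2// opprB.
rewrite distrC ger0_norm ?subr_ge0//.
have -> : expR (- x) - expR (- y) = expR (- x) * (1 - expR (- (y - x))).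
  by rewrite mulrBr mulr1 -expRD; congr (_ - expR _); ring.
have h1 : 0 <= 1 - expR (- (y - x)).
  by rewrite subr_ge0 -expR0 ler_expR oppr_le0 subr_ge0.
apply: (@le_trans _ _ (1 - expR (- (y - x)))).
  by rewrite ler_piMl// -expR0 ler_expR oppr_le0.
by rewrite lerBlDr -lerBlDl expR_ge1Dx.
Qed.

End PowerLipschitz.

(** * Integration against the Dirichlet weight *)

Section SimplexFunctional.
Variables (R : realType) (n : nat) (m : 'I_n.+1 -> nat).
Implicit Types (u : 'I_n -> R) (h : ('I_n -> R) -> R) (a : 'I_n.+1 -> R).

(* The density of the Dirichlet law of parameters [m j + 1], up to a constant. *)
Definition weight u : R := simplex_kernel m (fun=> 0) 1 u.

Definition linform a u : R := a ord0 * (1 - \sum_j u j) + \sum_j a (lift ord0 j) * u j.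

Lemma weight_ge0 u : 0 <= weight u.
Proof. exact: simplex_kernel_ge0. Qed.

Lemma weight_supp u : weight u != 0 -> simplex u.
Proof.
rewrite /weight /simplex_kernel mulf_eq0 negb_or => /andP[+ /prodf_neq0 h].
rewrite /gam; case: ifP => [s0 _|_]; last by rewrite eqxx.
split; last by rewrite -subr_ge0.
by move=> j; have := h j isT; rewrite /gam; case: ifP => // _; rewrite eqxx.
Qed.

Lemma weightE u : simplex u -> weight u =
  (1 - \sum_j u j) ^+ m ord0 / (m ord0)`!%:R *
  \prod_j (u j ^+ m (lift ord0 j) / (m (lift ord0 j))`!%:R).
Proof.
move=> [u0 u1]; rewrite /weight /simplex_kernel /gam subr_ge0 u1.
rewrite oppr0 mul0r expR0 mul1r; congr (_ * _); apply: eq_bigr => j _.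
by rewrite u0 mul0r expR0 mul1r.
Qed.

(** Each density is e^(-b s) times the truncated power, so all dependence on a gathers in one
    exponential. *)
Lemma simplex_kernel_weight a u : simplex_kernel m a 1 u = weight u * expR (- linform a u).
Proof.
have gE k b s : gam k b s = gam k 0 s * expR (- (b * s)).
  rewrite /gam; case: ifP => _; last by rewrite mul0r.
  by rewrite oppr0 mul0r expR0 mul1r mulrC mulNr.
rewrite /weight /simplex_kernel gE.
under eq_bigr do rewrite gE.
rewrite big_split /= mulrACA; congr (_ * _).
rewrite /linform opprD expRD; congr (_ * _).
by rewrite -sumrN expR_sum.
Qed.

Definition vm h : Prop := forall d' (S : measurableType d') (v : S -> 'I_n -> R),
  (forall j, measurable_fun setT (fun s => v s j)) -> measurable_fun setT (fun s => h (v s)).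

(** Admissible integrands: nonnegative and bounded by K on the simplex, nothing being asked outside,
    where the weight vanishes. This makes [wint] finite, although [fine] would hide an infinite
    integral. *)
Definition adm (K : R) h : Prop :=
  vm h /\ forall u, simplex u -> 0 <= h u <= K.

Definition wint h : R := fine (iterated_integral (fun u => (weight u * h u)%:E)).

Lemma vm_weight : vm weight.
Proof.
move=> d' S v mv; apply/measurable_EFinP.
have H := @vmeas_simplex_kernel R n m (fun=> 0).
exact: (H _ S (fun=> 1) v (measurable_cst _) mv).
Qed.

Lemma vmeas_weight h d (T : measurableType d) : vm h ->
  vmeas (fun (_ : T) u => (weight u * h u)%:E).
Proof.
move=> mh; apply: vmeasEFin => d' S p v mp mv.
by apply: measurable_funM; [exact: vm_weight|exact: mh].
Qed.

Lemma weight_mul_ge0 h K u : adm K h -> 0 <= weight u * h u.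
Proof.
move=> [_ hK]; have [->|/weight_supp/hK/andP[h0 _]] := eqVneq (weight u) 0.
  by rewrite mul0r.
by rewrite mulr_ge0// weight_ge0.
Qed.

Lemma vm_cst c : vm (fun=> c).
Proof. by move=> d' S v mv; exact: measurable_cst. Qed.

Lemma vm_linform a : vm (linform a).
Proof.
move=> d' S v mv; apply: measurable_funD.
  by apply: measurable_funM => //; apply: measurable_funB => //; exact: measurable_sum.
by apply: measurable_sum => j; exact: measurable_funM.
Qed.

Lemma linform_cst c u : linform (fun=> c) u = c.
Proof. by rewrite /linform -mulr_sumr -mulrDr subrK mulr1. Qed.

(** When all a_j are 1 the linear form is constantly 1, so the weight is e times a simplex kernel,
    whose integral is a value of [kconv]. *)
Lemma iterated_weight_lty :
  (iterated_integral (fun u => (weight u * 1)%:E) < +oo)%E.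
Proof.
have := kconv_iterated m 1 (fun j : 'I_n.+1 => @ltr01 R) => H.
have -> : iterated_integral (fun u => (weight u * 1)%:E) =
    ((expR 1)%:E * iterated_integral (fun u => (simplex_kernel m (fun=> 1%R) 1 u)%:E))%E.
  rewrite -(iteratedZ (T := R) (f := fun s u => (simplex_kernel m (fun=> 1) s u)%:E)) ?expR_ge0//.
  - apply: eq_iterated => u; rewrite -EFinM; congr EFin.
    by rewrite simplex_kernel_weight linform_cst mulrCA -expRD subrr expR0.
  - exact: vmeas_simplex_kernel.
  - by move=> t u; rewrite lee_fin simplex_kernel_ge0.
by rewrite -H -EFinM ltry.
Qed.

Lemma simplex0 : simplex (fun _ : 'I_n => 0 : R).
Proof. by split => //; rewrite big1. Qed.

Lemma adm_bound_ge0 h K : adm K h -> 0 <= K.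
Proof. by case=> _ /(_ _ simplex0)/andP[h0 hK]; exact: le_trans hK. Qed.

Lemma adm_cst c : 0 <= c -> adm c (fun=> c).
Proof. by move=> c0; split => [|u _]; [exact: vm_cst|rewrite c0 lexx]. Qed.

Lemma adm_expR a : (forall j, 0 <= a j) -> adm 1 (fun u => expR (- linform a u)).
Proof.
move=> a0; split.
  move=> d' S v mv; apply: (measurableT_comp (@measurable_expR R)).
  by apply: measurable_funN; exact: vm_linform.
move=> u [u0 u1]; rewrite expR_ge0 -expR0 ler_expR oppr_le0 addr_ge0//.
  by rewrite mulr_ge0// subr_ge0.
by apply: sumr_ge0 => j _; rewrite mulr_ge0.
Qed.

Lemma le_iterated_weight h h' K K' : adm K h -> adm K' h' ->
  (forall u, simplex u -> h u <= h' u) ->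
  (iterated_integral (fun u => (weight u * h u)%:E) <=
   iterated_integral (fun u => (weight u * h' u)%:E))%E.
Proof.
move=> hK hK' hh'; have [mh _] := hK; have [mh' _] := hK'.
apply: (le_iterated (T := R) (f := fun _ u => (weight u * h u)%:E)
  (g := fun _ u => (weight u * h' u)%:E) 0).
- exact: vmeas_weight.
- exact: vmeas_weight.
- by move=> _ u; rewrite lee_fin; exact: weight_mul_ge0 hK.
- move=> _ u; rewrite lee_fin.
  have [->|/weight_supp su] := eqVneq (weight u) 0; first by rewrite !mul0r.
  by rewrite ler_wpM2l ?weight_ge0// hh'.
Qed.

Lemma iterated_weightZ h K c : 0 <= c -> adm K h ->
  (iterated_integral (fun u => (weight u * (c * h u))%:E) =
   c%:E * iterated_integral (fun u => (weight u * h u)%:E))%E.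
Proof.
move=> c0 hK; have [mh _] := hK.
rewrite -(iteratedZ (T := R) (f := fun _ u => (weight u * h u)%:E) 0 c0).
- by apply: eq_iterated => u; rewrite -EFinM mulrCA.
- exact: vmeas_weight.
- by move=> _ u; rewrite lee_fin; exact: weight_mul_ge0 hK.
Qed.

Lemma wint_fin h K : adm K h ->
  (wint h)%:E = iterated_integral (fun u => (weight u * h u)%:E).
Proof.
move=> hK; have K0 := adm_bound_ge0 hK.
rewrite fineK// ge0_fin_numE; last first.
  by apply: iterated_ge0 => u; rewrite lee_fin; exact: weight_mul_ge0 hK.
apply: (@le_lt_trans _ _ (K%:E * iterated_integral (fun u => (weight u * 1)%:E))%E).
  rewrite -(iterated_weightZ K0 (adm_cst ler01)).
  apply: (le_iterated_weight hK (K' := K)).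
    by split => [|u _]; [exact: vm_cst|rewrite mulr1 K0 lexx].
  by move=> u su; rewrite mulr1; case: hK => _ /(_ _ su)/andP[].
have := iterated_weight_lty.
have : (0 <= iterated_integral (fun u => (weight u * 1)%:E))%E.
  by apply: iterated_ge0 => u; rewrite lee_fin mulr1 weight_ge0.
by case: (iterated_integral _) => // r _ _; rewrite -EFinM ltry.
Qed.

Definition wbar : R := wint (fun=> 1).

Lemma wint_ge0 h K : adm K h -> 0 <= wint h.
Proof.
move=> hK; apply: fine_ge0; apply: iterated_ge0 => u.
by rewrite lee_fin; exact: weight_mul_ge0 hK.
Qed.

Lemma wbar_ge0 : 0 <= wbar. Proof. exact: wint_ge0 (adm_cst ler01). Qed.

Lemma le_wint h h' K K' : adm K h -> adm K' h' ->
  (forall u, simplex u -> h u <= h' u) -> wint h <= wint h'.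
Proof.
move=> hK hK' hh'; rewrite -lee_fin (wint_fin hK) (wint_fin hK').
exact: le_iterated_weight hK hK' hh'.
Qed.

Lemma eq_wint h h' : (forall u, simplex u -> h u = h' u) -> wint h = wint h'.
Proof.
move=> hh'; congr fine; apply: eq_iterated => u.
have [->|/weight_supp su] := eqVneq (weight u) 0; first by rewrite !mul0r.
by rewrite hh'.
Qed.

Lemma wintZ h K c : 0 <= c -> adm K h -> wint (fun u => c * h u) = c * wint h.
Proof.
move=> c0 hK; apply: EFin_inj; rewrite EFinM (wint_fin hK) -(iterated_weightZ c0 hK).
have [mh hb] := hK; rewrite (@wint_fin _ (c * K))//; split.
  by move=> d' S v mv; apply: measurable_funM => //; exact: mh.
by move=> u /hb/andP[h0 hk]; rewrite mulr_ge0//= ler_wpM2l.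
Qed.

(** An estimate of h - h' written as h <= h' + e, so that only integrals of nonnegative functions
    occur; used in both directions it gives [wint_lipschitz]. *)
Lemma wint_le_shift h h' K K' e : adm K h -> adm K' h' -> 0 <= e ->
  (forall u, simplex u -> h u <= h' u + e) -> wint h <= wint h' + e * wbar.
Proof.
move=> hK hK' e0 hh'; have [mh hb] := hK; have [mh' hb'] := hK'.
rewrite -lee_fin EFinD EFinM (wint_fin hK) (wint_fin hK') /wbar (wint_fin (adm_cst ler01)).
rewrite -(iterated_weightZ e0 (adm_cst ler01)).
rewrite -(iteratedD (T := R) (f := fun _ u => (weight u * h' u)%:E)
  (g := fun _ u => (weight u * (e * 1))%:E) 0).
- rewrite (@eq_iterated _ _ (fun u => (weight u * h' u)%:E + (weight u * (e * 1))%:E)%E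
    (fun u => (weight u * (h' u + e))%:E)); last first.
    by move=> u; rewrite mulr1 mulrDr EFinD.
  apply: (le_iterated_weight hK (K' := K' + e)) => //; split.
    by move=> d' S v mv; apply: measurable_funD => //; exact: mh'.
  by move=> u /hb'/andP[h0 hk]; rewrite addr_ge0//= lerD2r.
- exact: vmeas_weight.
- by apply: vmeas_weight; exact: vm_cst.
- by move=> _ u; rewrite lee_fin; exact: weight_mul_ge0 hK'.
- by move=> _ u; rewrite lee_fin mulr_ge0 ?weight_ge0// mulr1.
Qed.

Lemma wint_lipschitz h h' K K' e : adm K h -> adm K' h' -> 0 <= e ->
  (forall u, simplex u -> `|h u - h' u| <= e) -> `|wint h - wint h'| <= e * wbar.
Proof.
move=> hK hK' e0 hh'.
have h1 : wint h' <= wint h + e * wbar.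
  by apply: (wint_le_shift hK' hK e0) => u /hh'; rewrite ler_norml => /andP[]; lra.
have h2 : wint h <= wint h' + e * wbar.
  by apply: (wint_le_shift hK hK' e0) => u /hh'; rewrite ler_norml => /andP[]; lra.
by rewrite ler_norml; apply/andP; split; lra.
Qed.

Lemma kconv_wint a : (forall j, 0 < a j) ->
  kconv m a 1 = wint (fun u => expR (- linform a u)).
Proof.
move=> a0; apply: EFin_inj; rewrite (kconv_iterated m 1 a0).
rewrite (wint_fin (adm_expR (fun j => ltW (a0 j)))).
by apply: eq_iterated => u; rewrite simplex_kernel_weight.
Qed.

End SimplexFunctional.

(** * Estimates on the simplex and the Lauricella integral *)

Section SimplexEstimates.
Variables (R : realType) (n : nat) (m : 'I_n.+1 -> nat).
Implicit Types (u : 'I_n -> R) (a : 'I_n.+1 -> R) (x : 'I_n -> R).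
Local Notation wbar := (@wbar R n m).
Local Notation wint := (@wint R n m).

Lemma simplex_le1 u j : simplex u -> u j <= 1.
Proof.
move=> [u0 u1]; apply: le_trans u1; rewrite (bigD1 j)//= lerDl.
exact: sumr_ge0.
Qed.

Lemma linform_lipschitz a b u : simplex u ->
  `|linform a u - linform b u| <= \sum_j `|a j - b j|.
Proof.
move=> su; have [u0 u1] := su.
have -> : linform a u - linform b u = (a ord0 - b ord0) * (1 - \sum_j u j) +
    \sum_j (a (lift ord0 j) - b (lift ord0 j)) * u j.
  rewrite /linform mulrBl opprD addrACA; congr (_ + _).
  by rewrite -sumrB; apply: eq_bigr => j _; rewrite mulrBl.
rewrite big_ord_recl (le_trans (ler_normD _ _))// lerD//.
  rewrite normrM ler_piMr// ger0_norm ?subr_ge0// lerBlDr lerDl.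
  exact: sumr_ge0.
rewrite (le_trans (ler_norm_sum _ _ _))//; apply: ler_sum => j _.
by rewrite normrM ler_piMr// ger0_norm// simplex_le1.
Qed.

Lemma linform_ge (lo : R) a u : simplex u -> (forall j, lo <= a j) -> lo <= linform a u.
Proof.
move=> [u0 u1] la; rewrite -{1}(linform_cst lo u) /linform lerD//.
  by rewrite ler_wpM2r// subr_ge0.
by apply: ler_sum => j _; rewrite ler_wpM2r.
Qed.

Lemma kconv_lipschitz a b : (forall j, 0 < a j) -> (forall j, 0 < b j) ->
  `|kconv m a 1 - kconv m b 1| <= wbar * \sum_j `|a j - b j|.
Proof.
move=> a0 b0; rewrite !kconv_wint// mulrC.
apply: wint_lipschitz.
- by apply: adm_expR => j; exact: ltW.
- by apply: adm_expR => j; exact: ltW.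
- exact: sumr_ge0.
move=> u su; apply: (le_trans _ (linform_lipschitz a b su)).
by apply: expR_lipschitz; apply: linform_ge => // j; exact: ltW.
Qed.

(** The linear form is an average of the a_j, hence at least lo. The resulting decay, after scaling
    by r, provides the integrable majorant of the radial integrand. *)
Lemma kconv_le (lo : R) a : 0 < lo -> (forall j, lo <= a j) ->
  0 <= kconv m a 1 <= wbar * expR (- lo).
Proof.
move=> lo0 la; have a0 j : 0 < a j by exact: lt_le_trans (la j).
have hA := adm_expR (fun j => ltW (a0 j)).
rewrite kconv_wint// (wint_ge0 m hA) /= mulrC.
rewrite -(wintZ m (expR_ge0 _) (adm_cst n (@ler01 R))).
apply: (le_wint m hA (K' := expR (- lo))).
  by split => [|u _]; [exact: vm_cst|rewrite mulr1 expR_ge0 lexx].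
by move=> u su; rewrite mulr1 ler_expR lerN2 linform_ge.
Qed.

Section Lauricella.
Variables (p hi : R) (p0 : 0 < p) (hi1 : hi < 1).

(** A lower bound of 1 - sum x_j u_j over the simplex when all x_j <= hi: it is 1 - hi if hi >= 0,
    and 1 otherwise, as u = 0 is allowed. *)
Let delta := Num.min 1 (1 - hi).

Let delta0 : 0 < delta. Proof. by rewrite lt_min ltr01 subr_gt0. Qed.

Lemma lauricella_base_ge x u : (forall j, x j <= hi) -> simplex u ->
  delta <= 1 - \sum_j x j * u j.
Proof.
move=> xhi [u0 u1]; pose h := Num.max 0 hi.
have h0 : 0 <= h by rewrite le_max lexx.
have : \sum_j x j * u j <= h.
  apply: (@le_trans _ _ (\sum_j h * u j)).
    by apply: ler_sum => j _; rewrite ler_wpM2r// (le_trans (xhi j))// le_max lexx orbT.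
  by rewrite -mulr_sumr ler_piMr.
have : delta <= 1 - h.
  by rewrite /delta /h; case: (leP 0 hi) => ?; rewrite ge_min ?subr0 ?lexx ?orbT.
by lra.
Qed.

Lemma powRN_le (y : R) : delta <= y -> y `^ (- p) <= delta `^ (- p).
Proof.
move=> dy; rewrite !powRN lef_pV2 ?posrE ?powR_gt0 ?(lt_le_trans delta0)//.
by rewrite ge0_ler_powR ?nnegrE ?(ltW p0) ?(ltW delta0)// (le_trans (ltW delta0)).
Qed.

Lemma adm_lauricella x : (forall j, x j <= hi) ->
  adm (delta `^ (- p)) (fun u => (1 - \sum_j x j * u j) `^ (- p)).
Proof.
move=> xhi; split.
  move=> d' S v mv; apply: (measurableT_comp (@measurable_powR R (- p))).
  apply: measurable_funB => //; apply: measurable_sum => j.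
  exact: measurable_funM.
by move=> u su; rewrite powR_ge0 powRN_le// lauricella_base_ge.
Qed.

Lemma wint_lauricella_lipschitz : exists2 C, 0 <= C & forall x y,
  (forall j, x j <= hi) -> (forall j, y j <= hi) ->
  `|wint (fun u => (1 - \sum_j x j * u j) `^ (- p)) -
    wint (fun u => (1 - \sum_j y j * u j) `^ (- p))| <= C * \sum_j `|x j - y j|.
Proof.
pose C := delta `^ (- p) * `|- p| / delta.
have C0 : 0 <= C by rewrite divr_ge0 ?mulr_ge0 ?powR_ge0 ?(ltW delta0).
exists (C * wbar); first by rewrite mulr_ge0// wbar_ge0.
move=> x y xhi yhi; rewrite mulrAC.
apply: wint_lipschitz; [exact: adm_lauricella|exact: adm_lauricella| |].
  by rewrite mulr_ge0// sumr_ge0.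
move=> u su; have bx := lauricella_base_ge xhi su; have by_ := lauricella_base_ge yhi su.
rewrite (le_trans (powR_lipschitz delta0 bx by_ (powRN_le bx) (powRN_le by_)))//.
rewrite ler_wpM2l// opprB addrC addrA subrK -sumrB.
rewrite (le_trans (ler_norm_sum _ _ _))//; apply: ler_sum => j _.
rewrite -mulrBl normrM distrC; have [u0 _] := su.
by rewrite ler_piMr// ger0_norm// simplex_le1.
Qed.

Lemma wint_linform a : (forall j, 0 < a j) ->
  (forall j, 1 - a (lift ord0 j) / a ord0 <= hi) ->
  a ord0 `^ p * wint (fun u => linform a u `^ (- p)) =
  wint (fun u => (1 - \sum_j (1 - a (lift ord0 j) / a ord0) * u j) `^ (- p)).
Proof.
move=> a0 ahi; pose z j := 1 - a (lift ord0 j) / a ord0.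
have h := adm_lauricella ahi.
have -> : wint (fun u => linform a u `^ (- p)) =
    wint (fun u => a ord0 `^ (- p) * (1 - \sum_j z j * u j) `^ (- p)).
  apply: eq_wint => u su; rewrite -powRM ?(ltW (a0 _))//.
    congr (_ `^ _); rewrite /linform /z.
    have -> : \sum_j (1 - a (lift ord0 j) / a ord0) * u j =
        \sum_j u j - (a ord0)^-1 * \sum_j a (lift ord0 j) * u j.
      rewrite mulr_sumr -sumrB; apply: eq_bigr => j _; ring.
    by field; rewrite gt_eqF.
  by rewrite (le_trans (ltW delta0))// lauricella_base_ge.
rewrite (wintZ m (powR_ge0 _ _) h) mulrA powRN mulfV ?mul1r//.
by rewrite gt_eqF// powR_gt0.
Qed.

End Lauricella.

(** The exponent c - sum alpha_j is alpha_0, and Gamma at positive integers gives exactly the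
    factorials already contained in the weight, so that only Gamma c survives of the prefactor. *)
Lemma lauricellaD_wint (alpha : 'I_n.+1 -> nat) (p hi : R) x : 0 < p -> hi < 1 ->
  (forall j, x j <= hi) -> (forall j, (0 < alpha j)%N) -> (forall j, m j = (alpha j).-1) ->
  lauricellaD p (fun j : 'I_n => (alpha (lift ord0 j))%:R) (\sum_j alpha j)%N%:R x =
  Gamma (\sum_j alpha j)%N%:R * wint (fun u => (1 - \sum_j x j * u j) `^ (- p)).
Proof.
move=> p0 hi1 xhi al0 mE.
have aE j : alpha j = (m j).+1 by rewrite mE prednK.
rewrite /lauricellaD.
have cE : (\sum_j alpha j)%N%:R - \sum_(j < n) (alpha (lift ord0 j))%:R = (alpha ord0)%:R :> R.
  by rewrite natr_sum big_ord_recl addrK.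
rewrite cE.
pose F := \prod_j (m j)`!%:R : R.
have F0 : F != 0.
  by apply/prodf_neq0 => j _; rewrite pnatr_eq0 -lt0n fact_gt0.
have Fge : 0 <= F by apply: prodr_ge0.
have -> : (\prod_(j < n) Gamma (alpha (lift ord0 j))%:R) * Gamma (alpha ord0)%:R = F :> R.
  rewrite /F big_ord_recl mulrC aE Gamma_nat; congr (_ * _).
  by apply: eq_bigr => j _; rewrite aE Gamma_nat.
rewrite -mulrA; congr (_ * _).
rewrite (_ : fine _ = F * wint (fun u => (1 - \sum_j x j * u j) `^ (- p))); first by rewrite mulKf.
have h := adm_lauricella p0 hi1 xhi.
rewrite -(wintZ m Fge h); congr fine; apply: eq_iterated => u; congr EFin.
have [su|nsu] := pselect (simplex u); last first.
  rewrite indicE memNset// mul0r.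
  have [->|/weight_supp//] := eqVneq (weight m u) 0; first by rewrite mul0r.
rewrite indicE mem_set// mul1r mulrA; congr (_ * _).
rewrite weightE// /F big_ord_recl.
have [u0 u1] := su.
have pE k (y : R) : 0 <= y -> y `^ ((alpha k)%:R - 1) = y ^+ (m k).
  by move=> y0; rewrite aE -natr1 addrK powR_mulrn.
rewrite pE ?subr_ge0//.
have -> : \prod_(j < n) u j `^ ((alpha (lift ord0 j))%:R - 1) =
    \prod_(j < n) u j ^+ m (lift ord0 j) by apply: eq_bigr => j _; exact: pE.
rewrite [in RHS]big_split /= prodfV.
have f0 k : (k`!%:R : R) != 0 by rewrite pnatr_eq0 -lt0n fact_gt0.
field; rewrite f0 /=.
by rewrite andbT; apply/prodf_neq0 => j _; exact: f0.
Qed.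

End SimplexEstimates.

(** * The radial integral *)

Section GammaIntegral.
Variables (R : realType) (d : R).
Hypothesis hd : -1 < d.
Let mu := @lebesgue_measure R.

Definition gamma_density (X r : R) : R := if 0 < r then r `^ d * expR (- (X * r)) else 0.

Lemma gamma_density_ge0 X r : 0 <= gamma_density X r.
Proof. by rewrite /gamma_density; case: ifP => // _; rewrite mulr_ge0 ?powR_ge0 ?expR_ge0. Qed.

Lemma measurable_halfline_oo (g : R -> R) : measurable_fun setT g ->
  measurable_fun setT (fun r : R => if 0 < r then g r else 0).
Proof. by move=> mg; apply: measurable_fun_ifT => //; exact: measurable_fun_ltr. Qed.

Lemma measurable_gamma_density X : measurable_fun setT (gamma_density X).
Proof.
apply: measurable_halfline_oo; apply: measurable_funM; first exact: measurable_powR.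
apply: (measurableT_comp (@measurable_expR R)); apply: measurable_funN.
exact: measurable_funM.
Qed.

Lemma bigcup_itv_oo : \bigcup_n `[(n.+2%:R^-1 : R), n.+2%:R]%classic = `]0, +oo[%classic.
Proof.
apply/seteqP; split => r /=.
  move=> [n _] /=; rewrite !in_itv /= andbT => /andP[h _].
  by rewrite (lt_le_trans _ h)// invr_gt0.
rewrite in_itv /= andbT => r0.
have [n1 _ H1] := near_infty_natSinv_lt (PosNum r0).
have [n2 hn2] : exists n, r <= n%:R.
  by exists (Num.trunc r).+1; rewrite ltW// -[ltLHS]/(r) truncnS_gt.
pose n := maxn n1 n2; exists n => //=; rewrite in_itv /=; apply/andP; split.
  apply: (@le_trans _ _ (n1.+1%:R^-1)); last by apply: ltW; exact: (H1 n1 (leqnn _)).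
  by rewrite lef_pV2 ?posrE// ler_nat ltnS leqW// leq_maxl.
by rewrite (le_trans hn2)// ler_nat (leq_trans (leq_maxr n1 n2))// leqW.
Qed.

(** The fundamental theorem is applied on compact intervals away from the possible singularity at 0;
    d > -1 makes the bound uniform. Only finiteness is needed later, so an inequality suffices. *)
Lemma integral_powR01_le : (\int[mu]_(r in `]0%R, 1%R]) (r `^ d)%:E <= ((d + 1)^-1)%:E)%E.
Proof.
have p0 : 0 < d + 1 by rewrite -ltrBlDr sub0r.
(* The offset 2 keeps the left end strictly below 1. *)
pose F (n : nat) := `[(n.+2%:R^-1 : R), 1]%classic.
have FU : \bigcup_n F n = `]0, 1]%classic.
  apply/seteqP; split => r /=.
    move=> [n _]; rewrite /F /= !in_itv /= => /andP[h h1]; rewrite h1 andbT.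
    by rewrite (lt_le_trans _ h)// invr_gt0.
  rewrite in_itv /= => /andP[r0 r1].
  have [n1 _ H1] := near_infty_natSinv_lt (PosNum r0).
  exists n1 => //; rewrite /F /= in_itv /= r1 andbT.
  apply: (@le_trans _ _ (n1.+1%:R^-1)); last by apply: ltW; exact: (H1 n1 (leqnn _)).
  by rewrite lef_pV2 ?posrE// ler_nat.
have mp : measurable_fun setT (fun r : R => (r `^ d)%:E).
  by apply/measurable_EFinP; exact: measurable_powR.
have H : (\int[mu]_(r in F n) (r `^ d)%:E @[n --> \oo] -->
    \int[mu]_(r in `]0%R, 1%R]) (r `^ d)%:E)%E.
  rewrite -FU; apply: ge0_nondecreasing_set_cvg_integral => //.
  - move=> n k nk; apply/subsetPset => r; rewrite /F /= !in_itv /= => /andP[h h1].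
    by rewrite h1 andbT (le_trans _ h)// lef_pV2 ?posrE// ler_nat.
  - by move=> n; exact: measurable_itv.
  - by move=> n; exact: measurable_funTS.
  - by move=> n r _; rewrite lee_fin powR_ge0.
rewrite -(cvg_lim _ H)//; apply: lime_le; first by apply/cvg_ex; eexists; exact: H.
apply: nearW => n.
have n1 : (n.+2%:R^-1 : R) < 1 by rewrite invf_lt1// ltr1n.
have n0 : (0 : R) < n.+2%:R^-1 by rewrite invr_gt0.
have dG (x : R) : 0 < x -> is_derive x (1 : R) (fun y : R => y `^ (d + 1) / (d + 1)) (x `^ d).
  move=> x0; have := is_derive1_powR (d + 1) x0; rewrite addrK => dx.
  apply: is_derive_eq; rewrite /GRing.scale /=; field; exact: lt0r_neq0.
have cG (x : R) : 0 < x -> {for x, continuous (fun y : R => y `^ (d + 1) / (d + 1))}.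
  move=> x0; apply: differentiable_continuous; apply/derivable1_diffP.
  by have [] := dG x x0.
rewrite (@continuous_FTC2 _ _ (fun y => y `^ (d + 1) / (d + 1)))//.
- rewrite -EFinB lee_fin powR1 div1r lerBlDr lerDl.
  by rewrite divr_ge0 ?powR_ge0// ltW.
- apply: continuous_in_subspaceT => x; rewrite inE /= in_itv /= => /andP[nx _].
  have x0 : 0 < x by exact: lt_le_trans nx.
  apply: differentiable_continuous; apply/derivable1_diffP.
  by have := is_derive1_powR d x0; case.
- split.
  + by move=> x; rewrite in_itv /= => /andP[nx _]; have [] := dG x (lt_trans n0 nx).
  + by apply: cvg_at_right_filter; exact: cG.
  + by apply: cvg_at_left_filter; apply: cG.
- move=> x; rewrite in_itv /= => /andP[nx _].
  by rewrite derive1E; have [_] := dG x (lt_trans n0 nx).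
Qed.

(** The majorant is r^d on ]0, 1] and r^N e^(-r), a multiple of [gam N 1], beyond 1, for an integer
    N >= d. *)
Lemma gamma_density_lty : (\int[mu]_r (gamma_density 1 r)%:E < +oo)%E.
Proof.
pose N := (Num.trunc `|d|).+1.
have dN : d <= N%:R.
  by rewrite (le_trans (ler_norm d))// ltW// truncnS_gt.
pose h1 (r : R) : R := if 0 < r <= 1 then r `^ d else 0.
pose h2 (r : R) : R := N`!%:R * gam N 1 r.
have mh1 : measurable_fun setT h1.
  apply: measurable_fun_ifT; [|exact: (@measurable_powR R d)|exact: measurable_cst].
  by apply: (measurable_and (f := fun r : R => 0 < r) (g := fun r : R => r <= 1));
    [exact: measurable_fun_ltr|exact: measurable_fun_ler].
have mh2 : measurable_fun setT h2.
  by apply: measurable_funM => //; exact: measurable_gam.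
have h10 r : 0 <= h1 r by rewrite /h1; case: ifP => // _; exact: powR_ge0.
have h20 r : 0 <= h2 r by rewrite mulr_ge0// gam_ge0.
have fN : (N`!%:R : R) != 0 by rewrite pnatr_eq0 -lt0n fact_gt0.
apply: (@le_lt_trans _ _ (\int[mu]_r ((h1 r)%:E + (h2 r)%:E))%E).
  apply: ge0_le_integral => //.
  - by move=> r _; rewrite lee_fin gamma_density_ge0.
  - by apply/measurable_EFinP; exact: measurable_gamma_density.
  - by apply: emeasurable_funD; exact/measurable_EFinP.
  - move=> r _; rewrite -EFinD lee_fin /gamma_density; case: ifP => r0; last by rewrite addr_ge0.
    rewrite mul1r; have [r1|r1] := leP r 1.
      apply: (@le_trans _ _ (h1 r)); last by rewrite lerDl.
      rewrite /h1 r0 r1 /= ler_piMr ?powR_ge0// -expR0 ler_expR oppr_le0 ltW//.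
    apply: (@le_trans _ _ (h2 r)); last by rewrite lerDr.
    have -> : h2 r = r ^+ N * expR (- r).
      by rewrite /h2 /gam (ltW r0) mulN1r; field.
    rewrite ler_wpM2r ?expR_ge0// -powR_mulrn ?(ltW r0)//.
    by apply: ler_powR => //; exact: ltW.
rewrite ge0_integralD//; last 4 first.
- by move=> r _; rewrite lee_fin.
- exact/measurable_EFinP.
- by move=> r _; rewrite lee_fin.
- exact/measurable_EFinP.
apply: lte_add_pinfty.
  have -> : (\int[mu]_r (h1 r)%:E = \int[mu]_(r in `]0%R, 1%R]) (r `^ d)%:E)%E.
    rewrite [RHS]integral_mkcond; apply: eq_integral => r _.
    by rewrite patchE mem_setE in_itv /= /h1; case: ifP.
  by apply: le_lt_trans integral_powR01_le _; rewrite ltry.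
have := integrableZl measurableT N`!%:R (ft_int (ft_gam N (@ltr01 R))).
by move=> /integrableP[_]; apply: le_lt_trans; apply: ge0_le_integral => //;
  [by move=> r _; rewrite lee_fin|exact/measurable_EFinP| |
   by move=> r _ /=; rewrite lee_fin ler_norm];
  apply: measurableT_comp => //; exact/measurable_EFinP.
Qed.

Lemma integral_gamma_density1 :
  (\int[mu]_r (gamma_density 1 r)%:E = (Gamma (d + 1))%:E)%E.
Proof.
rewrite /Gamma /Rintegral addrK.
have -> : (\int[mu]_(t in `]0%R, +oo[) (t `^ d * expR (- t))%:E =
    \int[mu]_r (gamma_density 1 r)%:E)%E.
  rewrite [LHS]integral_mkcond; apply: eq_integral => r _.
  by rewrite patchE mem_setE in_itv /= andbT /gamma_density mul1r; case: ifP.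
rewrite fineK// ge0_fin_numE ?gamma_density_lty//.
by apply: integral_ge0 => r _; rewrite lee_fin gamma_density_ge0.
Qed.

Lemma integral_gamma_density X : 0 < X ->
  (\int[mu]_r (gamma_density X r)%:E = (Gamma (d + 1) * X `^ (- (d + 1)))%:E)%E.
Proof.
move=> X0; have X0' : X != 0 by rewrite gt_eqF.
have mg : measurable_fun setT (fun r => (gamma_density 1 r)%:E).
  by apply/measurable_EFinP; exact: measurable_gamma_density.
have g0 r : (0 <= (gamma_density 1 r)%:E)%E by rewrite lee_fin gamma_density_ge0.
have := ge0_integral_affine 0 X0' mg g0; rewrite integral_gamma_density1 gtr0_norm// => H.
transitivity (\int[mu]_r ((X `^ (- d))%:E * (gamma_density 1 (X * r + 0))%:E))%E.
  apply: eq_integral => r _; rewrite -EFinM; congr EFin.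
  rewrite /gamma_density addr0 pmulr_rgt0// mul1r; case: ifP => r0; last by rewrite mulr0.
  rewrite powRM ?(ltW X0) ?(ltW r0)// !mulrA powRN mulVf ?mul1r//.
  by rewrite gt_eqF// powR_gt0.
rewrite ge0_integralZl//; last 2 first.
- by apply: (measurableT_comp mg); exact: measurable_affine.
- by rewrite lee_fin powR_ge0.
rewrite H -!EFinM; congr EFin; rewrite mulrCA mulrA mulrC; congr (_ * _).
rewrite -powR_inv1 ?(ltW X0)// -powRD; last by rewrite X0' implybT.
by congr (_ `^ _); ring.
Qed.

Lemma integrable_gamma_density X : 0 < X -> mu.-integrable setT (EFin \o gamma_density X).
Proof.
move=> X0; apply/integrableP; split.
  by apply/measurable_EFinP; exact: measurable_gamma_density.
under eq_integral do rewrite /= ger0_norm ?gamma_density_ge0//.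
by rewrite integral_gamma_density// ltry.
Qed.

End GammaIntegral.

(** * Riemann sums of Lipschitz functions *)

Section RiemannSums.
Variable R : realType.
Let mu := @lebesgue_measure R.
Implicit Types f g : R -> R.

Lemma integrable_itv f (i : interval R) : mu.-integrable setT (EFin \o f) ->
  mu.-integrable [set` i] (EFin \o f).
Proof. by move=> fi; apply: integrableS fi => //; exact: measurable_itv. Qed.

Lemma integrable_indic_cst (c a b : R) :
  mu.-integrable setT (EFin \o (fun r : R => c * \1_(`[a, b]%classic) r)).
Proof.
have := integrableZl measurableT c (integrable_indic_itv a b true false).
by apply: eq_integrable.
Qed.

Lemma Rintegral_cst_itv (c a b : R) : a <= b ->
  \int[mu]_(r in `[a, b]) (fun=> c) r = c * (b - a).
Proof.
move=> ab; have mI : measurable ([set` `[a, b]] : set (measurableTypeR R)).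
  exact: measurable_itv.
rewrite (Rintegral_cst _ mI); suff muI : mu `[a, b]%classic = (b - a)%:E.
  by congr (_ * _); exact: (congr1 fine muI).
rewrite /mu lebesgue_measure_itv /= lte_fin; case: (ltP a b) => [_|ba]; first by rewrite EFinB.
have -> : a = b by apply/eqP; rewrite eq_le ab.
by rewrite subrr.
Qed.

Lemma Rintegral_close f g a b (c : R) : mu.-integrable setT (EFin \o f) ->
  mu.-integrable setT (EFin \o g) -> a <= b ->
  (forall r, a <= r <= b -> `|f r - g r| <= c) ->
  `|\int[mu]_(r in `[a, b]) f r - \int[mu]_(r in `[a, b]) g r| <= c * (b - a).
Proof.
move=> fi gi ab fg; have mI : measurable ([set` `[a, b]] : set (measurableTypeR R)) by exact: measurable_itv.
have fi' := integrable_itv `[a, b] fi; have gi' := integrable_itv `[a, b] gi.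
have di : mu.-integrable `[a, b] (EFin \o (fun r => f r - g r)).
  apply: (@integrable_itv (fun r => f r - g r)).
  by have := integrableB measurableT fi gi; apply: eq_integrable.
rewrite -RintegralB// (le_trans (le_normr_Rintegral mI di))//.
have ci : mu.-integrable `[a, b] (EFin \o (fun=> c)).
  apply: eq_integrable (integrable_itv `[a, b] (integrable_indic_cst c a b)) => // r.
  by rewrite inE /= => rI; rewrite indicE mem_set// mulr1.
apply: (@le_trans _ _ (\int[mu]_(r in `[a, b]) c)).
  by apply: le_Rintegral => //; exact: integrable_norm.
by rewrite Rintegral_cst_itv.
Qed.

Lemma Rintegral_itv_split f a b c : mu.-integrable setT (EFin \o f) -> a <= b -> b <= c ->
  \int[mu]_(r in `[a, c]) f r = \int[mu]_(r in `[a, b]) f r + \int[mu]_(r in `[b, c]) f r.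
Proof.
move=> fi ab bc.
rewrite -[X in _ + X]Rintegral_itv_obnd_cbnd; last exact: (integrable_itv `]b, c]).
rewrite -(@Rintegral_itvB _ f (BLeft a) (BRight c) b); last 3 first.
- exact: (integrable_itv `[a, c]).
- by rewrite bnd_simp.
- by rewrite bnd_simp.
by rewrite addrC subrK.
Qed.

Lemma partition_mono (p : nat -> R) N : (forall i, (i < N)%N -> p i <= p i.+1) ->
  forall i j, (i <= j)%N -> (j <= N)%N -> p i <= p j.
Proof.
move=> hp i; elim=> [|j ih]; first by rewrite leqn0 => /eqP ->.
rewrite leq_eqVlt => /orP[/eqP ->//|ij jN].
exact: le_trans (ih ij (ltnW jN)) (hp j jN).
Qed.

(** On each cell f differs from its value at the tag by at most L delta; the errors add up by
    induction on the number of cells. *)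
Lemma riemann_sum_close f (a b L delta : R) : mu.-integrable setT (EFin \o f) -> 0 <= L ->
  (forall r s, a <= r <= b -> a <= s <= b -> `|f r - f s| <= L * `|r - s|) ->
  forall N (p t : nat -> R), p 0%N = a -> p N = b ->
  (forall i, (i < N)%N -> [/\ p i <= t i, t i <= p i.+1 & p i.+1 - p i < delta]) ->
  `|\sum_(i < N) (p i.+1 - p i) * f (t i) - \int[mu]_(r in `[a, b]) f r|
    <= L * delta * (b - a).
Proof.
move=> fi L0 fL N p t pa pb hp.
have pm := partition_mono (fun i iN => let: And3 h h' _ := hp i iN in le_trans h h').
suff H k : (k <= N)%N ->
    `|\sum_(i < k) (p i.+1 - p i) * f (t i) - \int[mu]_(r in `[a, p k]) f r|
    <= L * delta * (p k - a).
  by rewrite -pb; exact: H.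
elim: k => [|k ih] kN.
  by rewrite big_ord0 pa set_itv1 Rintegral_set1 subrr normr0 subrr mulr0.
have apk : a <= p k by rewrite -pa; apply: pm => //; exact: ltnW.
have [h1 h2 h3] := hp k kN; have pk : p k <= p k.+1 by exact: le_trans h2.
have pkb : p k.+1 <= b by rewrite -pb; exact: pm.
rewrite big_ord_recr /= (Rintegral_itv_split fi apk pk) opprD addrACA.
rewrite (le_trans (ler_normD _ _))//.
have -> : L * delta * (p k.+1 - a) = L * delta * (p k - a) + L * delta * (p k.+1 - p k) by ring.
rewrite lerD ?ih ?(ltnW kN)//.
(* The constant is cut off outside the cell, because [Rintegral_close] asks for integrability on the
   whole line. *)
pose g (r : R) : R := f (t k) * \1_(`[p k, p k.+1]%classic) r.
have gi : mu.-integrable setT (EFin \o g) by exact: integrable_indic_cst.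
have -> : (p k.+1 - p k) * f (t k) = \int[mu]_(r in `[p k, p k.+1]) g r.
  transitivity (\int[mu]_(r in `[p k, p k.+1]) f (t k)).
    by rewrite (Rintegral_cst_itv (f (t k)) pk) mulrC.
  by apply: eq_Rintegral => r rI; rewrite /g indicE rI mulr1.
apply: Rintegral_close => // r rk; have /andP[r1 r2] := rk.
have rI : r \in `[p k, p k.+1]%classic by rewrite mem_setE in_itv.
rewrite /g indicE rI mulr1 (le_trans (fL _ _ _ _))//.
- by rewrite (le_trans apk h1) (le_trans h2).
- by rewrite (le_trans apk r1) (le_trans r2).
- rewrite ler_wpM2l// ltW// (le_lt_trans _ h3)// ler_norml; apply/andP; split; lra.
Qed.

End RiemannSums.

(** * The scalar radial integrand *)

Section Radial.
Variables (R : realType) (n : nat) (m : 'I_n.+1 -> nat) (d : R).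
Hypothesis hd : -1 < d.
Let mu := @lebesgue_measure R.
Implicit Types (u : 'I_n -> R) (a : 'I_n.+1 -> R).
Local Notation wbar := (@wbar R n m).
Local Notation wint := (@wint R n m).

Definition radial a (r : R) : R :=
  if 0 < r then r `^ d * kconv m (fun j => r * a j) 1 else 0.

Lemma vmeas_radial a :
  vmeas (fun r u => (weight m u * gamma_density d (linform a u) r)%:E).
Proof.
apply: vmeasEFin => d' S p v mp mv.
apply: measurable_funM; first exact: vm_weight.
rewrite /gamma_density; apply: measurable_fun_ifT; last exact: measurable_cst.
  exact: measurable_fun_ltr.
apply: measurable_funM; first exact: (measurableT_comp (@measurable_powR R d)).
apply: (measurableT_comp (@measurable_expR R)); apply: measurable_funN.
by apply: measurable_funM => //; exact: vm_linform.
Qed.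

Lemma iterated0 k : iterated_integral (fun _ : 'I_k -> R => 0%E) = 0%E.
Proof.
elim: k => [|k ih] //=; apply: integral0_eq => x _; exact: ih.
Qed.

(** Homogeneity of the linear form moves the factor r into the exponent; in this form the integral
    over r can be exchanged with those over u. *)
Lemma radial_iterated a r : (forall j, 0 < a j) -> (radial a r)%:E =
  iterated_integral (fun u => (weight m u * gamma_density d (linform a u) r)%:E).
Proof.
move=> a0; rewrite /radial /gamma_density; case: ifP => r0; last first.
  by rewrite -[LHS](iterated0 n); apply: eq_iterated => u; rewrite mulr0.
have ra0 j : 0 < r * a j by rewrite mulr_gt0.
rewrite kconv_wint// EFinM (wint_fin m (adm_expR (fun j => ltW (ra0 j)))).
rewrite -(iterated_weightZ m (powR_ge0 _ _) (adm_expR (fun j => ltW (ra0 j)))).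
apply: eq_iterated => u; congr (_ * (_ * expR (- _)))%:E.
rewrite /linform [RHS]mulrC [in RHS]mulrDr mulr_sumr mulrA; congr (_ + _).
by apply: eq_bigr => j _; rewrite mulrA.
Qed.

Lemma radial_ge0 a r : (forall j, 0 < a j) -> 0 <= radial a r.
Proof.
move=> a0; rewrite -lee_fin (radial_iterated r a0); apply: iterated_ge0 => u.
by rewrite lee_fin mulr_ge0 ?weight_ge0 ?gamma_density_ge0.
Qed.

Lemma measurable_radial a : (forall j, 0 < a j) -> measurable_fun setT (radial a).
Proof.
move=> a0; apply/measurable_EFinP.
have := measurable_iterated (vmeas_radial a).
have h t u : (0 <= (weight m u * gamma_density d (linform a u) t)%:E)%E.
  by rewrite lee_fin mulr_ge0 ?weight_ge0 ?gamma_density_ge0.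
move=> /(_ h); apply: eq_measurable_fun => r _.
by rewrite /= radial_iterated.
Qed.

Lemma radial_le (lo : R) a r : 0 < lo -> (forall j, lo <= a j) ->
  radial a r <= wbar * gamma_density d lo r.
Proof.
move=> lo0 la; rewrite /radial /gamma_density; case: ifP => r0; last by rewrite mulr0.
rewrite mulrCA ler_wpM2l ?powR_ge0// [lo * r]mulrC.
have /andP[] := @kconv_le R n m (r * lo) (fun j => r * a j) (mulr_gt0 r0 lo0)
  (fun j => ler_wpM2l (ltW r0) (la j)).
by [].
Qed.

Section Box.
Variables (lo : R) (lo0 : 0 < lo).

Let pos a : (forall j, lo <= a j) -> forall j, 0 < a j.
Proof. by move=> la j; exact: lt_le_trans (la j). Qed.

Lemma integrable_radial a : (forall j, lo <= a j) -> mu.-integrable setT (EFin \o radial a).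
Proof.
move=> la; have gi := integrableZl measurableT wbar (integrable_gamma_density hd lo0).
apply: le_integrable gi => //; first by apply/measurable_EFinP; apply: measurable_radial; exact: pos.
move=> r _ /=; rewrite lee_fin ger0_norm ?radial_ge0//; last exact: pos.
by rewrite (le_trans (radial_le r lo0 la))// ler_norm.
Qed.

Lemma adm_linform a : (forall j, lo <= a j) ->
  adm (lo `^ (- (d + 1))) (fun u => linform a u `^ (- (d + 1))).
Proof.
move=> la; split.
  by move=> d' S v mv; apply: (measurableT_comp (@measurable_powR R _)); exact: vm_linform.
move=> u su; have h := linform_ge su la.
have p0 : 0 <= d + 1 by rewrite -lerBlDr sub0r ltW.
rewrite powR_ge0 /= !powRN lef_pV2 ?posrE ?powR_gt0//; last exact: lt_le_trans h.
by rewrite ge0_ler_powR ?nnegrE ?(ltW lo0)// (le_trans (ltW lo0)).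
Qed.

Lemma Gamma_ge0 (s : R) : 0 <= Gamma s.
Proof. by apply: Rintegral_ge0 => t _; rewrite mulr_ge0 ?powR_ge0 ?expR_ge0. Qed.

Lemma integral_radial a : (forall j, lo <= a j) ->
  \int[mu]_r radial a r = Gamma (d + 1) * wint (fun u => linform a u `^ (- (d + 1))).
Proof.
move=> la; apply: EFin_inj; rewrite EFinM (wint_fin m (adm_linform la)).
rewrite -(iterated_weightZ m (Gamma_ge0 _) (adm_linform la)).
rewrite (EFin_Rintegral (integrable_radial la)).
transitivity (\int[mu]_r iterated_integral
    (fun u => (weight m u * gamma_density d (linform a u) r)%:E))%E.
  by apply: eq_integral => r _; rewrite radial_iterated//; exact: pos.
rewrite (iterated_tonelli (vmeas_radial a)); last first.
  by move=> t u; rewrite lee_fin mulr_ge0 ?weight_ge0 ?gamma_density_ge0.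
apply: eq_iterated => u.
under eq_integral do rewrite EFinM.
rewrite ge0_integralZl//; last 3 first.
- by apply/measurable_EFinP; exact: measurable_gamma_density.
- by move=> r _; rewrite lee_fin gamma_density_ge0.
- by rewrite lee_fin weight_ge0.
have [->|/weight_supp su] := eqVneq (weight m u) 0; first by rewrite mul0e mul0r.
have X0 : 0 < linform a u by rewrite (lt_le_trans lo0)// linform_ge.
by rewrite (integral_gamma_density hd X0) -EFinM.
Qed.

(** The majorant minus the integrand is nonnegative, so its integral over [s, t] is at most its full
    integral; rearranged, this bounds the tail by one independent of a. *)
Lemma radial_tail a (s t : R) : (forall j, lo <= a j) ->
  `|\int[mu]_(r in `[s, t]) radial a r - \int[mu]_r radial a r| <=
  wbar * (\int[mu]_r gamma_density d lo r - \int[mu]_(r in `[s, t]) gamma_density d lo r).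
Proof.
move=> la; pose H := gamma_density d lo.
have Hi : mu.-integrable setT (EFin \o H) by exact: integrable_gamma_density.
have qi := integrable_radial la.
have sub (f : R -> R) : (forall r, 0 <= f r) -> mu.-integrable setT (EFin \o f) ->
    \int[mu]_(r in `[s, t]) f r <= \int[mu]_r f r.
  move=> f0 fi; rewrite /Rintegral fine_le//.
  - by apply: integrable_fin_num => //; exact: integrable_itv.
  - exact: integrable_fin_num.
  - apply: ge0_subset_integral => //; first by case/integrableP: fi.
    by move=> r _; rewrite lee_fin.
have wHi : mu.-integrable setT (EFin \o (fun r => wbar * H r)).
  by have := integrableZl measurableT wbar Hi; apply: eq_integrable.
have ki : mu.-integrable setT (EFin \o (fun r => wbar * H r - radial a r)).
  by have := integrableB measurableT wHi qi; apply: eq_integrable.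
have := sub (radial a) (fun r => radial_ge0 r (pos la)) qi.
have k0 r : 0 <= wbar * H r - radial a r by rewrite subr_ge0 radial_le.
have := sub _ k0 ki; rewrite !RintegralB ?RintegralZl//; try exact: integrable_itv.
move=> h1 h2; rewrite distrC ger0_norm ?subr_ge0//; rewrite mulrBr -/H; lra.
Qed.

End Box.
End Radial.

Section RadialEstimates.
Variables (R : realType) (n : nat) (m : 'I_n.+1 -> nat) (d : R).
Hypothesis hd : -1 < d.
Let mu := @lebesgue_measure R.
Implicit Types a b : 'I_n.+1 -> R.
Local Notation wbar := (@wbar R n m).
Local Notation radial := (radial m d).

Lemma gamma_density_tail (lo e : R) : 0 < lo -> 0 < e -> exists delta M : R,
  [/\ 0 < delta, 0 < M & forall s t, s < delta -> M < t ->
   \int[mu]_r gamma_density d lo r - \int[mu]_(r in `[s, t]) gamma_density d lo r < e].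
Proof.
move=> lo0 e0; pose H := gamma_density d lo.
have Hi : mu.-integrable setT (EFin \o H) by exact: integrable_gamma_density.
have H0 r : (0 <= (H r)%:E)%E by rewrite lee_fin gamma_density_ge0.
have mH : measurable_fun setT (EFin \o H) by apply/measurable_EFinP; exact: measurable_gamma_density.
pose F k := `[(k.+2%:R^-1 : R), k.+2%:R]%classic.
have cv : (\int[mu]_(r in F k) (H r)%:E @[k --> \oo] --> \int[mu]_(r in `]0%R, +oo[) (H r)%:E)%E.
  rewrite -(bigcup_itv_oo R); apply: ge0_nondecreasing_set_cvg_integral => //.
  - move=> i j ij; apply/subsetPset => r; rewrite /F /= !in_itv /= => /andP[h1 h2].
    by rewrite (le_trans _ h1) ?lef_pV2 ?posrE ?ler_nat// (le_trans h2)// ler_nat.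
  - by move=> k; exact: measurable_itv.
  - by move=> k; exact: measurable_funTS.
have eH : (\int[mu]_(r in `]0%R, +oo[) (H r)%:E = \int[mu]_r (H r)%:E)%E.
  rewrite integral_mkcond; apply: eq_integral => r _; rewrite patchE mem_setE in_itv /= andbT.
  by rewrite /H /gamma_density; case: (0 < r).
have fF k : (\int[mu]_(r in F k) (H r)%:E)%E \is a fin_num.
  by apply: integrable_fin_num; [exact: measurable_itv|exact: integrable_itv].
have : \int[mu]_(r in F k) H r @[k --> \oo] --> \int[mu]_r H r.
  move: cv; rewrite eH -(EFin_Rintegral Hi) => /fine_cvgP[_]; exact.
move=> /cvgrPdist_lt/(_ e e0)[N _ HN].
exists (N.+2%:R^-1), (N.+2%:R); split=> [||s t s1 t1]; rewrite ?invr_gt0//.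
apply: le_lt_trans (HN N (leqnn _)); rewrite (le_trans _ (ler_norm _))// lerB//.
rewrite /Rintegral fine_le//.
- apply: integrable_fin_num; [exact: measurable_itv|exact: integrable_itv].
- apply: ge0_subset_integral => //; [exact: measurable_itv|exact: measurable_funTS|].
  move=> r; rewrite /F /= !in_itv /= => /andP[h1 h2].
  by rewrite (le_trans (ltW s1) h1) (le_trans h2 (ltW t1)).
Qed.

(** Scaling by r contributes a factor r, which turns r^d into r^(d+1), a nondecreasing power bounded
    by its value at t. *)
Lemma radial_lipschitz_base a b (t r : R) : (forall j, 0 < a j) -> (forall j, 0 < b j) ->
  0 < r -> r <= t ->
  `|radial a r - radial b r| <= wbar * t `^ (d + 1) * \sum_j `|a j - b j|.
Proof.
move=> a0 b0 r0 rt; rewrite /radial r0 -mulrBr normrM (ger0_norm (powR_ge0 _ _)).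
have h := kconv_lipschitz m (fun j => mulr_gt0 r0 (a0 j)) (fun j => mulr_gt0 r0 (b0 j)).
rewrite (le_trans (ler_wpM2l (powR_ge0 _ _) h))//.
have -> : \sum_j `|r * a j - r * b j| = r * \sum_j `|a j - b j|.
  by rewrite mulr_sumr; apply: eq_bigr => j _; rewrite -mulrBr normrM gtr0_norm.
have -> : r `^ d * (wbar * (r * \sum_j `|a j - b j|)) =
    wbar * (r `^ d * r) * \sum_j `|a j - b j| by ring.
rewrite ler_wpM2r ?sumr_ge0// ler_wpM2l ?wbar_ge0//.
rewrite -{2}[r]powRr1 ?(ltW r0)// -powRD; last by rewrite (gt_eqF r0) implybT.
have p0 : 0 <= d + 1 by rewrite -lerBlDr sub0r ltW.
by rewrite ge0_ler_powR ?nnegrE ?(ltW r0)// (le_trans (ltW r0)).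
Qed.

Variables (lo hi : R).
Hypothesis lo0 : 0 < lo.
Let box a := forall j, lo <= a j <= hi.

Let boxlo a : box a -> forall j, lo <= a j.
Proof. by move=> ha j; have /andP[] := ha j. Qed.

Let boxpos a : box a -> forall j, 0 < a j.
Proof. by move=> ha j; exact: lt_le_trans (boxlo ha j). Qed.

Lemma integral_radial_lipschitz (s t : R) : 0 < s -> s <= t -> exists2 L : R, 0 <= L &
  forall a b, box a -> box b ->
  `|\int[mu]_(r in `[s, t]) radial a r - \int[mu]_(r in `[s, t]) radial b r| <=
  L * \sum_j `|a j - b j|.
Proof.
move=> s0 st; exists (wbar * t `^ (d + 1) * (t - s)).
  by rewrite !mulr_ge0 ?wbar_ge0 ?powR_ge0 ?subr_ge0.
move=> a b ha hb; rewrite mulrAC; apply: Rintegral_close => //.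
- exact: (integrable_radial m hd lo0 (boxlo ha)).
- exact: (integrable_radial m hd lo0 (boxlo hb)).
move=> r /andP[sr rt]; apply: radial_lipschitz_base => //; try exact: boxpos.
exact: lt_le_trans sr.
Qed.

(** The maximum sits at one end or the other according to the sign of d; the sum covers both. *)
Lemma powR_bound (s t r : R) : 0 < s -> s <= r -> r <= t -> r `^ d <= s `^ d + t `^ d.
Proof.
move=> s0 sr rt; have r0 : 0 < r by exact: lt_le_trans sr.
have [d0|d0] := leP 0 d.
  by rewrite (@le_trans _ _ (t `^ d)) ?lerDr ?powR_ge0// ge0_ler_powR ?nnegrE ?(ltW r0)// (le_trans (ltW r0)).
rewrite (@le_trans _ _ (s `^ d)) ?lerDl ?powR_ge0//.
rewrite -(opprK d) !(powRN _ (- d)) lef_pV2 ?posrE ?powR_gt0//.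
by rewrite ge0_ler_powR ?nnegrE ?(ltW r0) ?(ltW s0)// oppr_ge0 ltW.
Qed.

Lemma radial_lipschitz_r (s t : R) : 0 < s -> exists2 L : R, 0 <= L &
  forall a r r', box a -> s <= r <= t -> s <= r' <= t ->
  `|radial a r - radial a r'| <= L * `|r - r'|.
Proof.
move=> s0; pose M := s `^ d + t `^ d.
have M0 : 0 <= M by rewrite addr_ge0 ?powR_ge0.
have hi0 : 0 <= `|hi| by [].
(* The two terms come from the product rule: variation of r^d times the bound on [kconv], and the
   bound M on r^d times the variation of [kconv], where n + 1 arguments move at speed at most
   |hi|. *)
exists (M * `|d| / s * wbar + M * (wbar * (n.+1%:R * `|hi|))).
  rewrite addr_ge0 ?mulr_ge0 ?wbar_ge0 ?invr_ge0//; exact: ltW.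
move=> a r r' ha /andP[sr rt] /andP[sr' rt'].
have r0 : 0 < r by exact: lt_le_trans sr.
have r'0 : 0 < r' by exact: lt_le_trans sr'.
have hr := powR_bound s0 sr rt; have hr' := powR_bound s0 sr' rt'.
rewrite /radial r0 r'0.
set g := kconv m (fun j => r * a j) 1; set g' := kconv m _ 1.
have -> : r `^ d * g - r' `^ d * g' = (r `^ d - r' `^ d) * g + r' `^ d * (g - g') by ring.
rewrite (le_trans (ler_normD _ _))// [leRHS]mulrDl lerD// normrM.
  have /andP[g0 g1] : 0 <= g <= wbar.
    have /andP[-> h] := kconv_le m (mulr_gt0 r0 lo0)
      (fun j => ler_wpM2l (ltW r0) (boxlo ha j)).
    rewrite (le_trans h)// ler_piMr ?wbar_ge0// -expR0 ler_expR oppr_le0.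
    by rewrite mulr_ge0 ?(ltW r0)// ltW.
  rewrite mulrAC ler_pM// ?(ger0_norm g0)//.
  exact: powR_lipschitz.
rewrite (ger0_norm (powR_ge0 _ _)) -mulrA ler_pM ?powR_ge0//.
have h := kconv_lipschitz m (fun j => mulr_gt0 r0 (boxpos ha j))
  (fun j => mulr_gt0 r'0 (boxpos ha j)).
rewrite (le_trans h)// -mulrA ler_wpM2l ?wbar_ge0//.
apply: (@le_trans _ _ (\sum_(j < n.+1) `|hi| * `|r - r'|)).
  apply: ler_sum => j _; rewrite -mulrBl normrM mulrC ler_wpM2r//.
  have /andP[h1 h2] := ha j; rewrite gtr0_norm ?boxpos//.
  by rewrite (le_trans h2)// ler_norm.
by rewrite sumr_const card_ord -mulrA mulr_natl.
Qed.

End RadialEstimates.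

(** * Slots and the operator identity *)

Section Slots.
Variables (R : realType) (A B : cstarAlgType R) (n : nat) (tens : ('I_n.+1 -> A) -> B).
Hypothesis htens : is_cstar_tensor_power tens.
Implicit Types (x y k : A) (j : 'I_n.+1).

Lemma slot1 j : slot tens 1 j = 1.
Proof.
case: htens => _ [t1 _] _ _ _; rewrite -t1 /slot; congr tens.
by apply/funext => i /=; case: ifP.
Qed.

Lemma slot_lin j (c : R[i]) x y : slot tens (c *: x + y) j = c *: slot tens x j + slot tens y j.
Proof. by case: htens => tl _ _ _ _; exact: tl. Qed.

Lemma slotM j x y : slot tens x j * slot tens y j = slot tens (x * y) j.
Proof.
case: htens => _ [_ tM] _ _ _; rewrite /slot -tM; congr tens.
by apply/funext => i /=; case: ifP; rewrite ?mulr1.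
Qed.

Lemma slot_comm i j k : slot tens k i * slot tens k j = slot tens k j * slot tens k i.
Proof.
case: htens => _ [_ tM] _ _ _; rewrite /slot -!tM; congr tens.
by apply/funext => l /=; case: (l == i); case: (l == j); rewrite ?mulr1 ?mul1r.
Qed.

Lemma slot_star j x : star x = x -> star (slot tens x j) = slot tens x j.
Proof.
move=> sx; case: htens => _ _ ts _ _; rewrite /slot -ts; congr tens.
by apply/funext => i /=; case: ifP; rewrite ?star1.
Qed.

Lemma slot_unit j x : x \is a GRing.unit -> slot tens x j \is a GRing.unit.
Proof.
move=> ux; apply/unitrP; exists (slot tens x^-1 j).
by rewrite !slotM mulVr// mulrV// slot1.
Qed.

Lemma slotBA j x (c : R[i]) : slot tens x j - c%:A = slot tens (x - c%:A) j.
Proof. by rewrite -scaleNr addrC -(slot1 j) -slot_lin scaleNr addrC. Qed.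

(** If the value a were at most 0, then k - a would be invertible, by positivity for a < 0 and by
    hypothesis for a = 0. Its slot is then invertible, with inverse in D by [suba_inv], although the
    character kills it. *)
Lemma char_slot_gt0 k chi j : cstar_positive k -> k \is a GRing.unit ->
  is_character (generated_cstar (range (slot tens k))) chi ->
  0 < complex.Re (chi (slot tens k j)).
Proof.
move=> [sk kp] uk hchi; set b := slot tens k; set D := generated_cstar _ in hchi *.
have hD : cstar_subalgebra D by exact: generated_suba.
have sb : star (b j) = b j by exact: slot_star.
have Db : D (b j) by apply: sub_generated; exists j.
set a := complex.Re _; rewrite ltNge; apply/negP => a0.
have uka : k - (a%:C)%:A \is a GRing.unit.
  apply/negPn/negP => nu; have := kp _ nu; rewrite ler0c => a1; move: nu.
  by rewrite (_ : a = 0) ?scale0r ?subr0 ?uk//; apply/le_anti; rewrite a0 a1.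
have ub : b j - (a%:C)%:A \is a GRing.unit by rewrite slotBA slot_unit.
have Dba : D (b j - (a%:C)%:A) by apply: (subaB hD) => //; exact: subaA.
have sba : star (b j - (a%:C)%:A) = b j - (a%:C)%:A.
  rewrite -scaleNr addrC starD starZ star1 sb; congr (_ *: _ + _).
  by apply/eqP; rewrite eq_complex /= !oppr0 !eqxx.
have := charM hchi Dba (suba_inv hD Dba sba ub).
rewrite mulrV// (charB hD hchi Db (subaA hD _)) (charA hD _ hchi).
rewrite (char_real hD hchi Db sb) subrr mul0r; case: hchi => -> _ _ /eqP.
by rewrite oner_eq0.
Qed.

(** The upper bound is a norm; the lower bound is the norm of the inverse, on which a character
    takes the reciprocal value. *)
Lemma slot_box k : cstar_positive k -> k \is a GRing.unit -> exists lo hi : R,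
  [/\ 0 < lo, lo < hi & forall chi, is_character (generated_cstar (range (slot tens k))) chi ->
    forall j, lo <= complex.Re (chi (slot tens k j)) <= hi].
Proof.
move=> kp uk; have [sk _] := kp; set b := slot tens k; set D := generated_cstar _.
have hD : cstar_subalgebra D by exact: generated_suba.
have sb j : star (b j) = b j by exact: slot_star.
have ub j : b j \is a GRing.unit by exact: slot_unit.
have Db j : D (b j) by apply: sub_generated; exists j.
have Dv j : D (b j)^-1 by exact: suba_inv.
pose N := \sum_j cnorm (b j)^-1 + 1; pose M := \sum_j cnorm (b j).
have le_sum (F : 'I_n.+1 -> R) j : (forall i, 0 <= F i) -> F j <= \sum_i F i.
  by move=> F0; rewrite (bigD1 j)//= lerDl sumr_ge0.
have N0 : 0 < N by rewrite ltr_wpDl// sumr_ge0// => j _; exact: cnorm_ge0.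
have M0 : 0 <= M by rewrite sumr_ge0// => j _; exact: cnorm_ge0.
have lo0 : 0 < N^-1 by rewrite invr_gt0.
(* N is positive thanks to its summand 1, and the second bound is enlarged so as to exceed the first
   strictly. *)
exists N^-1, (M + N^-1 + 1); split=> // [|chi hchi j].
  by rewrite -addrA addrCA ltrDl ltr_wpDl.
have a0 := char_slot_gt0 j kp uk hchi; set a := complex.Re _ in a0 *.
have aE : chi (b j) = a%:C by exact: (char_real hD hchi (Db j) (sb j)).
apply/andP; split; last first.
  apply: le_trans (ler_norm _) _; apply: le_trans (Re_le_cabs (chi (b j))) _.
  apply: le_trans (char_le hD hchi (Db j)) _.
  rewrite (@le_trans _ _ M)//; first by apply: le_sum => i; exact: cnorm_ge0.
  by rewrite -addrA lerDl addr_ge0// ltW.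
have hv : a * cabs (chi (b j)^-1) = 1.
  have : cabs (chi (b j * (b j)^-1)) = 1.
    by rewrite mulrV//; case: hchi => -> _ _; rewrite cabs1.
  by rewrite (charM hchi (Db j) (Dv j)) cabsM aE cabs_real gtr0_norm.
rewrite -div1r ler_pdivrMr// -hv ler_wpM2l ?(ltW a0)//.
rewrite (le_trans (char_le hD hchi (Dv j)))//.
apply: (@le_trans _ _ (\sum_j cnorm (b j)^-1)); last by rewrite lerDl.
by apply: (le_sum (fun j => cnorm (b j)^-1)) => i; exact: cnorm_ge0.
Qed.

(** The product telescopes. Indexing the slots by natural numbers through [inord] makes this an
    induction on the upper limit. *)
Lemma zeltE k (j : 'I_n) : k \is a GRing.unit ->
  zelt tens k j = 1 - (slot tens k ord0)^-1 * slot tens k (lift ord0 j).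
Proof.
move=> uk; rewrite /zelt; congr (1 - _).
pose b i := slot tens k (inord i); pose F i := (b i)^-1 * b i.+1.
transitivity (\prod_(i < n | (i < j.+1)%N) F i).
  apply: eq_bigr => i _; rewrite /F /b /yelt; congr ((slot tens k _)^-1 * slot tens k _).
    by apply: val_inj; rewrite /= inordK// ltnS ltnW.
  by apply: val_inj; rewrite /= inordK ?ltnS.
rewrite -(big_ord_widen n F (ltn_ord j)).
have -> : slot tens k (lift ord0 j) = b j.+1.
  by congr (slot tens k _); apply: val_inj; rewrite /= inordK ?ltnS.
have -> : slot tens k ord0 = b 0%N.
  by congr (slot tens k _); apply: val_inj; rewrite /= inordK.
elim: (j : nat) => [|i ih]; first by rewrite big_ord_recl big_ord0 mulr1.
rewrite big_ord_recr /= ih /F mulrA mulrK//; exact: slot_unit.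
Qed.

End Slots.

(** * From the scalar identity to the algebra *)

Section PositiveFamily.
Variables (R : realType) (B : cstarAlgType R) (n : nat) (b : 'I_n.+1 -> B).
Hypotheses (hb : forall j, star (b j) = b j) (hbC : forall i j, b i * b j = b j * b i).
Variables (lo hi : R).
Hypotheses (lo0 : 0 < lo) (lohi : lo < hi)
  (hbox : forall chi, is_character (generated_cstar (range b)) chi ->
    forall j, lo <= complex.Re (chi (b j)) <= hi).
Variables (alpha : 'I_n.+1 -> nat) (d : R).
Hypotheses (hn : (0 < n)%N) (halpha : forall j, (0 < alpha j)%N) (hd : -1 < d).

Let mu := @lebesgue_measure R.
Let D := generated_cstar (range b).
Let hD : cstar_subalgebra D := range_suba b.
Let m j := (alpha j).-1.
Let spec (chi : B -> R[i]) j := complex.Re (chi (b j)).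
Let box (a : 'I_n.+1 -> R) := forall j, lo <= a j <= hi.
Local Notation rad := (radial m d).
Local Notation wbar := (@wbar R n m).

Let boxlo a : box a -> forall j, lo <= a j.
Proof. by move=> ha j; have /andP[] := ha j. Qed.

Let boxpos a : box a -> forall j, 0 < a j.
Proof. by move=> ha j; exact: lt_le_trans (boxlo ha j). Qed.

Let specC chi j : is_character D chi -> chi (b j) = (spec chi j)%:C.
Proof. by move=> hchi; exact: (char_real hD hchi (range_gen _) (hb j)). Qed.

Definition integrand (r : R) : B :=
  (r `^ d)%:C *: joint_cfc (fun j => r%:C *: b j) (Gfun alpha).

(** The calculus of the scaled family refers to the algebra that this family generates; the
    identification makes all values of r live in the same D. *)
Lemma generated_scale (r : R) : 0 < r ->
  generated_cstar (range (fun j => r%:C *: b j)) = D.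
Proof.
move=> r0; apply/seteqP; split; apply: generated_min; try exact: generated_suba.
  by move=> _ [j _ <-]; apply: (subaZ hD); exact: range_gen.
move=> _ [j _ <-].
have -> : b j = (r^-1)%:C *: (r%:C *: b j).
  by rewrite scalerA -rmorphM mulVf ?gt_eqF// scale1r.
by apply: (subaZ (generated_suba _)); apply: sub_generated; exists j.
Qed.

Lemma integrandP r : 0 < r -> D (integrand r) /\
  forall chi, is_character D chi -> chi (integrand r) = (rad (spec chi) r)%:C.
Proof.
move=> r0.
have [y Dy hy] : realizable b (fun a => kconv m (fun j => r * a j) 1).
  apply: (realizable_lipschitz hb hbC lohi hbox (L := wbar * r)).
    by rewrite mulr_ge0 ?wbar_ge0 ?ltW.
  move=> x z hx hz; have := kconv_lipschitz m (fun j => mulr_gt0 r0 (boxpos hx j))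
    (fun j => mulr_gt0 r0 (boxpos hz j)).
  rewrite -mulrA [r * _]mulr_sumr; congr (_ <= _ * _); apply: eq_bigr => j _.
  by rewrite -mulrBr normrM gtr0_norm.
have -> : integrand r = (r `^ d)%:C *: y.
  congr (_ *: _); apply: joint_cfcE.
  - move=> j; rewrite starZ hb; congr (_ *: _).
    by apply/eqP; rewrite eq_complex /= !oppr0 !eqxx.
  - by move=> i j; rewrite -!scalerAl -!scalerAr hbC.
  - by rewrite generated_scale.
  move=> chi; rewrite generated_scale// => hchi; rewrite hy//.
  rewrite -(Gfun_kconv hn halpha) => [|j]; last by rewrite mulr_gt0// (boxpos (hbox hchi)).
  congr Gfun; apply/funext => j.
  by rewrite (charZ hD _ hchi (range_gen _)) specC// -rmorphM.
split; first exact: (subaZ hD).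
by move=> chi hchi; rewrite (charZ hD _ hchi Dy) hy// -rmorphM /radial r0.
Qed.

Lemma realizable_partial_integral (s t : R) : 0 < s -> s <= t ->
  realizable b (fun a => \int[mu]_(r in `[s, t]) rad a r).
Proof.
move=> s0 st; have [L L0 hL] := @integral_radial_lipschitz R n m d hd lo hi lo0 s t s0 st.
exact: (realizable_lipschitz hb hbC lohi hbox L0).
Qed.

Lemma radial_tail_uniform e : 0 < e -> exists delta M : R, [/\ 0 < delta, 0 < M &
  forall s t, s < delta -> M < t -> forall a, box a ->
  `|\int[mu]_(r in `[s, t]) rad a r - \int[mu]_r rad a r| <= e].
Proof.
move=> e0; have w0 : 0 <= wbar by exact: wbar_ge0.
have w1 : 0 < wbar + 1 by rewrite ltr_wpDl.
have [delta [M [d0 M0 H]]] := gamma_density_tail hd lo0 (divr_gt0 e0 w1).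
exists delta, M; split=> // s t sd tM a ha.
rewrite (le_trans (radial_tail m hd lo0 s t (boxlo ha)))//.
rewrite (le_trans (ler_wpM2l w0 (ltW (H s t sd tM))))//.
by rewrite mulrCA ler_piMr ?(ltW e0)// ler_pdivrMr// mul1r lerDl.
Qed.

(** The Lipschitz constant available on [s, t] grows with t, so the full integral is reached as a
    uniform limit over the box. *)
Lemma realizable_integral : realizable b (fun a => \int[mu]_r rad a r).
Proof.
apply: (realizable_lim hb hbC hbox) => e e0.
have [delta [M [d0 M0 H]]] := radial_tail_uniform e0.
(* The number 1 is placed between s and t, which guarantees s <= t. *)
pose s := Num.min (delta / 2) 1; pose t := M + 1.
have s0 : 0 < s by rewrite lt_min ltr01 divr_gt0.
have sd : s < delta by rewrite gt_min ltr_pdivrMr// ltr_pMr// ltr1n.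
have st : s <= t by rewrite (@le_trans _ _ 1) ?ge_min ?lexx ?orbT// lerDr ltW.
have tM : M < t by rewrite ltrDl.
exists (fun a => \int[mu]_(r in `[s, t]) rad a r); first exact: realizable_partial_integral.
by move=> a ha; rewrite distrC; exact: H.
Qed.

(** Both Riemann sums and tails are measured through characters, where the scalar bounds are uniform
    over the box; this is what upgrades convergence at each character to convergence in norm. *)
Lemma improper_integral (J : B) : D J ->
  (forall chi, is_character D chi -> chi J = (\int[mu]_r rad (spec chi) r)%:C) ->
  is_improper_integral integrand J.
Proof.
move=> DJ hJ.
have /choice[I hI] : forall st : R * R, exists y, 0 < st.1 -> st.1 <= st.2 -> D y /\
    forall chi, is_character D chi ->
      chi y = (\int[mu]_(r in `[st.1, st.2]) rad (spec chi) r)%:C.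
  move=> [s t] /=; have [s0|] := ltP 0 s; last by exists 0.
  have [st|] := leP s t; last by exists 0.
  by have [y Dy hy] := realizable_partial_integral s0 st; exists y.
exists (fun s t => I (s, t)) => [s t s0 st|e e0]; last first.
  have e2 : 0 < e / 2 by rewrite divr_gt0.
  have [delta [M [d0 M0 H]]] := radial_tail_uniform e2.
  exists delta, M; split=> // s t s0 sd Mt st; have [DI cI] := hI (s, t) s0 st.
  apply: (@le_lt_trans _ _ (e / 2)); last by rewrite ltr_pdivrMr// ltr_pMr// ltr1n.
  apply: (cnorm_le_char hD (range_comm hb hbC) (subaB hD DI DJ)) => chi hchi.
  rewrite (charB hD hchi DI DJ) cI// hJ// -rmorphB cabs_real.
  by apply: H => //; exact: hbox.
have [DI cI] := hI (s, t) s0 st.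
have [L L0 hL] := @radial_lipschitz_r R n m d lo hi lo0 s t s0.
move=> e e0; pose K := L * (t - s) + 1.
have K0 : 0 < K by rewrite ltr_wpDl// mulr_ge0// subr_ge0.
(* With this mesh the total error is at most L (t - s) e / K, which is less than e by the summand 1
   in K. *)
exists (e / K); first by rewrite divr_gt0.
move=> N p tg p0 pN hp.
have tgI i : (i < N)%N -> s <= tg i <= t.
  move=> iN; have [h1 h2 _] := hp i iN.
  have pm := partition_mono (fun i iN => let: And3 h h' _ := hp i iN in le_trans h h').
  by rewrite -p0 -pN (le_trans (pm _ _ (leq0n i) (ltnW iN)) h1) (le_trans h2 (pm _ _ iN (leqnn N))).
have tg0 i : (i < N)%N -> 0 < tg i by move=> /tgI /andP[h _]; exact: lt_le_trans h.
apply: (@le_lt_trans _ _ (L * (e / K) * (t - s))); last first.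
  by rewrite mulrAC mulrA ltr_pdivrMr// [ltRHS]mulrC ltr_pM2r// ltrDl.
have Df (i : 'I_N) : D ((p i.+1 - p i)%:C *: integrand (tg i)).
  by apply: (subaZ hD); have [] := integrandP (tg0 i (ltn_ord i)).
have DS : D (\sum_(i < N) (p i.+1 - p i)%:C *: integrand (tg i)) by exact: (suba_sum hD).
apply: (cnorm_le_char hD (range_comm hb hbC) (subaB hD DS DI)) => chi hchi.
rewrite (charB hD hchi DS DI) cI// (char_sum hD _ hchi)//.
have -> : \sum_(i < N) chi ((p i.+1 - p i)%:C *: integrand (tg i)) =
    (\sum_(i < N) (p i.+1 - p i) * rad (spec chi) (tg i))%:C.
  rewrite rmorph_sum; apply: eq_bigr => i _.
  have [Di hi'] := integrandP (tg0 i (ltn_ord i)).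
  by rewrite (charZ hD _ hchi Di) hi'// -rmorphM.
rewrite -rmorphB cabs_real; apply: riemann_sum_close => //.
- exact: (integrable_radial m hd lo0 (boxlo (hbox hchi))).
- by move=> r r' hr hr'; apply: hL => //; exact: hbox.
Qed.

Let p := d + 1.
Let p0 : 0 < p. Proof. by rewrite -ltrBlDr sub0r. Qed.
Let c := (\sum_j alpha j)%N%:R : R.
Let lmin := lo / hi.
Let lmax := hi / lo.
Let hi0 : 0 < hi. Proof. exact: lt_trans lohi. Qed.
Let lmin0 : 0 < lmin. Proof. exact: divr_gt0. Qed.
Let lhi1 : 1 - lmin < 1. Proof. by rewrite ltrBlDr ltrDl. Qed.

Let ratio_box a i j : box a -> lmin <= a i / a j <= lmax.
Proof.
move=> ha; have /andP[i1 i2] := ha i; have /andP[j1 j2] := ha j; have aj := boxpos ha j.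
rewrite ler_pdivlMr// ler_pdivrMr//; apply/andP; split.
  by rewrite /lmin mulrAC ler_pdivrMr// ler_pM// ?(ltW aj) ?(ltW lo0).
by rewrite /lmax mulrAC ler_pdivlMr// ler_pM// ?(ltW lo0)// (le_trans (ltW lo0)).
Qed.

Lemma realizable_powR : realizable b (fun a => a ord0 `^ p).
Proof.
apply: (realizable_lipschitz hb hbC lohi hbox (L := hi `^ p * `|p| / lo)).
  by rewrite divr_ge0 ?mulr_ge0 ?powR_ge0 ?(ltW lo0).
move=> x y hx hy; have /andP[x1 x2] := hx ord0; have /andP[y1 y2] := hy ord0.
have le_hi (t : R) : lo <= t -> t <= hi -> t `^ p <= hi `^ p.
  by move=> t1 t2; rewrite ge0_ler_powR ?nnegrE ?(ltW p0) ?(ltW hi0) ?(le_trans (ltW lo0)).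
rewrite (le_trans (powR_lipschitz lo0 x1 y1 (le_hi _ x1 x2) (le_hi _ y1 y2)))//.
rewrite ler_wpM2l ?divr_ge0 ?mulr_ge0 ?powR_ge0 ?(ltW lo0)//.
by rewrite big_ord_recl lerDl sumr_ge0.
Qed.

Hypothesis hu : forall j, b j \is a GRing.unit.

Let z (j : 'I_n) : B := 1 - (b ord0)^-1 * b (lift ord0 j).

(** The calculus in z takes place in the algebra generated by z, which lies in D. The element is
    realized there, and its transform on D follows because characters of D restrict. *)
Lemma lauricella_element : exists2 y, D y &
  joint_cfc z (fun x => (lauricellaD p (fun j => (alpha (lift ord0 j))%:R) c x)%:C) = y /\
  forall chi, is_character D chi -> chi y = (Gamma c * wint m (fun u =>
    (1 - \sum_j (1 - spec chi (lift ord0 j) / spec chi ord0) * u j) `^ (- p)))%:C.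
Proof.
have comm := range_comm hb hbC; have Db j : D (b j) by exact: range_gen.
have Dv : D (b ord0)^-1 by exact: suba_inv.
have Dw j : D ((b ord0)^-1 * b (lift ord0 j)) by exact: (subaM hD).
have Dz j : D (z j) by apply: (subaB hD) => //; exact: (suba1 hD).
have sz j : star (z j) = z j.
  rewrite /z -scaleN1r starD star1 starZ starM hb (star_inv (hb ord0) (hu ord0)).
  rewrite -(comm _ _ Dv (Db (lift ord0 j))).
  congr (_ + _ *: _).
  by apply/eqP; rewrite eq_complex /= !oppr0 !eqxx.
have zC i i' : z i * z i' = z i' * z i by exact: (comm _ _ (Dz i) (Dz i')).
have DzD : generated_cstar (range z) `<=` D by apply: generated_min => // _ [i _ <-].
have hDz := range_suba z.
have mono chi : is_character D chi -> is_character (generated_cstar (range z)) chi.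
  by case=> c1 cl cM; split=> // [t x y /DzD Dx /DzD Dy|x y /DzD Dx /DzD Dy]; [exact: cl|exact: cM].
have chiw chi j : is_character D chi ->
    chi ((b ord0)^-1 * b (lift ord0 j)) = (spec chi (lift ord0 j) / spec chi ord0)%:C.
  move=> hchi; have s0 : (spec chi ord0)%:C != 0.
    by rewrite eq_complex /= eqxx andbT gt_eqF// (boxpos (hbox hchi)).
  apply: (mulfI s0); rewrite -specC// -(charM hchi)// mulrA mulrV// mul1r !specC//.
  rewrite -rmorphM; congr (_%:C); rewrite mulrC divfK//.
  by rewrite gt_eqF// (boxpos (hbox hchi)).
have chiz chi j : is_character D chi ->
    chi (z j) = (1 - spec chi (lift ord0 j) / spec chi ord0)%:C.
  move=> hchi; rewrite (charB hD hchi (suba1 hD) (Dw j)) chiw//.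
  by rewrite rmorphB; case: hchi => ->.
(* A character of the smaller algebra is not known to come from D, so a norm is used instead. For w
   = 1 - z_j the characters of D give |lmax - w| <= lmax - lmin, and every character of the smaller
   algebra respects this; hence w >= lmin and z_j stays below 1. *)
have zbox chi : is_character (generated_cstar (range z)) chi ->
    forall j, 1 - 2 * lmax <= complex.Re (chi (z j)) <= 1 - lmin.
  move=> hchi j; have Dzj : generated_cstar (range z) (z j) by exact: range_gen.
  set r := complex.Re _.
  have DA t := subaA hDz t.
  have D1z : D (lmax%:C%:A - (b ord0)^-1 * b (lift ord0 j)).
    by apply: (subaB hD) => //; exact: (subaA hD).
  have nw : cnorm (lmax%:C%:A - (b ord0)^-1 * b (lift ord0 j)) <= lmax - lmin.
    apply: (cnorm_le_char hD comm D1z) => psi hpsi.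
    rewrite (charB hD hpsi (subaA hD _) (Dw j)) (charA hD _ hpsi) chiw// -rmorphB cabs_real.
    have /andP[h1 h2] := ratio_box (lift ord0 j) ord0 (hbox hpsi).
    by rewrite ger0_norm ?subr_ge0// lerB.
  have e : lmax%:C%:A - (b ord0)^-1 * b (lift ord0 j) = lmax%:C%:A - (1 - z j).
    by rewrite /z subKr.
  have D1 : generated_cstar (range z) (1 - z j) by apply: (subaB hDz) => //; exact: (suba1 hDz).
  have := le_trans (char_le hDz hchi (subaB hDz (DA lmax%:C) D1)) _.
  rewrite -e => /(_ _ nw); rewrite e (charB hDz hchi (DA _) D1) (charA hDz _ hchi).
  rewrite (charB hDz hchi (suba1 hDz) Dzj) (char_real hDz hchi Dzj (sz j)) -/r.
  have -> : chi 1 = 1%:C by case: hchi.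
  rewrite -!rmorphB cabs_real ler_norml => /andP[h1 h2].
  by apply/andP; split; move: lmin0; lra.
have [C C0 hC] := wint_lauricella_lipschitz m p0 lhi1.
have lohi' : 1 - 2 * lmax < 1 - lmin.
  have h1 : 1 < lmax by rewrite ltr_pdivlMr// mul1r.
  have h2 : lmin < 1 by rewrite ltr_pdivrMr// mul1r.
  by lra.
have [y Dy hy] : realizable z (fun x => Gamma c * wint m (fun u => (1 - \sum_j x j * u j) `^ (- p))).
  apply: (realizable_lipschitz sz zC lohi' zbox (L := `|Gamma c| * C)); first by rewrite mulr_ge0.
  move=> x x' hx hx'; rewrite -mulrBr normrM -mulrA ler_wpM2l//.
  by apply: hC => j; [have /andP[] := hx j|have /andP[] := hx' j].
exists y; first exact: DzD.
split.
  apply: (joint_cfcE sz zC Dy) => chi hchi; rewrite hy//; congr (_%:C).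
  apply/esym; apply: (lauricellaD_wint p0 lhi1) => // j.
  by have /andP[] := zbox _ hchi j.
move=> chi hchi; rewrite hy; last exact: mono.
congr ((_ * wint m _)%:C); apply/funext => u; congr ((1 - _) `^ _).
by apply: eq_bigr => j _; rewrite chiz.
Qed.

Theorem radial_integral_lauricella : exists2 J : B, is_improper_integral integrand J
  & joint_cfc b (fun a => (a ord0 `^ p)%:C) * J =
    (Gamma p / Gamma c)%:C *:
    joint_cfc z (fun x => (lauricellaD p (fun j => (alpha (lift ord0 j))%:R) c x)%:C).
Proof.
have comm := range_comm hb hbC.
have [J DJ hJ] := realizable_integral.
have [P DP hP] := realizable_powR.
have [y Dy [-> hy]] := lauricella_element.
exists J; first exact: improper_integral.
rewrite (joint_cfcE hb hbC DP hP).
(* Both sides lie in D, so scalars are compared: the factor a_0^(d+1) turns the radial integral into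
   Gamma (d + 1) times the Lauricella integral, and Gamma c cancels. *)
apply: (char_inj hD comm (subaM hD DP DJ) (subaZ hD _ Dy)) => chi hchi.
rewrite (charM hchi DP DJ) (charZ hD _ hchi Dy) hP// hJ// hy// -!rmorphM; congr (_%:C).
have hb' := hbox hchi.
rewrite (integral_radial m hd lo0 (boxlo hb')) mulrCA -/p.
rewrite (wint_linform m p0 lhi1 (boxpos hb')) => [|j]; last first.
  by have /andP[h _] := ratio_box (lift ord0 j) ord0 hb'; rewrite lerB.
have c0 : Gamma c != 0.
  rewrite /c -(prednK (n := \sum_j alpha j)%N) ?Gamma_nat; last by rewrite big_ord_recl ltn_addr.
  by rewrite pnatr_eq0 -lt0n fact_gt0.
by rewrite mulrA divfK.
Qed.

End PositiveFamily.

Unset Implicit Arguments.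
Set Strict Implicit.
Set Printing Implicit Defensive.

Theorem proposition2p4 (R : realType) (A B : cstarAlgType R) (n : nat)
    (tens : ('I_n.+1 -> A) -> B) (k : A) (alpha : 'I_n.+1 -> nat) (d : R)
    (hn : (0 < n)%N)
    (htens : is_cstar_tensor_power tens)
    (kpos : cstar_positive k) (kunit : k \is a GRing.unit)
    (halpha : forall j, (0 < alpha j)%N) (hd : -1 < d) :
  exists2 J : B,
    is_improper_integral
      (fun r : R => (r `^ d)%:C *:
         joint_cfc (fun j => r%:C *: slot tens k j) (Gfun alpha)) J
    & joint_cfc (slot tens k) (fun a => (a ord0 `^ (d + 1))%:C) * J =
      (Gamma (d + 1) / Gamma (\sum_j alpha j)%N%:R)%:C *:
      joint_cfc (zelt tens k)
        (fun x => (lauricellaD (d + 1) (fun j : 'I_n => (alpha (lift ord0 j))%:R)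
                     (\sum_j alpha j)%N%:R x)%:C).
Proof.
have [lo [hi [lo0 lohi hbox]]] := slot_box htens kpos kunit; have [sk _] := kpos.
have -> : zelt tens k = fun j => 1 - (slot tens k ord0)^-1 * slot tens k (lift ord0 j).
  by apply/funext => j; exact: zeltE.
exact: (radial_integral_lauricella (fun j => slot_star htens j sk)
  (fun i j => slot_comm htens i j k) lo0 lohi hbox hn halpha hd
  (fun j => slot_unit htens j kunit)).
Qed.
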